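(* Let $c_{\mathrm{ww}}(\kappa)=\sqrt{\tanh\kappa/\kappa}$ (with $c_{\mathrm{ww}}(0)=1$), and for $\kappa>0$ let $c_{\mathrm{ww}}^2(\kappa|\partial_z|)$ denote the Fourier multiplier acting on $2\pi$-periodic functions by $c_{\mathrm{ww}}^2(\kappa|\partial_z|)e^{inz}=c_{\mathrm{ww}}^2(n\kappa)e^{inz}$, $n\in\mathbb{Z}$. Consider the system $$-c\eta+u+u\eta=(1-c^2)b_1,\qquad -cu+c_{\mathrm{ww}}^2(\kappa|\partial_z|)\eta+\tfrac12u^2=(1-c^2)b_2$$ for $2\pi$-periodic functions $\eta,u$ of $z$, a speed $c$, and parameters $\kappa>0$, $b_1,b_2\in\mathbb{R}$. Then for any $\kappa>0$ and any $b_1,b_2\in\mathbb{R}$ with $|b_1|,|b_2|$ sufficiently small, there exists a one-parameter family of solutions $\eta(a;\kappa,b_1,b_2)(z)$, $u(a;\kappa,b_1,b_2)(z)$, $c(a;\kappa,b_1,b_2)$, for $a\in\mathbb{R}$ with $|a|$ sufficiently small, such that $\eta$ and $u$ are $2\pi$-periodic, even and smooth in $z$, $c$ is even in $a$, and $\eta,u,c$ depend analytically on $a,\kappa,b_1,b_2$. Moreover, as $a,b_1,b_2\to0$, $$\eta(a;\kappa,b_1,b_2)(z)=\eta_0(\kappa,b_1,b_2)+a\cos z+a(b_1c_{\mathrm{ww}}(\kappa)+b_2)\cos z+a^2(h_0+h_2\cos2z)+O(a(a+b_1+b_2)^2),$$ $$u(a;\kappa,b_1,b_2)(z)=u_0(\kappa,b_1,b_2)+ac_{\mathrm{ww}}(\kappa)\cos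 z+\tfrac12ac_{\mathrm{ww}}(\kappa)(b_1c_{\mathrm{ww}}(\kappa)+b_2)\cos z+a^2c_{\mathrm{ww}}(\kappa)\Big(h_0-\tfrac12+\big(h_2-\tfrac12\big)\cos2z\Big)+O(a(a+b_1+b_2)^2),$$ $$c(a;\kappa,b_1,b_2)=c_0(\kappa,b_1,b_2)+\tfrac34a^2c_{\mathrm{ww}}(\kappa)(2h_0+h_2-1)+O(a(a+b_1+b_2)^2),$$ where, as $b_1,b_2\to0$, $$\eta_0=b_1c_{\mathrm{ww}}(\kappa)+b_2+O((b_1+b_2)^2),\quad u_0=b_1+b_2c_{\mathrm{ww}}(\kappa)+O((b_1+b_2)^2),$$ $$c_0=c_{\mathrm{ww}}(\kappa)+b_1\big(\tfrac12c_{\mathrm{ww}}^2(\kappa)+1\big)+\tfrac32b_2c_{\mathrm{ww}}(\kappa)+O((b_1+b_2)^2),$$ and $$h_0=\frac34\frac{c_{\mathrm{ww}}^2(\kappa)}{c_{\mathrm{ww}}^2(\kappa)-1},\qquad h_2=\frac34\frac{c_{\mathrm{ww}}^2(\kappa)}{c_{\mathrm{ww}}^2(\kappa)-c_{\mathrm{ww}}^2(2\kappa)}.$$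
   Context: The system describes $2\pi/\kappa$-periodic traveling waves $\eta(\kappa(x-ct)),u(\kappa(x-ct))$ of the normalized full-dispersion shallow water equations $\partial_t\eta+\partial_xu+\partial_x(u\eta)=0$, $\partial_tu+c_{\mathrm{ww}}^2(|\partial_x|)\partial_x\eta+u\partial_xu=0$, where $c_{\mathrm{ww}}^2(|\partial_x|)$ is the Fourier multiplier with symbol $c_{\mathrm{ww}}^2(k)$. *)

(* Defs.v *)
From Stdlib Require Import Reals.
From Coquelicot Require Import Coquelicot.
Open Scope R_scope.

Definition tanh (x : R) : R := (exp x - exp (- x)) / (exp x + exp (- x)).

Definition cww (k : R) : R :=
  if Req_EM_T k 0 then 1 else sqrt (tanh k / k).

Definition cww2 (k : R) : R := (cww k) ^ 2.

(* real Fourier coefficients of a 2*pi-periodic function: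
   f(z) ~ sum_{n>=0} (fa f n cos(nz) + fb f n sin(nz)) *)
Definition fa (f : R -> R) (n : nat) : R :=
  match n with
  | O => / (2 * PI) * RInt f 0 (2 * PI)
  | _ => / PI * RInt (fun z => f z * cos (INR n * z)) 0 (2 * PI)
  end.

Definition fb (f : R -> R) (n : nat) : R :=
  / PI * RInt (fun z => f z * sin (INR n * z)) 0 (2 * PI).

(* (c_ww^2(kappa |d_z|) f)(z) = v : the Fourier multiplier
   e^{inz} |-> c_ww^2(n kappa) e^{inz}, written in real form
   (c_ww is even, so c_ww^2(|n| kappa) pairs e^{inz} and e^{-inz}).
   The series is required to converge to v. *)
Definition fourier_mult (kappa : R) (f : R -> R) (z v : R) : Prop :=
  is_series (fun n : nat => cww2 (INR n * kappa) *
                 (fa f n * cos (INR n * z) + fb f n * sin (INR n * z))) v.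

Definition periodic2pi (f : R -> R) : Prop := forall z, f (z + 2 * PI) = f z.
Definition even_fun (f : R -> R) : Prop := forall z, f (- z) = f z.
Definition smooth (f : R -> R) : Prop := forall (n : nat) (z : R), ex_derive_n f n z.

Definition tw_system (kappa b1 b2 c : R) (eta u : R -> R) : Prop :=
  forall z,
    - c * eta z + u z + u z * eta z = (1 - c ^ 2) * b1 /\
    exists v, fourier_mult kappa eta z v /\
      - c * u z + v + / 2 * u z ^ 2 = (1 - c ^ 2) * b2.

Definition cube_sum (N : nat) (t : nat -> nat -> nat -> nat -> R) : R :=
  sum_f_R0 (fun i => sum_f_R0 (fun j => sum_f_R0 (fun k =>
    sum_f_R0 (fun l => t i j k l) N) N) N) N.

(* Real analyticity of a z-indexed family F(x1,x2,x3,x4)(z) at p, jointly in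
   (x1,x2,x3,x4) and uniformly in z: F is given near p by an absolutely
   convergent power series whose coefficients (functions of z) are bounded
   in sup norm (i.e. analyticity with values in bounded functions of z with
   the sup norm). *)
Definition analytic4_at (F : R -> R -> R -> R -> R -> R) (p1 p2 p3 p4 : R) : Prop :=
  exists (rho : R) (coef : nat -> nat -> nat -> nat -> R -> R)
         (B : nat -> nat -> nat -> nat -> R) (M : R),
    0 < rho /\
    (forall i j k l z, Rabs (coef i j k l z) <= B i j k l) /\
    (forall N, cube_sum N (fun i j k l => B i j k l * rho ^ (i + j + k + l)) <= M) /\
    (forall x1 x2 x3 x4, Rabs (x1 - p1) < rho -> Rabs (x2 - p2) < rho ->
       Rabs (x3 - p3) < rho -> Rabs (x4 - p4) < rho ->
       forall z, is_lim_seq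
         (fun N => cube_sum N (fun i j k l => coef i j k l z *
              (x1 - p1) ^ i * (x2 - p2) ^ j * (x3 - p3) ^ k * (x4 - p4) ^ l))
         (F x1 x2 x3 x4 z)).

(* Main.v *)
(* Write [h = 1 + eta] and [w = c - u]; the equations become [w h = const] and
   [w^2 / 2 + L h = const], and they are invariant under [w -> l w], [h -> l^2 h].  After scaling,
   [h = La (1 + a F)], [w = nu (1 + a G)] with [(1 + a F) (1 + a G) = 1], where [F] has mean zero and
   unit first cosine coefficient.  The modes [n >= 2] and [n = 1] of the second equation turn into a
   fixed point problem [F = cos z + a S(a, F)], a contraction for small [a]; it involves only [a] and
   [kappa].  The speed and the two scaling factors then solve scalar equations with parameters
   [b1, b2], again by contraction.  Both iterations are defined globally in the parameters, so their
   limits do not depend on a base point; analyticity near each point follows because the contractions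
   hold in a Banach algebra of power series in the parameters with values in a weighted Wiener
   algebra in [z]. *)
Require Import Defs.
From Stdlib Require Import Reals Lra Lia List FinFun Cantor Factorial IndefiniteDescription.
From Coquelicot Require Import Coquelicot.
Open Scope R_scope.

(** * Double series *)

(** Mode [n] of the linearized problem is divided by [1 - l_n], where [l_n] is the quotient of
    [cww2 (n kappa)] by [cww2 kappa]. For [n >= 2] these factors do not vanish because tanh is
    strictly subadditive. One radius in kappa serves all of them because [l_n] decays like [1/n]:
    large [n] are handled together by a geometric series, the finitely many others one by one. The
    mean is governed by [1 - cww2 kappa], nonzero since [tanh x < x].

    The remainders in the expansions carry a factor [|a|], also when [b1] and [b2] dominate. A
    Taylor estimate in all small parameters does not show this factor. The speed equations are
    therefore compared with the same equations at [a = 0]. The difference solves a linear system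
    with small coefficients whose inhomogeneity comes only from the coupling to the profile, which
    is [O(a^2)]. *)

Definition abs_bounded (u : nat -> R) (B : R) : Prop :=
  forall n, sum_f_R0 (fun k => Rabs (u k)) n <= B.

Lemma is_series_lim_seq (u : nat -> R) (l : R) :
  is_series u l <-> is_lim_seq (sum_f_R0 u) l.
Proof.
  split; intros H.
  - apply (is_lim_seq_ext (sum_n u)); [intros; apply sum_n_Reals | exact H].
  - apply (is_lim_seq_ext _ (sum_n u)) in H; [exact H | intros; symmetry; apply sum_n_Reals].
Qed.

Lemma sum_f_R0_nonneg (u : nat -> R) n : (forall k, 0 <= u k) -> 0 <= sum_f_R0 u n.
Proof. intros H; induction n; simpl; [auto | specialize (H (S n)); lra]. Qed.

Lemma abs_bounded_ge0 u B : abs_bounded u B -> 0 <= B.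
Proof.
  intros H. eapply Rle_trans; [| exact (H O)]. simpl; apply Rabs_pos.
Qed.

Lemma abs_bounded_le u v B C :
  abs_bounded v B -> (forall k, Rabs (u k) <= Rabs (v k)) -> B <= C -> abs_bounded u C.
Proof.
  intros H Huv HBC n. eapply Rle_trans; [| eapply Rle_trans; [exact (H n) | exact HBC]].
  apply sum_Rle; intros; auto.
Qed.
Arguments abs_bounded_le {u} {v} {B} {C}.

Lemma abs_bounded_ext u v B : (forall k, u k = v k) -> abs_bounded u B -> abs_bounded v B.
Proof.
  intros E H; apply (abs_bounded_le H); [intros; rewrite E|]; lra.
Qed.

Lemma abs_bounded_scal c u B : abs_bounded u B -> abs_bounded (fun k => c * u k) (Rabs c * B).
Proof.
  intros H n. rewrite (sum_eq _ (fun k => Rabs (u k) * Rabs c)).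
  - rewrite <- scal_sum. apply Rmult_le_compat_l; [apply Rabs_pos | apply H].
  - intros; rewrite Rabs_mult; ring.
Qed.

Lemma abs_bounded_scal_pos c u B :
  0 <= c -> abs_bounded u B -> abs_bounded (fun k => c * u k) (c * B).
Proof. intros Hc H; pose proof (abs_bounded_scal c u B H) as K; rewrite Rabs_pos_eq in K; auto. Qed.

Lemma nonneg_sum_le_ex_series (u : nat -> R) B :
  (forall k, 0 <= u k) -> (forall n, sum_f_R0 u n <= B) -> exists l, is_series u l.
Proof.
  intros Hp H.
  destruct (ex_finite_lim_seq_incr (sum_f_R0 u) B) as [l Hl].
  - intros n; simpl. specialize (Hp (S n)); lra.
  - exact H.
  - exists l. apply is_series_lim_seq; exact Hl.
Qed.

Lemma abs_bounded_ex_series u B : abs_bounded u B -> exists l, is_series u l.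
Proof.
  intros H. destruct (nonneg_sum_le_ex_series (fun k => Rabs (u k)) B) as [l Hl].
  - intros; apply Rabs_pos.
  - exact H.
  - destruct (ex_series_Rabs u) as [s Hs]; [exists l; exact Hl | exists s; exact Hs].
Qed.

Lemma Rabs_sum_f_R0_le u n : Rabs (sum_f_R0 u n) <= sum_f_R0 (fun k => Rabs (u k)) n.
Proof. apply Rsum_abs. Qed.

Lemma is_lim_seq_le_const (u : nat -> R) (l B : R) :
  is_lim_seq u l -> (forall n, u n <= B) -> l <= B.
Proof.
  intros H Hu. apply (is_lim_seq_le u (fun _ => B) l B Hu H). apply is_lim_seq_const.
Qed.

Lemma is_series_le_bound u (l B : R) :
  is_series u l -> (forall n, sum_f_R0 u n <= B) -> l <= B.
Proof. intros H; apply is_lim_seq_le_const. apply is_series_lim_seq; exact H. Qed.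
Arguments is_series_le_bound {u} {l} {B}.

Lemma is_series_nonneg_partial u (l : R) n :
  (forall k, 0 <= u k) -> is_series u l -> sum_f_R0 u n <= l.
Proof.
  intros Hp H. apply is_series_lim_seq in H.
  apply (is_lim_seq_incr_compare _ _ H). intros k; simpl; specialize (Hp (S k)); lra.
Qed.

Lemma is_series_abs_bounded u (l B : R) : is_series u l -> abs_bounded u B -> Rabs l <= B.
Proof.
  intros H HB. apply is_series_lim_seq in H.
  apply is_lim_seq_abs in H.
  refine (is_lim_seq_le_const _ (Rabs l) _ H _).
  intros n; eapply Rle_trans; [apply Rabs_sum_f_R0_le | apply HB].
Qed.

Lemma is_series_uniq u (l l' : R) : is_series u l -> is_series u l' -> l = l'.
Proof. intros H H'; rewrite <- (is_series_unique _ _ H); apply is_series_unique; exact H'. Qed.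

Lemma is_series_R_ext (u v : nat -> R) (a : R) :
  (forall n, u n = v n) -> is_series u a -> is_series v a.
Proof. apply is_series_ext. Qed.

Lemma is_series_R_plus (u v : nat -> R) (a b : R) :
  is_series u a -> is_series v b -> is_series (fun n => u n + v n) (a + b).
Proof. intros; apply (is_series_plus u v); auto. Qed.
Arguments is_series_R_plus {u} {v} {a} {b}.

Lemma is_series_R_scal c (u : nat -> R) (a : R) :
  is_series u a -> is_series (fun n => c * u n) (c * a).
Proof. intros; apply (is_series_scal c u); auto. Qed.

Lemma is_series_zero : is_series (fun _ => 0) 0.
Proof.
  apply is_series_lim_seq. apply is_lim_seq_ext with (fun _ => 0).
  - intros n; induction n; simpl; lra.
  - apply is_lim_seq_const.
Qed.

Lemma is_series_single (k : nat) (x : R) : is_series (fun n => if Nat.eqb n k then x else 0) x.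
Proof.
  apply is_series_lim_seq. apply is_lim_seq_ext_loc with (fun _ => x); [| apply is_lim_seq_const].
  exists k. intros n Hn.
  assert (H : forall m, sum_f_R0 (fun n => if Nat.eqb n k then x else 0) m
                        = if Nat.leb k m then x else 0).
  { induction m; cbn [sum_f_R0].
    - destruct k; reflexivity.
    - rewrite IHm.
      destruct (Nat.eqb_spec (S m) k), (Nat.leb_spec k m), (Nat.leb_spec k (S m)); try lia; lra. }
  rewrite H. apply Nat.leb_le in Hn; rewrite Hn; reflexivity.
Qed.

Lemma abs_bounded_single (k : nat) (x B : R) :
  Rabs x <= B -> abs_bounded (fun n => if Nat.eqb n k then x else 0) B.
Proof.
  intros H n. eapply Rle_trans; [| exact H].
  assert (E : is_series (fun i => Rabs (if Nat.eqb i k then x else 0)) (Rabs x)).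
  { apply (is_series_ext (fun i => if Nat.eqb i k then Rabs x else 0)); [| apply is_series_single].
    intros i; destruct (Nat.eqb i k); [reflexivity | symmetry; apply Rabs_R0]. }
  apply (is_series_nonneg_partial _ _ n (fun i => Rabs_pos _) E).
Qed.

Lemma is_series_sum_f_R0 (a : nat -> nat -> R) (v : nat -> R) n :
  (forall m, is_series (a m) (v m)) ->
  is_series (fun k => sum_f_R0 (fun m => a m k) n) (sum_f_R0 v n).
Proof.
  intros H; induction n; simpl; [apply H | eapply is_series_R_plus; auto].
Qed.

Fixpoint list_sum {A : Type} (f : A -> R) (l : list A) : R :=
  match l with nil => 0 | x :: l' => f x + list_sum f l' end.

Lemma list_sum_app {A} (f : A -> R) l l' : list_sum f (l ++ l') = list_sum f l + list_sum f l'.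
Proof. induction l; simpl; [ring | rewrite IHl; ring]. Qed.

Lemma list_sum_incl {A} (f : A -> R) (l l' : list A) :
  (forall x, 0 <= f x) -> NoDup l -> incl l l' -> list_sum f l <= list_sum f l'.
Proof.
  intros Hf Hl; revert l'; induction Hl as [| x l Hx Hl IH]; intros l' Hi; simpl.
  - clear Hi; induction l'; simpl; [lra | specialize (Hf a); lra].
  - destruct (in_split x l') as (l1 & l2 & ->); [apply Hi; left; reflexivity |].
    assert (incl l (l1 ++ l2)).
    { intros y Hy. specialize (Hi y (or_intror Hy)). apply in_app_iff in Hi.
      apply in_app_iff. destruct Hi as [|[->|]]; auto. contradiction. }
    specialize (IH _ H). rewrite list_sum_app in *. simpl. lra.
Qed.

Lemma list_sum_map {A B} (g : B -> A) (f : A -> R) l :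
  list_sum f (map g l) = list_sum (fun x => f (g x)) l.
Proof. induction l; simpl; congruence. Qed.

Lemma list_sum_seq (f : nat -> R) n : list_sum f (seq 0 (S n)) = sum_f_R0 f n.
Proof.
  induction n; [simpl; ring |].
  rewrite seq_S, list_sum_app, IHn. simpl. ring.
Qed.

Lemma list_sum_prod {A B} (f : A * B -> R) l l' :
  list_sum f (list_prod l l') = list_sum (fun x => list_sum (fun y => f (x, y)) l') l.
Proof.
  induction l; simpl; [reflexivity |].
  rewrite list_sum_app, list_sum_map, IHl. reflexivity.
Qed.

Lemma list_sum_square (a : nat -> nat -> R) M :
  list_sum (fun q => a (fst q) (snd q)) (list_prod (seq 0 (S M)) (seq 0 (S M)))
  = sum_f_R0 (fun m => sum_f_R0 (a m) M) M.
Proof.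
  rewrite list_sum_prod, list_sum_seq. apply sum_eq; intros. apply list_sum_seq.
Qed.

(** The Cantor enumeration turns a double series into a simple one, so a countable sum of expansions
    is again an expansion indexed by [nat]. *)
Definition diag_enum (a : nat -> nat -> R) (t : nat) : R :=
  a (fst (of_nat t)) (snd (of_nat t)).

Lemma diag_enum_le_square a T :
  (forall m k, 0 <= a m k) ->
  sum_f_R0 (diag_enum a) T <= sum_f_R0 (fun m => sum_f_R0 (a m) T) T.
Proof.
  intros Hp. rewrite <- list_sum_square, <- list_sum_seq. unfold diag_enum.
  rewrite <- (list_sum_map of_nat (fun q => a (fst q) (snd q))).
  apply list_sum_incl; [auto | |].
  - apply Injective_map_NoDup; [| apply seq_NoDup].
    intros x y E. rewrite <- (cancel_to_of x), E. apply cancel_to_of.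
  - intros [x y] Hq. apply in_map_iff in Hq. destruct Hq as (t & Et & Ht).
    apply in_seq in Ht.
    (* A Cantor code is at least as large as each coordinate, so codes up to [T] stay in the square
       of side [T]. *)
    pose proof (to_nat_non_decreasing x y) as H. rewrite <- Et, cancel_to_of in H.
    apply in_prod; apply in_seq; lia.
Qed.

Lemma square_le_diag_enum a M :
  (forall m k, 0 <= a m k) ->
  exists T, sum_f_R0 (fun m => sum_f_R0 (a m) M) M <= sum_f_R0 (diag_enum a) T.
Proof.
  intros Hp.
  set (l := list_prod (seq 0 (S M)) (seq 0 (S M))).
  (* The largest code of a pair in the square: the enumeration has covered the whole square by
     then. *)
  set (T := list_max (map to_nat l)).
  exists T. rewrite <- list_sum_square, <- list_sum_seq. unfold diag_enum. fold l.
  rewrite <- (list_sum_map of_nat (fun q => a (fst q) (snd q))).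
  apply list_sum_incl; [auto | |].
  - unfold l.
    assert (G : forall (A B : Type) (l1 : list A) (l2 : list B),
               NoDup l1 -> NoDup l2 -> NoDup (list_prod l1 l2)).
    { intros A B l1 l2 H1 H2. induction H1; simpl; [constructor |].
      apply NoDup_app; [apply Injective_map_NoDup; auto; intros u v E; inversion E; auto | auto |].
      intros [u v] Hu Hv. apply in_map_iff in Hu. destruct Hu as (w & Ew & _).
        inversion Ew; subst. apply in_prod_iff in Hv. tauto. }
    apply G; apply seq_NoDup.
  - intros q Hq. apply in_map_iff. exists (to_nat q). split; [apply cancel_of_to |].
    apply in_seq. split; [lia |]. rewrite Nat.add_0_l.
    apply Nat.lt_succ_r.
    assert (Hm : List.Forall (fun k => (k <= T)%nat) (map to_nat l))
      by (apply list_max_le; apply le_n).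
    rewrite Forall_forall in Hm. apply Hm. apply in_map; exact Hq.
Qed.

Lemma sum_f_R0_le_extend u n m :
  (forall k, 0 <= u k) -> (n <= m)%nat -> sum_f_R0 u n <= sum_f_R0 u m.
Proof.
  intros Hp H; induction H; [lra | simpl; specialize (Hp (S m)); lra].
Qed.

Lemma diag_enum_series_nonneg a (v : nat -> R) (V : R) :
  (forall m k, 0 <= a m k) -> (forall m, is_series (a m) (v m)) -> is_series v V ->
  is_series (diag_enum a) V.
Proof.
  intros Hp Hv HV.
  assert (Hv0 : forall m, 0 <= v m).
  { intros m. eapply Rle_trans; [| apply (is_series_nonneg_partial _ _ 0 (Hp m) (Hv m))].
    apply Hp. }
  assert (Hd : forall t, 0 <= diag_enum a t) by (intros; apply Hp).
  assert (Hle : forall n, sum_f_R0 (diag_enum a) n <= V).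
  { intros n. eapply Rle_trans; [apply diag_enum_le_square; auto |].
    eapply Rle_trans; [| apply (is_series_nonneg_partial _ _ n Hv0 HV)].
    apply sum_Rle; intros; apply is_series_nonneg_partial; auto. }
  destruct (nonneg_sum_le_ex_series _ V Hd Hle) as [S HS].
  replace V with S; [exact HS |].
  apply Rle_antisym.
  - apply (is_series_le_bound HS Hle).
  - apply (is_series_le_bound HV). intros n.
    apply (is_series_le_bound (is_series_sum_f_R0 a v n Hv)). intros k.
    eapply Rle_trans; [apply (sum_f_R0_le_extend _ k (Nat.max n k)); [| lia] |].
    { intros; apply sum_f_R0_nonneg; auto. }
    assert (E : forall N K, sum_f_R0 (fun k0 => sum_f_R0 (fun m => a m k0) N) K
                 = sum_f_R0 (fun m => sum_f_R0 (a m) K) N).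
    { intros N K; induction K; simpl; [reflexivity |].
      rewrite IHK. rewrite <- sum_plus. reflexivity. }
    rewrite E.
    eapply Rle_trans; [apply (sum_f_R0_le_extend _ n (Nat.max n k)); [| lia] |].
    { intros; apply sum_f_R0_nonneg; auto. }
    destruct (square_le_diag_enum a (Nat.max n k) Hp) as [T HT].
    eapply Rle_trans; [exact HT |].
    apply is_series_nonneg_partial; auto.
Qed.

Lemma diag_enum_abs_bounded a (A : nat -> R) B :
  (forall m, abs_bounded (a m) (A m)) -> (forall n, sum_f_R0 A n <= B) ->
  abs_bounded (diag_enum a) B.
Proof.
  intros Ha HA n.
  eapply Rle_trans; [apply (diag_enum_le_square (fun m k => Rabs (a m k))) |].
  - intros; apply Rabs_pos.
  - eapply Rle_trans; [| apply (HA n)]. apply sum_Rle; intros; apply Ha.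
Qed.

(** Reduced to nonnegative terms by writing [a] as the difference of [(|a| + a) / 2] and
    [(|a| - a) / 2]. The bounds [A] on the rows make the row sums of [|a|] summable. *)
Lemma diag_enum_series a (A v : nat -> R) (B V : R) :
  (forall m, abs_bounded (a m) (A m)) -> (forall n, sum_f_R0 A n <= B) ->
  (forall m, is_series (a m) (v m)) -> is_series v V ->
  is_series (diag_enum a) V.
Proof.
  intros Ha HA Hv HV.
  assert (Hw : forall m, exists w, is_series (fun k => Rabs (a m k)) w).
  { intros m. apply (nonneg_sum_le_ex_series _ (A m)); [intros; apply Rabs_pos | apply Ha]. }
  destruct (functional_choice _ Hw) as [w Hw'].
  assert (HwA : forall m, 0 <= w m <= A m).
  { intros m; split.
    - eapply Rle_trans; [apply (sum_f_R0_nonneg (fun k => Rabs (a m k)) 0); intros; apply Rabs_pos |].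
      apply is_series_nonneg_partial; [intros; apply Rabs_pos | auto].
    - apply (is_series_le_bound (Hw' m)). apply Ha. }
  destruct (nonneg_sum_le_ex_series w B) as [W HW].
  { intros; apply HwA. }
  { intros n; eapply Rle_trans; [| apply (HA n)]. apply sum_Rle; intros; apply HwA. }
  assert (P : is_series (diag_enum (fun m k => / 2 * (Rabs (a m k) + a m k))) (/ 2 * (W + V))).
  { apply (diag_enum_series_nonneg _ (fun m => / 2 * (w m + v m))).
    - intros m k. pose proof (Rle_abs (- a m k)). rewrite Rabs_Ropp in H. lra.
    - intros m. apply is_series_R_scal, is_series_R_plus; auto.
    - apply is_series_R_scal, is_series_R_plus; auto. }
  assert (Q : is_series (diag_enum (fun m k => / 2 * (Rabs (a m k) + - 1 * a m k))) (/ 2 * (W + - 1 * V))).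
  { apply (diag_enum_series_nonneg _ (fun m => / 2 * (w m + -1 * v m))).
    - intros m k. pose proof (Rle_abs (a m k)). lra.
    - intros m. apply is_series_R_scal, is_series_R_plus; auto. apply is_series_R_scal; auto.
    - apply is_series_R_scal, is_series_R_plus; auto. apply is_series_R_scal; auto. }
  pose proof (is_series_R_plus P (is_series_R_scal (-1) _ _ Q)) as H.
  replace V with (/ 2 * (W + V) + -1 * (/ 2 * (W + -1 * V))) by field.
  eapply is_series_ext; [| exact H]. intros n; unfold diag_enum; simpl. field.
Qed.

Lemma series_exchange_nonneg_le a (v w : nat -> R) (V : R) K :
  (forall m k, 0 <= a m k) -> (forall m, is_series (a m) (v m)) -> is_series v V ->
  (forall k, is_series (fun m => a m k) (w k)) -> sum_f_R0 w K <= V.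
Proof.
  intros Hp Hv HV Hw.
  apply (is_series_le_bound (is_series_sum_f_R0 (fun k m => a m k) w K Hw)).
  intros N.
  assert (Hv0 : forall m, 0 <= v m).
  { intros m. eapply Rle_trans; [| apply (is_series_nonneg_partial _ _ 0 (Hp m) (Hv m))].
    apply Hp. }
  eapply Rle_trans; [| apply (is_series_nonneg_partial _ _ N Hv0 HV)].
  apply sum_Rle; intros. apply (is_series_nonneg_partial (a n)); auto.
Qed.

(** Tonelli: the one-sided bound on partial sums is used twice, the second time with rows and
    columns swapped. *)
Lemma series_exchange_nonneg a (v w : nat -> R) (V : R) :
  (forall m k, 0 <= a m k) -> (forall m, is_series (a m) (v m)) -> is_series v V ->
  (forall k, is_series (fun m => a m k) (w k)) -> is_series w V.
Proof.
  intros Hp Hv HV Hw.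
  assert (Hw0 : forall k, 0 <= w k).
  { intros k. eapply Rle_trans; [apply (Hp O k) |].
    apply (is_series_nonneg_partial (fun m => a m k) _ 0); auto. }
  assert (Hle : forall K, sum_f_R0 w K <= V)
    by (intros; eapply series_exchange_nonneg_le; eauto).
  destruct (nonneg_sum_le_ex_series w V Hw0 Hle) as [W HW].
  replace V with W; [exact HW |]. apply Rle_antisym.
  - apply (is_series_le_bound HW Hle).
  - apply (is_series_le_bound HV). intros K.
    apply (series_exchange_nonneg_le (fun k m => a m k) w v W K); auto.
Qed.

Lemma series_exchange a (A v w : nat -> R) (B V : R) :
  (forall m, abs_bounded (a m) (A m)) -> (forall n, sum_f_R0 A n <= B) ->
  (forall m, is_series (a m) (v m)) -> is_series v V ->
  (forall k, is_series (fun m => a m k) (w k)) -> is_series w V.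
Proof.
  intros Ha HA Hv HV Hw.
  assert (Hr : forall m, exists r, is_series (fun k => Rabs (a m k)) r).
  { intros m. apply (nonneg_sum_le_ex_series _ (A m)); [intros; apply Rabs_pos | apply Ha]. }
  destruct (functional_choice _ Hr) as [r Hr'].
  assert (HrA : forall m, 0 <= r m <= A m).
  { intros m; split.
    - eapply Rle_trans; [apply (sum_f_R0_nonneg (fun k => Rabs (a m k)) 0); intros; apply Rabs_pos |].
      apply is_series_nonneg_partial; [intros; apply Rabs_pos | auto].
    - apply (is_series_le_bound (Hr' m)). apply Ha. }
  destruct (nonneg_sum_le_ex_series r B) as [V' HV'].
  { intros; apply HrA. }
  { intros n; eapply Rle_trans; [| apply (HA n)]. apply sum_Rle; intros; apply HrA. }
  assert (Hc : forall k, exists s, is_series (fun m => Rabs (a m k)) s).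
  { intros k. apply (nonneg_sum_le_ex_series _ B); [intros; apply Rabs_pos |].
    intros n; eapply Rle_trans; [| apply (HA n)]. apply sum_Rle; intros m _.
    eapply Rle_trans; [| apply (Ha m k)].
    destruct k; simpl; [lra |].
    pose proof (sum_f_R0_nonneg (fun i => Rabs (a m i)) k (fun i => Rabs_pos _)). lra. }
  destruct (functional_choice _ Hc) as [s Hs].
  assert (P : is_series (fun k => / 2 * (s k + w k)) (/ 2 * (V' + V))).
  { apply (series_exchange_nonneg (fun m k => / 2 * (Rabs (a m k) + a m k))
             (fun m => / 2 * (r m + v m))).
    - intros m k. pose proof (Rle_abs (- a m k)). rewrite Rabs_Ropp in H. lra.
    - intros m. apply is_series_R_scal, is_series_R_plus; auto.
    - apply is_series_R_scal, is_series_R_plus; auto.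
    - intros k. apply is_series_R_scal, is_series_R_plus; auto. }
  assert (Q : is_series (fun k => / 2 * (s k + -1 * w k)) (/ 2 * (V' + -1 * V))).
  { apply (series_exchange_nonneg (fun m k => / 2 * (Rabs (a m k) + -1 * a m k))
             (fun m => / 2 * (r m + -1 * v m))).
    - intros m k. pose proof (Rle_abs (a m k)). lra.
    - intros m. apply is_series_R_scal, is_series_R_plus; auto. apply is_series_R_scal; auto.
    - apply is_series_R_scal, is_series_R_plus; auto. apply is_series_R_scal; auto.
    - intros k. apply is_series_R_scal, is_series_R_plus; auto. apply is_series_R_scal; auto. }
  pose proof (is_series_R_plus P (is_series_R_scal (-1) _ _ Q)) as H.
  replace V with (/ 2 * (V' + V) + -1 * (/ 2 * (V' + -1 * V))) by field.
  eapply is_series_ext; [| exact H]. intros n; simpl. field.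
Qed.

(** * Weighted Wiener norms *)

Record point := Pt { pa : R; pk : R; pb : R; pd : R }.

Definition pfun := point -> R -> R.

Record mode := Mode { ea : nat; ek : nat; eb : nat; ed : nat; ez : nat }.

Definition degree (t : mode) : nat := (ea t + ek t + eb t + ed t)%nat.

(** The factor in the frequency is submultiplicative, which gives an algebra, and forces exponential
    decay, which gives smoothness in [z]. At [rho = 0] the convention [0 ^ 0 = 1] leaves the modes
    of degree 0; the others have weight 0 and vanish at the only point of the box. So [normed x 0]
    is the weighted Wiener norm of the slice at [x]. *)
Definition weight (rho : R) (t : mode) : R := rho ^ degree t * 2 ^ ez t.

Definition monomial (p : point) (t : mode) (x : point) : R :=
  (pa x - pa p) ^ ea t * (pk x - pk p) ^ ek t * (pb x - pb p) ^ eb t * (pd x - pd p) ^ ed t.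

Definition atom (p : point) (t : mode) (x : point) (z : R) : R :=
  monomial p t x * cos (INR (ez t) * z).

Definition box (p : point) (rho : R) (x : point) : Prop :=
  Rabs (pa x - pa p) <= rho /\ Rabs (pk x - pk p) <= rho /\
  Rabs (pb x - pb p) <= rho /\ Rabs (pd x - pd p) <= rho.

(* An upper bound for a weighted Wiener norm: power series in the parameters on the polydisc of
   radius [rho], exponential weight [2 ^ n] in the frequency.  A mode may occur several times
   in the expansion, so that products and countable sums need no regrouping. *)
Definition normed (p : point) (rho : R) (f : pfun) (B : R) : Prop :=
  0 <= rho /\
  exists (g : nat -> R) (t : nat -> mode),
    abs_bounded (fun m => g m * weight rho (t m)) B /\
    forall x, box p rho x -> forall z, is_series (fun m => g m * atom p (t m) x z) (f x z).

Lemma weight_ge0 rho t : 0 <= rho -> 0 <= weight rho t.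
Proof. intros; unfold weight; apply Rmult_le_pos; apply pow_le; lra. Qed.

Lemma box_center p rho : 0 <= rho -> box p rho p.
Proof. intros; repeat split; unfold Rminus; rewrite Rplus_opp_r, Rabs_R0; auto. Qed.

Lemma box_mono p rho rho' x : rho' <= rho -> box p rho' x -> box p rho x.
Proof. intros H (? & ? & ? & ?); repeat split; lra. Qed.

Lemma Rabs_pow_le x r n : Rabs x <= r -> Rabs (x ^ n) <= r ^ n.
Proof. intros; rewrite <- RPow_abs; apply pow_incr; split; [apply Rabs_pos | auto]. Qed.

Lemma Rabs_mult_le a b A B : Rabs a <= A -> Rabs b <= B -> Rabs (a * b) <= A * B.
Proof. intros; rewrite Rabs_mult; apply Rmult_le_compat; auto; apply Rabs_pos. Qed.

Lemma Rabs_cos_le1 x : Rabs (cos x) <= 1.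
Proof. apply Rabs_le; pose proof (COS_bound x); lra. Qed.

Lemma monomial_le p rho t x : box p rho x -> Rabs (monomial p t x) <= rho ^ degree t.
Proof.
  intros (? & ? & ? & ?). unfold monomial, degree. rewrite !pow_add.
  repeat apply Rabs_mult_le; apply Rabs_pow_le; auto.
Qed.

Lemma atom_le p rho t x z : 0 <= rho -> box p rho x -> Rabs (atom p t x z) <= weight rho t.
Proof.
  intros Hr H. unfold atom, weight. apply Rabs_mult_le; [apply monomial_le; auto |].
  eapply Rle_trans; [apply Rabs_cos_le1 | apply pow_R1_Rle; lra].
Qed.

Lemma normed_ge0 p rho f B : normed p rho f B -> 0 <= B.
Proof. intros (_ & g & t & H & _); eapply abs_bounded_ge0; eauto. Qed.
Arguments normed_ge0 {p} {rho} {f} {B}.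

Lemma normed_radius_ge0 p rho f B : normed p rho f B -> 0 <= rho.
Proof. intros (H & _); exact H. Qed.

Lemma normed_ext p rho f g B :
  (forall x z, box p rho x -> f x z = g x z) -> normed p rho f B -> normed p rho g B.
Proof.
  intros E (Hr & c & t & Hb & Hs). split; [auto |]. exists c, t. split; [auto |].
  intros x Hx z. rewrite <- E; auto.
Qed.

Lemma normed_le p rho f B C : normed p rho f B -> B <= C -> normed p rho f C.
Proof.
  intros (Hr & c & t & Hb & Hs) H. split; [auto |]. exists c, t. split; [| auto].
  intros n; eapply Rle_trans; [apply Hb | auto].
Qed.

Lemma normed_restrict p rho rho' f B :
  normed p rho f B -> 0 <= rho' <= rho -> normed p rho' f B.
Proof.
  intros (Hr & c & t & Hb & Hs) H. split; [lra |]. exists c, t. split.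
  - apply (abs_bounded_le Hb); [| lra]. intros k. rewrite !Rabs_mult.
    apply Rmult_le_compat_l; [apply Rabs_pos |].
    rewrite !Rabs_pos_eq by (apply weight_ge0; lra).
    apply Rmult_le_compat_r; [apply pow_le; lra |]. apply pow_incr; auto.
  - intros x Hx; apply Hs. eapply box_mono; [| exact Hx]; lra.
Qed.

Lemma normed_bound p rho f B x z : normed p rho f B -> box p rho x -> Rabs (f x z) <= B.
Proof.
  intros (Hr & c & t & Hb & Hs) Hx. apply (is_series_abs_bounded _ _ _ (Hs x Hx z)).
  apply (abs_bounded_le Hb); [| lra]. intros k. rewrite !Rabs_mult.
  apply Rmult_le_compat_l; [apply Rabs_pos |].
  rewrite (Rabs_pos_eq (weight _ _)) by (apply weight_ge0; lra). apply atom_le; auto.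
Qed.
Arguments normed_bound {p} {rho} {f} {B} {x}.

(** The expansions of the terms are concatenated along the diagonal enumeration. Sums, products,
    geometric series, Fourier multipliers and limits of iterations are all obtained from this one
    closure property. *)
Lemma normed_series p rho (f : nat -> pfun) (B : nat -> R) F C :
  0 <= rho ->
  (forall m, normed p rho (f m) (B m)) -> (forall n, sum_f_R0 B n <= C) ->
  (forall x z, box p rho x -> is_series (fun m => f m x z) (F x z)) ->
  normed p rho F C.
Proof.
  intros Hr Hf HB HF. split; [auto |].
  assert (Hf' : forall m, exists gt : (nat -> R) * (nat -> mode),
    abs_bounded (fun k => fst gt k * weight rho (snd gt k)) (B m) /\
    forall x, box p rho x -> forall z,
      is_series (fun k => fst gt k * atom p (snd gt k) x z) (f m x z)).
  { intros m; destruct (Hf m) as (_ & g & t & H1 & H2). exists (g, t); split; auto. }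
  destruct (functional_choice _ Hf') as [gt Hgt].
  exists (diag_enum (fun m k => fst (gt m) k)),
         (fun j => snd (gt (fst (of_nat j))) (snd (of_nat j))).
  split.
  - apply (diag_enum_abs_bounded (fun m k => fst (gt m) k * weight rho (snd (gt m) k)) B); auto.
    intros m; apply Hgt.
  - intros x Hx z.
    apply (diag_enum_series (fun m k => fst (gt m) k * atom p (snd (gt m) k) x z)
             B (fun m => f m x z) C); auto.
    + intros m. destruct (Hgt m) as [H1 _].
      apply (abs_bounded_le H1); [| lra]. intros k. rewrite !Rabs_mult.
      apply Rmult_le_compat_l; [apply Rabs_pos |].
      rewrite (Rabs_pos_eq (weight _ _)) by (apply weight_ge0; lra). apply atom_le; auto.
    + intros m. apply Hgt; auto.
Qed.

Lemma normed_atom p rho c t : 0 <= rho ->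
  normed p rho (fun x z => c * atom p t x z) (Rabs c * weight rho t).
Proof.
  intros Hr. split; [auto |]. exists (fun m => if Nat.eqb m 0 then c else 0), (fun _ => t). split.
  - apply abs_bounded_ext with (fun m => if Nat.eqb m 0 then c * weight rho t else 0).
    { intros k; destruct (Nat.eqb k 0); ring. }
    apply abs_bounded_single. rewrite Rabs_mult, (Rabs_pos_eq (weight _ _)); [lra |].
    apply weight_ge0; auto.
  - intros x Hx z. eapply is_series_ext; [| apply is_series_single with (k := O)].
    intros n; simpl. destruct (Nat.eqb n 0); ring.
Qed.

Lemma normed_const p rho c : 0 <= rho -> normed p rho (fun _ _ => c) (Rabs c).
Proof.
  intros Hr. apply normed_le with (Rabs c * weight rho (Mode 0 0 0 0 0)).
  - eapply normed_ext; [| apply normed_atom; auto].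
    intros; unfold atom, monomial; simpl. rewrite Rmult_0_l, cos_0; ring.
  - unfold weight; simpl; lra.
Qed.

Lemma normed_one p rho : 0 <= rho -> normed p rho (fun _ _ => 1) 1.
Proof. intros Hr; pose proof (normed_const p rho 1 Hr) as H; rewrite Rabs_R1 in H; exact H. Qed.

Lemma normed_zero p rho : 0 <= rho -> normed p rho (fun _ _ => 0) 0.
Proof. intros Hr; pose proof (normed_const p rho 0 Hr) as H; rewrite Rabs_R0 in H; exact H. Qed.

Lemma normed_plus p rho f g B C :
  normed p rho f B -> normed p rho g C -> normed p rho (fun x z => f x z + g x z) (B + C).
Proof.
  intros Hf Hg. pose proof (normed_radius_ge0 _ _ _ _ Hf) as Hr.
  pose proof (normed_ge0 Hf). pose proof (normed_ge0 Hg).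
  apply normed_series with
    (f := fun m => match m with O => f | S O => g | _ => fun _ _ => 0 end)
    (B := fun m => match m with O => B | S O => C | _ => 0 end); auto.
  - intros [|[|m]]; auto. eapply normed_le; [apply normed_const; auto |]. rewrite Rabs_R0; lra.
  - intros n. apply Rle_trans with
      (sum_f_R0 (fun m => match m with O => B | S O => C | _ => 0 end) (S n)).
    + apply sum_f_R0_le_extend; [intros [|[|k]]; lra | lia].
    + clear -H H0; induction n; simpl in *; lra.
  - intros x z Hx.
    eapply is_series_ext; [| eapply is_series_R_plus;
      [apply (is_series_single O) | apply (is_series_single 1%nat)]].
    intros [|[|n]]; simpl; ring.
Qed.
Arguments normed_plus {p} {rho} {f} {g} {B} {C}.

Lemma normed_scal p rho c f B :
  normed p rho f B -> normed p rho (fun x z => c * f x z) (Rabs c * B).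
Proof.
  intros (Hr & g & t & Hb & Hs). split; [auto |]. exists (fun m => c * g m), t. split.
  - eapply abs_bounded_ext; [| apply abs_bounded_scal; exact Hb]. intros; simpl; ring.
  - intros x Hx z. eapply is_series_ext; [| apply is_series_R_scal; apply Hs; auto].
    intros; simpl; ring.
Qed.

Lemma normed_opp p rho f B : normed p rho f B -> normed p rho (fun x z => - f x z) B.
Proof.
  intros H. apply (normed_scal _ _ (-1)) in H. replace (Rabs (-1)) with 1 in H by (rewrite Rabs_left; lra). rewrite Rmult_1_l in H.
  eapply normed_ext; [| exact H]. intros; simpl; ring.
Qed.
Arguments normed_opp {p} {rho} {f} {B}.

Lemma normed_minus p rho f g B C :
  normed p rho f B -> normed p rho g C -> normed p rho (fun x z => f x z - g x z) (B + C).
Proof. intros Hf Hg. eapply normed_plus; [auto | eapply normed_opp; auto]. Qed.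
Arguments normed_minus {p} {rho} {f} {g} {B} {C}.

(** Product-to-sum formula: the frequencies [n + n'] and [|n - n'|] both have weight at most
    [2 ^ (n + n')], and the two halves add up to the product of the weights. The form [max - min]
    avoids truncated subtraction. *)
Lemma normed_atom_mult p rho t t' : 0 <= rho ->
  normed p rho (fun x z => atom p t x z * atom p t' x z) (weight rho t * weight rho t').
Proof.
  intros Hr.
  set (s n := Mode (ea t + ea t') (ek t + ek t') (eb t + eb t') (ed t + ed t') n).
  apply normed_le with
    (Rabs (/ 2) * weight rho (s (ez t + ez t')%nat) +
     Rabs (/ 2) * weight rho (s (Nat.max (ez t) (ez t') - Nat.min (ez t) (ez t'))%nat)).
  - eapply normed_ext; [| eapply normed_plus; apply normed_atom; auto].
    intros x z _. unfold atom, monomial; simpl. rewrite !pow_add.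
    rewrite minus_INR, plus_INR by lia.
    assert (E : cos ((INR (Nat.max (ez t) (ez t')) - INR (Nat.min (ez t) (ez t'))) * z)
                = cos (INR (ez t) * z - INR (ez t') * z)).
    { destruct (Nat.le_ge_cases (ez t) (ez t')).
      - rewrite Nat.max_r, Nat.min_l by lia. rewrite <- cos_neg. f_equal; ring.
      - rewrite Nat.max_l, Nat.min_r by lia. f_equal; ring. }
    rewrite E, Rmult_plus_distr_r, cos_minus, cos_plus. field.
  - rewrite Rabs_pos_eq by lra.
    assert (H : forall n, (n <= ez t + ez t')%nat ->
                weight rho (s n) <= weight rho t * weight rho t').
    { intros n Hn. unfold weight.
      replace (rho ^ degree t * 2 ^ ez t * (rho ^ degree t' * 2 ^ ez t'))
        with (rho ^ degree (s n) * 2 ^ (ez t + ez t')).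
      - apply Rmult_le_compat_l; [apply pow_le; auto | apply Rle_pow; [lra | exact Hn]].
      - replace (degree (s n)) with (degree t + degree t')%nat
          by (unfold degree, s; simpl; lia).
        rewrite !pow_add; ring. }
    pose proof (H (ez t + ez t')%nat ltac:(lia)).
    pose proof (H (Nat.max (ez t) (ez t') - Nat.min (ez t) (ez t'))%nat ltac:(lia)). lra.
Qed.

Lemma sum_f_R0_scal c u n : sum_f_R0 (fun k => c * u k) n = c * sum_f_R0 u n.
Proof. rewrite scal_sum; apply sum_eq; intros; ring. Qed.

(** Two passes: first a single atom times the series of [g], then the sum over the atoms of [f]. *)
Lemma normed_mult p rho f g B C :
  normed p rho f B -> normed p rho g C -> normed p rho (fun x z => f x z * g x z) (B * C).
Proof.
  intros (Hr & a & t & Ha & Hs) Hg.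
  pose proof (normed_ge0 Hg) as HC.
  assert (Hat : forall t0, normed p rho (fun x z => atom p t0 x z * g x z) (weight rho t0 * C)).
  { intros t0. destruct Hg as (_ & a' & t' & Ha' & Hs').
    apply normed_series with
      (f := fun m x z => a' m * (atom p t0 x z * atom p (t' m) x z))
      (B := fun m => Rabs (a' m) * (weight rho t0 * weight rho (t' m))); auto.
    - intros m; apply normed_scal, normed_atom_mult; auto.
    - intros n. pose proof (weight_ge0 rho t0 Hr).
      rewrite (sum_eq _ (fun m => weight rho t0 * Rabs (a' m * weight rho (t' m)))).
      + rewrite sum_f_R0_scal. apply Rmult_le_compat_l; auto.
      + intros; rewrite Rabs_mult, (Rabs_pos_eq (weight rho (t' i))); [ring | apply weight_ge0; auto].
    - intros x z Hx. eapply is_series_ext; [| apply is_series_R_scal; apply (Hs' x Hx z)].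
      intros; simpl; ring. }
  apply normed_series with
    (f := fun m x z => a m * (atom p (t m) x z * g x z))
    (B := fun m => Rabs (a m) * (weight rho (t m) * C)); auto.
  - intros m; apply normed_scal; auto.
  - intros n.
    rewrite (sum_eq _ (fun m => C * Rabs (a m * weight rho (t m)))).
    + rewrite sum_f_R0_scal, (Rmult_comm B). apply Rmult_le_compat_l; auto.
    + intros; rewrite Rabs_mult, (Rabs_pos_eq (weight rho (t i))); [ring | apply weight_ge0; auto].
  - intros x z Hx. rewrite Rmult_comm.
    eapply is_series_ext; [| apply is_series_R_scal; apply (Hs x Hx z)].
    intros; simpl; ring.
Qed.
Arguments normed_mult {p} {rho} {f} {g} {B} {C}.

Lemma normed_pow p rho f B n : normed p rho f B -> normed p rho (fun x z => f x z ^ n) (B ^ n).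
Proof.
  intros H; induction n; simpl.
  - eapply normed_le; [apply normed_const; eapply normed_radius_ge0; eauto |].
    rewrite Rabs_R1; lra.
  - eapply normed_mult; auto.
Qed.

(** Subtracting the value at the centre removes the modes of degree 0; each remaining mode has
    degree at least 1 and gains a factor [rho' / rho]. *)
Lemma normed_shrink p rho rho' f B :
  normed p rho f B -> 0 < rho -> 0 <= rho' <= rho ->
  normed p rho' (fun x z => f x z - f p z) (rho' / rho * B).
Proof.
  intros (_ & g & t & Hb & Hs) Hr Hr'. split; [lra |].
  exists (fun m => if Nat.eqb (degree (t m)) 0 then 0 else g m), t. split.
  - assert (Hq : 0 <= rho' / rho) by (apply Rdiv_le_0_compat; lra).
    apply (@abs_bounded_le _ (fun m => rho' / rho * (g m * weight rho (t m))) (rho' / rho * B));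
      [| | lra].
    + pose proof (abs_bounded_scal (rho' / rho) _ _ Hb) as H.
      rewrite Rabs_pos_eq in H by auto. exact H.
    + intros k. destruct (Nat.eqb_spec (degree (t k)) 0) as [E | E].
      * rewrite Rmult_0_l, Rabs_R0; apply Rabs_pos.
      * rewrite !Rabs_mult, !(Rabs_pos_eq (weight _ _)) by (apply weight_ge0; lra).
        rewrite (Rabs_pos_eq (rho' / rho)) by auto.
        rewrite (Rmult_comm (rho' / rho)), Rmult_assoc.
        apply Rmult_le_compat_l; [apply Rabs_pos |].
        unfold weight. destruct (degree (t k)) as [|n]; [lia |]. simpl.
        replace (rho * rho ^ n * 2 ^ ez (t k) * (rho' / rho))
          with (rho' * rho ^ n * 2 ^ ez (t k)) by (field; lra).
        apply Rmult_le_compat_r; [apply pow_le; lra |].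
        apply Rmult_le_compat_l; [lra | apply pow_incr; auto].
  - intros x Hx z.
    assert (Hx' : box p rho x) by (eapply box_mono; [| exact Hx]; lra).
    pose proof (box_center p rho ltac:(lra)) as Hp.
    pose proof (is_series_R_plus (Hs x Hx' z) (is_series_R_scal (-1) _ _ (Hs p Hp z))) as H.
    replace (f x z - f p z) with (f x z + -1 * f p z) by ring.
    eapply is_series_ext; [| exact H]. intros m; simpl.
    unfold atom, monomial. unfold Rminus; rewrite !Rplus_opp_r.
    destruct (Nat.eqb_spec (degree (t m)) 0) as [E | E]; unfold degree in E.
    + replace (ea (t m)) with O by lia. replace (ek (t m)) with O by lia.
      replace (eb (t m)) with O by lia. replace (ed (t m)) with O by lia. simpl; ring.
    + assert (E' : 0 ^ ea (t m) * 0 ^ ek (t m) * 0 ^ eb (t m) * 0 ^ ed (t m) = 0).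
      { rewrite <- !pow_add. apply pow_ne_zero; exact E. }
      rewrite E'. ring.
Qed.

Lemma sum_pow_le x n : 0 <= x < 1 -> sum_f_R0 (fun k => x ^ k) n <= / (1 - x).
Proof.
  intros H. rewrite tech3 by lra. pose proof (pow_le x (S n) (proj1 H)).
  apply Rmult_le_reg_r with (1 - x); [lra |]. field_simplify; lra.
Qed.

Lemma is_series_geom' (x : R) : Rabs x < 1 -> is_series (fun n => x ^ n) (/ (1 - x)).
Proof. apply is_series_geom. Qed.

Lemma normed_inv_one_minus p rho f B :
  normed p rho f B -> B < 1 -> normed p rho (fun x z => / (1 - f x z)) (/ (1 - B)).
Proof.
  intros H HB. pose proof (normed_ge0 H).
  apply normed_series with (f := fun n x z => f x z ^ n) (B := fun n => B ^ n).
  - eapply normed_radius_ge0; eauto.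
  - intros m; apply normed_pow; auto.
  - intros n; apply sum_pow_le; lra.
  - intros x z Hx. apply is_series_geom'.
    eapply Rle_lt_trans; [eapply normed_bound; eauto | auto].
Qed.

Lemma normed_coordinate p rho (c : point -> R) t :
  0 <= rho -> degree t = 1%nat -> ez t = 0%nat -> (forall x, monomial p t x = c x - c p) ->
  normed p rho (fun x _ => c x) (Rabs (c p) + rho).
Proof.
  intros Hr Ht Hz E. apply normed_le with (Rabs (c p) + Rabs 1 * weight rho t).
  - eapply normed_ext; [| eapply normed_plus; [apply normed_const; auto | apply normed_atom; auto]].
    intros; unfold atom; simpl. rewrite E, Hz. simpl. rewrite Rmult_0_l, cos_0; ring.
  - rewrite Rabs_R1; unfold weight. rewrite Ht, Hz. simpl; lra.
Qed.

Lemma normed_pa p rho : 0 <= rho -> normed p rho (fun x _ => pa x) (Rabs (pa p) + rho).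
Proof.
  intros; apply (normed_coordinate p rho pa (Mode 1 0 0 0 0)); auto.
  intros; unfold monomial; simpl; ring.
Qed.

Lemma normed_pb p rho : 0 <= rho -> normed p rho (fun x _ => pb x) (Rabs (pb p) + rho).
Proof.
  intros; apply (normed_coordinate p rho pb (Mode 0 0 1 0 0)); auto.
  intros; unfold monomial; simpl; ring.
Qed.

Lemma normed_pd p rho : 0 <= rho -> normed p rho (fun x _ => pd x) (Rabs (pd p) + rho).
Proof.
  intros; apply (normed_coordinate p rho pd (Mode 0 0 0 1 0)); auto.
  intros; unfold monomial; simpl; ring.
Qed.

Lemma normed_cos p rho n : 0 <= rho -> normed p rho (fun _ z => cos (INR n * z)) (2 ^ n).
Proof.
  intros Hr. apply normed_le with (Rabs 1 * weight rho (Mode 0 0 0 0 n)).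
  - eapply normed_ext; [| apply normed_atom; auto].
    intros; unfold atom, monomial; simpl. ring.
  - rewrite Rabs_R1; unfold weight; simpl; lra.
Qed.

(** * Fourier coefficients and multipliers *)

Lemma is_series_tail_le (u : nat -> R) (l : R) (A : nat -> R) (sA : R) n :
  (forall k, Rabs (u k) <= A k) -> is_series u l -> is_series A sA ->
  Rabs (sum_f_R0 u n - l) <= sA - sum_f_R0 A n.
Proof.
  intros Hu Hl HA.
  apply is_series_lim_seq in Hl. apply is_series_lim_seq in HA.
  assert (L : is_lim_seq (fun m => sum_f_R0 A (m + n) - sum_f_R0 A n) (sA - sum_f_R0 A n)).
  { apply is_lim_seq_minus'; [apply is_lim_seq_incr_n; exact HA | apply is_lim_seq_const]. }
  assert (L' : is_lim_seq (fun m => Rabs (sum_f_R0 u n - sum_f_R0 u (m + n))) (Rabs (sum_f_R0 u n - l))).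
  { apply (is_lim_seq_abs _ (sum_f_R0 u n - l)).
    apply is_lim_seq_minus'; [apply is_lim_seq_const | apply is_lim_seq_incr_n; exact Hl]. }
  refine (is_lim_seq_le _ _ (Rabs (sum_f_R0 u n - l)) (sA - sum_f_R0 A n) _ L' L).
  intros m; induction m; simpl.
  - rewrite !Rminus_diag, Rabs_R0; lra.
  - specialize (Hu (S (m + n))).
    pose proof (Rabs_triang (sum_f_R0 u n - sum_f_R0 u (m + n)) (- u (S (m + n)))) as Ht.
    rewrite Rabs_Ropp in Ht.
    replace (sum_f_R0 u n - (sum_f_R0 u (m + n) + u (S (m + n))))
      with (sum_f_R0 u n - sum_f_R0 u (m + n) + - u (S (m + n))) by ring. lra.
Qed.

(** Weierstrass test: the majorant [A] makes the partial sums converge uniformly in [z], which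
    allows integration term by term. *)
Lemma is_RInt_series (u : nat -> R -> R) (A I : nat -> R) (B a b : R) (g : R -> R) :
  (forall m, is_RInt (u m) a b (I m)) ->
  (forall m z, Rabs (u m z) <= A m) -> (forall n, sum_f_R0 A n <= B) ->
  (forall z, is_series (fun m => u m z) (g z)) ->
  exists v, is_series I v /\ is_RInt g a b v.
Proof.
  intros HI HA HB Hg.
  assert (HA0 : forall m, 0 <= A m).
  { intros m; eapply Rle_trans; [apply Rabs_pos | apply (HA m 0)]. }
  destruct (nonneg_sum_le_ex_series A B HA0 HB) as [sA HsA].
  assert (Hn : forall n, is_RInt (fun z => sum_f_R0 (fun m => u m z) n) a b (sum_f_R0 I n)).
  { induction n; simpl; [apply HI |]. apply (is_RInt_plus (V := R_NormedModule)); auto. }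
  destruct (filterlim_RInt (V := R_CompleteNormedModule)
             (fun n z => sum_f_R0 (fun m => u m z) n) a b
             eventually eventually_filter g (sum_f_R0 I) Hn) as (v & H1 & H2).
  - apply filterlim_locally. intros eps.
    pose proof (proj1 (is_series_lim_seq _ _) HsA) as L. apply is_lim_seq_spec in L.
    destruct (L eps) as [N HN]. exists N. intros n Hn' z.
    specialize (HN n Hn'). simpl in HN.
    change (Rabs (sum_f_R0 (fun m => u m z) n - g z) < eps).
    eapply Rle_lt_trans; [apply (is_series_tail_le (fun m => u m z) (g z) A sA); auto |].
    rewrite Rabs_minus_sym in HN. eapply Rle_lt_trans; [apply Rle_abs | exact HN].
  - exists v; split; [apply is_series_lim_seq; exact H1 | exact H2].
Qed.

Lemma is_RInt_cos_freq (c : R) :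
  c <> 0 -> sin (c * (2 * PI)) = 0 -> is_RInt (fun z => cos (c * z)) 0 (2 * PI) 0.
Proof.
  intros Hc H.
  replace 0 with (minus (sin (c * (2 * PI)) / c) (sin (c * 0) / c)) at 2.
  - apply (is_RInt_derive (fun z => sin (c * z) / c)).
    + intros z _. auto_derive; [auto | field; auto].
    + intros z _. apply (continuous_comp (fun z => c * z) cos).
      * apply (continuous_mult (fun _ => c) (fun z => z)); [apply continuous_const | apply continuous_id].
      * apply continuous_cos.
  - rewrite H, Rmult_0_r, sin_0. unfold minus, plus, opp; simpl. field; auto.
Qed.

Lemma is_RInt_sin_freq (c : R) :
  cos (c * (2 * PI)) = 1 -> is_RInt (fun z => sin (c * z)) 0 (2 * PI) 0.
Proof.
  intros H. destruct (Req_dec c 0) as [-> | Hc].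
  { apply (is_RInt_ext (fun _ => 0)).
    - intros; rewrite Rmult_0_l, sin_0; auto.
    - pose proof (is_RInt_const (V := R_NormedModule) 0 (2 * PI) 0) as K.
      unfold scal in K; simpl in K; unfold mult in K; simpl in K. rewrite Rmult_0_r in K. exact K. }
  replace 0 with (minus (- cos (c * (2 * PI)) / c) (- cos (c * 0) / c)) at 2.
  - apply (is_RInt_derive (fun z => - cos (c * z) / c)).
    + intros z _. auto_derive; [auto | field; auto].
    + intros z _. apply (continuous_comp (fun z => c * z) sin).
      * apply (continuous_mult (fun _ => c) (fun z => z)); [apply continuous_const | apply continuous_id].
      * apply continuous_sin.
  - rewrite H, Rmult_0_r, cos_0. unfold minus, plus, opp; simpl. field; auto.
Qed.

Lemma cos_sin_INR_2PI n : cos (INR n * (2 * PI)) = 1 /\ sin (INR n * (2 * PI)) = 0.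
Proof.
  induction n as [|n [IHc IHs]].
  - simpl; rewrite Rmult_0_l; split; [apply cos_0 | apply sin_0].
  - rewrite S_INR, Rmult_plus_distr_r, Rmult_1_l, cos_plus, sin_plus, IHc, IHs, cos_2PI, sin_2PI.
    split; ring.
Qed.

Lemma is_RInt_R_ext (f g : R -> R) (a b v : R) :
  (forall z, f z = g z) -> is_RInt f a b v -> is_RInt g a b v.
Proof. intros E; apply is_RInt_ext; intros; apply E. Qed.

Definition cos_mass (k : nat) : R := match k with O => 2 * PI | _ => PI end.

Lemma is_RInt_R_const (c a b : R) : is_RInt (fun _ => c) a b ((b - a) * c).
Proof. exact (is_RInt_const (V := R_NormedModule) a b c). Qed.

Lemma is_RInt_R_plus (f g : R -> R) (a b u v : R) :
  is_RInt f a b u -> is_RInt g a b v -> is_RInt (fun z => f z + g z) a b (u + v).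
Proof. intros; apply (is_RInt_plus (V := R_NormedModule)); auto. Qed.

Lemma is_RInt_R_scal (f : R -> R) (c a b u : R) :
  is_RInt f a b u -> is_RInt (fun z => c * f z) a b (c * u).
Proof. intros; apply (is_RInt_scal (V := R_NormedModule)); auto. Qed.

Lemma is_RInt_cos_cos n k :
  is_RInt (fun z => cos (INR n * z) * cos (INR k * z)) 0 (2 * PI)
    (if Nat.eqb n k then cos_mass k else 0).
Proof.
  destruct (cos_sin_INR_2PI n) as [Cn Sn]. destruct (cos_sin_INR_2PI k) as [Ck Sk].
  apply (is_RInt_R_ext (fun z => / 2 * (cos ((INR n + INR k) * z) + cos ((INR n - INR k) * z)))).
  { intros z. rewrite Rmult_plus_distr_r, Rmult_minus_distr_r, cos_plus, cos_minus. field. }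
  assert (Sp : sin ((INR n + INR k) * (2 * PI)) = 0).
  { rewrite Rmult_plus_distr_r, sin_plus, Sn, Sk; ring. }
  assert (Sm : sin ((INR n - INR k) * (2 * PI)) = 0).
  { rewrite Rmult_minus_distr_r, sin_minus, Sn, Sk; ring. }
  destruct (Nat.eqb_spec n k) as [-> | Hnk].
  - destruct k as [|k]; simpl cos_mass.
    + replace (2 * PI) with (/ 2 * ((2 * PI - 0) * 1 + (2 * PI - 0) * 1)) at 2 by field.
      apply is_RInt_R_scal, is_RInt_R_plus;
        apply (is_RInt_R_ext (fun _ => 1)); try apply is_RInt_R_const;
        intros; simpl; rewrite ?Rplus_0_r, ?Rminus_diag, Rmult_0_l, cos_0; auto.
    + replace PI with (/ 2 * (0 + (2 * PI - 0) * 1)) at 2 by field.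
      apply is_RInt_R_scal, is_RInt_R_plus.
      * apply is_RInt_cos_freq; [pose proof (pos_INR k); rewrite S_INR; lra | exact Sp].
      * apply (is_RInt_R_ext (fun _ => 1)); [| apply is_RInt_R_const].
        intros; rewrite Rminus_diag, Rmult_0_l, cos_0; auto.
  - replace 0 with (/ 2 * (0 + 0)) at 2 by field.
    apply is_RInt_R_scal, is_RInt_R_plus; apply is_RInt_cos_freq; auto.
    + pose proof (pos_INR n); pose proof (pos_INR k). intros E.
      assert (En : INR n = 0) by lra. assert (Ek : INR k = 0) by lra.
      apply Hnk. apply INR_eq; lra.
    + intros E; apply Hnk, INR_eq; lra.
Qed.

Lemma is_RInt_cos_sin n k :
  is_RInt (fun z => cos (INR n * z) * sin (INR k * z)) 0 (2 * PI) 0.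
Proof.
  destruct (cos_sin_INR_2PI n) as [Cn Sn]. destruct (cos_sin_INR_2PI k) as [Ck Sk].
  apply (is_RInt_R_ext (fun z => / 2 * (sin ((INR k + INR n) * z) + sin ((INR k - INR n) * z)))).
  { intros z. rewrite Rmult_plus_distr_r, Rmult_minus_distr_r, sin_plus, sin_minus. field. }
  replace 0 with (/ 2 * (0 + 0)) at 2 by field.
  apply is_RInt_R_scal, is_RInt_R_plus; apply is_RInt_sin_freq.
  - rewrite Rmult_plus_distr_r, cos_plus, Cn, Sn, Ck, Sk; ring.
  - rewrite Rmult_minus_distr_r, cos_minus, Cn, Sn, Ck, Sk; ring.
Qed.

(** Orthogonality of the cosines. As a frequency may be repeated infinitely often, a Fourier
    coefficient is itself a series. *)
Lemma cosine_series_fa (c : nat -> R) (n : nat -> nat) (B : R) (g : R -> R) k :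
  abs_bounded c B ->
  (forall z, is_series (fun m => c m * cos (INR (n m) * z)) (g z)) ->
  is_series (fun m => if Nat.eqb (n m) k then c m else 0) (fa g k).
Proof.
  intros HB Hg.
  destruct (is_RInt_series (fun m z => c m * (cos (INR (n m) * z) * cos (INR k * z)))
     (fun m => Rabs (c m)) (fun m => c m * (if Nat.eqb (n m) k then cos_mass k else 0))
     B 0 (2 * PI) (fun z => g z * cos (INR k * z))) as (v & H1 & H2); auto.
  - intros m; apply is_RInt_R_scal, is_RInt_cos_cos.
  - intros m z. rewrite <- (Rmult_1_r (Rabs (c m))).
    apply Rabs_mult_le; [lra |]. rewrite <- (Rmult_1_l 1). apply Rabs_mult_le; apply Rabs_cos_le1.
  - intros z. rewrite (Rmult_comm (g z)).
    eapply is_series_ext; [| apply is_series_R_scal; apply Hg]. intros; simpl; ring.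
  - assert (E : fa g k = / cos_mass k * v).
    { unfold fa, cos_mass; destruct k.
      - rewrite <- (is_RInt_unique _ _ _ _ H2). f_equal. apply RInt_ext.
        intros; simpl; rewrite Rmult_0_l, cos_0; ring.
      - rewrite <- (is_RInt_unique _ _ _ _ H2). reflexivity. }
    rewrite E. eapply is_series_ext; [| apply is_series_R_scal; exact H1].
    intros m; simpl. pose proof PI_RGT_0.
    destruct (Nat.eqb (n m) k); [| ring]. unfold cos_mass; destruct k; field; lra.
Qed.

Lemma cosine_series_fb (c : nat -> R) (n : nat -> nat) (B : R) (g : R -> R) k :
  abs_bounded c B ->
  (forall z, is_series (fun m => c m * cos (INR (n m) * z)) (g z)) ->
  fb g k = 0.
Proof.
  intros HB Hg.
  destruct (is_RInt_series (fun m z => c m * (cos (INR (n m) * z) * sin (INR k * z)))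
     (fun m => Rabs (c m)) (fun m => c m * 0)
     B 0 (2 * PI) (fun z => g z * sin (INR k * z))) as (v & H1 & H2); auto.
  - intros m; apply is_RInt_R_scal, is_RInt_cos_sin.
  - intros m z. rewrite <- (Rmult_1_r (Rabs (c m))).
    apply Rabs_mult_le; [lra |]. rewrite <- (Rmult_1_l 1).
    apply Rabs_mult_le; [apply Rabs_cos_le1 |]. apply Rabs_le; apply SIN_bound.
  - intros z. rewrite (Rmult_comm (g z)).
    eapply is_series_ext; [| apply is_series_R_scal; apply Hg]. intros; simpl; ring.
  - unfold fb. rewrite (is_RInt_unique _ _ _ _ H2).
    replace v with 0; [ring |]. apply (is_series_uniq (fun m => c m * 0)); auto.
    eapply is_series_ext; [| apply is_series_zero]. intros; simpl; ring.
Qed.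

(* Exchanging the sum over the frequency [k] and the sum over the repeated modes [m]. *)
Lemma cosine_series_multiplier (c : nat -> R) (n : nat -> nat) (B : R) (g : R -> R) (s : nat -> R) (S z : R) :
  abs_bounded c B ->
  (forall z, is_series (fun m => c m * cos (INR (n m) * z)) (g z)) ->
  (forall k, Rabs (s k) <= S) ->
  exists v, is_series (fun m => s (n m) * c m * cos (INR (n m) * z)) v /\
            is_series (fun k => s k * fa g k * cos (INR k * z)) v.
Proof.
  intros HB Hg HS.
  assert (S0 : 0 <= S) by (eapply Rle_trans; [apply Rabs_pos | apply (HS O)]).
  (* Row [m] has its only entry in column [n m]: summing rows gives the terms of the expansion,
     summing column [k] gives the [k]-th Fourier mode. *)
  set (a := fun m k => if Nat.eqb k (n m) then s (n m) * c m * cos (INR (n m) * z) else 0).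
  set (e := fun m => s (n m) * c m * cos (INR (n m) * z)).
  assert (He : forall m, Rabs (e m) <= S * Rabs (c m)).
  { intros m. unfold e. rewrite <- (Rmult_1_r (S * _)). apply Rabs_mult_le; [| apply Rabs_cos_le1].
    apply Rabs_mult_le; [apply HS | lra]. }
  assert (HeB : abs_bounded e (S * B)).
  { intros N. eapply Rle_trans; [apply sum_Rle; intros; apply He |].
    rewrite sum_f_R0_scal. apply Rmult_le_compat_l; auto. }
  destruct (abs_bounded_ex_series _ _ HeB) as [v Hv].
  exists v; split; [exact Hv |].
  apply (series_exchange a (fun m => Rabs (e m)) e _ (S * B)); auto.
  - intros m; apply abs_bounded_single; unfold e; lra.
  - intros m; apply is_series_single.
  - intros k. pose proof (is_series_R_scal (s k * cos (INR k * z)) _ _ (cosine_series_fa c n B g k HB Hg)) as H.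
    replace (s k * fa g k * cos (INR k * z)) with (s k * cos (INR k * z) * fa g k) by ring.
    eapply is_series_ext; [| exact H]. intros m; unfold a; simpl.
    rewrite (Nat.eqb_sym k). destruct (Nat.eqb_spec (n m) k) as [-> |]; ring.
Qed.

Definition cosine_series (g : R -> R) (B : R) : Prop :=
  exists (c : nat -> R) (n : nat -> nat),
    abs_bounded (fun m => c m * 2 ^ n m) B /\
    forall z, is_series (fun m => c m * cos (INR (n m) * z)) (g z).

Lemma pow2_ge1 n : 1 <= 2 ^ n.
Proof. apply pow_R1_Rle; lra. Qed.

Lemma abs_bounded_drop_pow2 (c : nat -> R) (n : nat -> nat) B :
  abs_bounded (fun m => c m * 2 ^ n m) B -> abs_bounded c B.
Proof.
  intros H; apply (abs_bounded_le H); [| lra].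
  intros k. rewrite Rabs_mult, (Rabs_pos_eq (2 ^ _)) by (apply pow_le; lra).
  rewrite <- (Rmult_1_r (Rabs (c k))) at 1.
  apply Rmult_le_compat_l; [apply Rabs_pos | apply pow2_ge1].
Qed.

Lemma slice_modes p rho (f : pfun) B (g : nat -> R) (t : nat -> mode) x : 0 <= rho ->
  abs_bounded (fun m => g m * weight rho (t m)) B ->
  (forall y, box p rho y -> forall z, is_series (fun m => g m * atom p (t m) y z) (f y z)) ->
  box p rho x ->
  abs_bounded (fun m => g m * monomial p (t m) x) B /\
  forall z, is_series (fun m => g m * monomial p (t m) x * cos (INR (ez (t m)) * z)) (f x z).
Proof.
  intros Hr Hb Hs Hx. split.
  - apply (abs_bounded_le Hb); [| lra]. intros m. rewrite !Rabs_mult.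
    apply Rmult_le_compat_l; [apply Rabs_pos |].
    rewrite (Rabs_pos_eq (weight _ _)) by (apply weight_ge0; auto). unfold weight.
    rewrite <- (Rmult_1_r (Rabs _)).
    apply Rmult_le_compat; [apply Rabs_pos | lra | apply monomial_le; auto | apply pow2_ge1].
  - intros z. eapply is_series_ext; [| apply Hs; auto]. intros; unfold atom; simpl; ring.
Qed.

Lemma normed_slice p rho f B x :
  normed p rho f B -> box p rho x -> cosine_series (f x) B.
Proof.
  intros (Hr & g & t & Hb & Hs) Hx.
  exists (fun m => g m * monomial p (t m) x), (fun m => ez (t m)). split.
  - apply (abs_bounded_le Hb); [| lra]. intros k.
    rewrite Rmult_assoc, !(Rabs_mult (g k)). apply Rmult_le_compat_l; [apply Rabs_pos |].
    rewrite (Rabs_pos_eq (weight _ _)) by (apply weight_ge0; auto). unfold weight.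
    apply Rabs_mult_le; [apply monomial_le; auto | rewrite Rabs_pos_eq; [lra | apply pow_le; lra]].
  - intros z. eapply is_series_ext; [| apply Hs; auto].
    intros; unfold atom; simpl; ring.
Qed.
Arguments normed_slice {p} {rho} {f} {B} {x}.

Lemma cosine_series_fb0 g B k : cosine_series g B -> fb g k = 0.
Proof.
  intros (c & n & Hb & Hg). eapply cosine_series_fb; [| exact Hg].
  eapply abs_bounded_drop_pow2; exact Hb.
Qed.

Lemma cosine_series_ex_RInt g B k :
  cosine_series g B -> ex_RInt (fun z => g z * cos (INR k * z)) 0 (2 * PI).
Proof.
  intros (c & n & Hb & Hg). apply abs_bounded_drop_pow2 in Hb.
  destruct (is_RInt_series (fun m z => c m * (cos (INR (n m) * z) * cos (INR k * z)))
     (fun m => Rabs (c m)) (fun m => c m * (if Nat.eqb (n m) k then cos_mass k else 0))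
     B 0 (2 * PI) (fun z => g z * cos (INR k * z))) as (v & H1 & H2); [| | exact Hb | |].
  - intros m; apply is_RInt_R_scal, is_RInt_cos_cos.
  - intros m z. rewrite <- (Rmult_1_r (Rabs (c m))).
    apply Rabs_mult_le; [lra |]. rewrite <- (Rmult_1_l 1). apply Rabs_mult_le; apply Rabs_cos_le1.
  - intros z. rewrite (Rmult_comm (g z)).
    eapply is_series_ext; [| apply is_series_R_scal; apply Hg]. intros; simpl; ring.
  - exists v; exact H2.
Qed.

Lemma fa_RInt g k : fa g k = / cos_mass k * RInt (fun z => g z * cos (INR k * z)) 0 (2 * PI).
Proof.
  unfold fa, cos_mass; destruct k; [| reflexivity]. f_equal. apply RInt_ext.
  intros; simpl; rewrite Rmult_0_l, cos_0; ring.
Qed.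

Lemma fa_ext f g k : (forall z, f z = g z) -> fa f k = fa g k.
Proof. intros E; rewrite !fa_RInt. f_equal. apply RInt_ext; intros; rewrite E; auto. Qed.

Lemma fa_plus f g B C k : cosine_series f B -> cosine_series g C ->
  fa (fun z => f z + g z) k = fa f k + fa g k.
Proof.
  intros Hf Hg. rewrite !fa_RInt, <- Rmult_plus_distr_l. f_equal.
  rewrite <- (RInt_plus (V := R_CompleteNormedModule)); [| eapply cosine_series_ex_RInt; eauto ..].
  apply RInt_ext; intros. unfold plus; simpl; ring.
Qed.

Lemma fa_scal f c B k : cosine_series f B -> fa (fun z => c * f z) k = c * fa f k.
Proof.
  intros Hf. rewrite !fa_RInt.
  replace (c * (/ cos_mass k * RInt (fun z => f z * cos (INR k * z)) 0 (2 * PI)))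
    with (/ cos_mass k * (c * RInt (fun z => f z * cos (INR k * z)) 0 (2 * PI))) by ring.
  f_equal.
  transitivity (RInt (fun z => scal c (f z * cos (INR k * z))) 0 (2 * PI)).
  - apply RInt_ext; intros. unfold scal; simpl; unfold mult; simpl; ring.
  - apply (RInt_scal (V := R_CompleteNormedModule)). eapply cosine_series_ex_RInt; eauto.
Qed.

Lemma fa_cos n k : fa (fun z => cos (INR n * z)) k = if Nat.eqb n k then 1 else 0.
Proof.
  rewrite fa_RInt, (is_RInt_unique _ _ _ _ (is_RInt_cos_cos n k)).
  pose proof PI_RGT_0. destruct (Nat.eqb n k); [| ring]. unfold cos_mass; destruct k; field; lra.
Qed.

Lemma cosine_series_fourier g B z :
  cosine_series g B -> is_series (fun k => fa g k * cos (INR k * z)) (g z).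
Proof.
  intros (c & n & Hb & Hg). apply abs_bounded_drop_pow2 in Hb.
  destruct (cosine_series_multiplier c n B g (fun _ => 1) 1 z Hb Hg) as (v & H1 & H2).
  { intros; rewrite Rabs_R1; lra. }
  replace (g z) with v.
  - eapply is_series_ext; [| exact H2]. intros; simpl; ring.
  - eapply is_series_uniq; [exact H1 |]. eapply is_series_ext; [| apply Hg]. intros; simpl; ring.
Qed.

Lemma cosine_series_even g B : cosine_series g B -> even_fun g.
Proof.
  intros (c & n & Hb & Hg) z. eapply is_series_uniq; [apply Hg |].
  eapply is_series_ext; [| apply Hg]. intros m; simpl.
  rewrite Ropp_mult_distr_r_reverse, cos_neg; auto.
Qed.

Lemma cosine_series_periodic g B : cosine_series g B -> periodic2pi g.
Proof.
  intros (c & n & Hb & Hg) z. eapply is_series_uniq; [apply Hg |].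
  eapply is_series_ext; [| apply Hg]. intros m; simpl.
  destruct (cos_sin_INR_2PI (n m)) as [C S].
  rewrite Rmult_plus_distr_l, cos_plus, C, S; ring.
Qed.

Lemma cos_INR_plus_PI n z : cos (INR n * (z + PI)) = (-1) ^ n * cos (INR n * z).
Proof.
  assert (H : cos (INR n * PI) = (-1) ^ n /\ sin (INR n * PI) = 0).
  { induction n as [|n [IHc IHs]].
    - simpl; rewrite Rmult_0_l; split; [apply cos_0 | apply sin_0].
    - rewrite S_INR, Rmult_plus_distr_r, Rmult_1_l, cos_plus, sin_plus, IHc, IHs, cos_PI, sin_PI.
      simpl; split; ring. }
  destruct H as [C S]. rewrite Rmult_plus_distr_l, cos_plus, C, S; ring.
Qed.

Lemma Rabs_pow_opp1 n : Rabs ((-1) ^ n) = 1.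
Proof. rewrite <- RPow_abs. replace (Rabs (-1)) with 1 by (rewrite Rabs_left; lra). apply pow1. Qed.

(** Serves the symmetry that relates the amplitudes [a] and [-a] by a shift of half a period. *)
Lemma fa_shift_PI g B k : cosine_series g B -> fa (fun z => g (z + PI)) k = (-1) ^ k * fa g k.
Proof.
  intros (c & n & Hb & Hg). apply abs_bounded_drop_pow2 in Hb.
  pose proof (cosine_series_fa c n B g k Hb Hg) as H1.
  assert (Hb' : abs_bounded (fun m => (-1) ^ n m * c m) B).
  { apply (abs_bounded_le Hb); [| lra]. intros m.
    rewrite Rabs_mult, Rabs_pow_opp1; lra. }
  assert (Hg' : forall z, is_series (fun m => (-1) ^ n m * c m * cos (INR (n m) * z)) (g (z + PI))).
  { intros z. eapply is_series_ext; [| apply Hg]. intros m; simpl. rewrite cos_INR_plus_PI; ring. }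
  eapply is_series_uniq; [apply (cosine_series_fa _ n B (fun z => g (z + PI)) k Hb' Hg') |].
  eapply is_series_ext; [| apply is_series_R_scal; exact H1].
  intros m; simpl. destruct (Nat.eqb_spec (n m) k) as [-> |]; ring.
Qed.

Lemma cosine_series_shift_PI g B : cosine_series g B -> cosine_series (fun z => g (z + PI)) B.
Proof.
  intros (c & n & Hb & Hg). exists (fun m => (-1) ^ n m * c m), n. split.
  - apply (abs_bounded_le Hb); [| lra]. intros m.
    rewrite !Rabs_mult, Rabs_pow_opp1; lra.
  - intros z. eapply is_series_ext; [| apply Hg]. intros m; simpl. rewrite cos_INR_plus_PI; ring.
Qed.

Lemma normed_fa p rho f B k :
  normed p rho f B -> normed p rho (fun x _ => fa (f x) k) B.
Proof.
  intros (Hr & g & t & Hb & Hs).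
  (* A Fourier coefficient is constant in [z]: the frequency is reset to 0 and the exponents of the
     parameters are kept, which can only lower the weight. *)
  set (t0 m := Mode (ea (t m)) (ek (t m)) (eb (t m)) (ed (t m)) 0).
  apply normed_series with
    (f := fun m x z => (if Nat.eqb (ez (t m)) k then g m else 0) * atom p (t0 m) x z)
    (B := fun m => Rabs (g m * weight rho (t m))); auto.
  - intros m. eapply normed_le; [apply normed_atom; auto |].
    rewrite Rabs_mult, (Rabs_pos_eq (weight rho (t m))) by (apply weight_ge0; auto).
    apply Rmult_le_compat; [apply Rabs_pos | apply weight_ge0; auto | |].
    + destruct (Nat.eqb (ez (t m)) k); [lra | rewrite Rabs_R0; apply Rabs_pos].
    + unfold weight. apply Rmult_le_compat_l; [apply pow_le; auto | apply pow2_ge1].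
  - intros x z Hx.
    destruct (slice_modes p rho f B g t x Hr Hb Hs Hx) as [Hb' Hg'].
    eapply is_series_ext; [| apply (cosine_series_fa _ _ B (f x) k Hb' Hg')].
    intros m; simpl. unfold atom, t0, monomial; simpl. rewrite Rmult_0_l, cos_0.
    destruct (Nat.eqb (ez (t m)) k); ring.
Qed.

(** The symbol depends on kappa, so the operator acts on the expansion in kappa as well. [Series]
    makes it total, hence usable in an iteration that knows no base point; convergence is
    [multiplier_series]. *)
Definition multiplier (s : nat -> R -> R) (f : pfun) (x : point) (z : R) : R :=
  Series (fun k => s k (pk x) * fa (f x) k * cos (INR k * z)).

Lemma multiplier_series p rho s S f B x z :
  (forall k, normed p rho (fun y _ => s k (pk y)) S) -> normed p rho f B -> box p rho x ->
  is_series (fun k => s k (pk x) * fa (f x) k * cos (INR k * z)) (multiplier s f x z).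
Proof.
  intros Hk Hf Hx. destruct (normed_slice Hf Hx) as (c & n & Hb & Hg).
  apply abs_bounded_drop_pow2 in Hb.
  destruct (cosine_series_multiplier c n B (f x) (fun k => s k (pk x)) S z Hb Hg) as (v & H1 & H2).
  { intros k. apply (normed_bound 0 (Hk k) Hx). }
  unfold multiplier. rewrite (is_series_unique _ _ H2). exact H2.
Qed.

Lemma normed_multiplier p rho s S f B :
  (forall k, normed p rho (fun y _ => s k (pk y)) S) -> normed p rho f B ->
  normed p rho (multiplier s f) (S * B).
Proof.
  intros Hk Hf. pose proof Hf as (Hr & g & t & Hb & Hs).
  pose proof (normed_ge0 (Hk O)) as HS.
  apply normed_series with
    (f := fun m x z => s (ez (t m)) (pk x) * (g m * atom p (t m) x z))
    (B := fun m => S * Rabs (g m * weight rho (t m))); auto.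
  - intros m. apply (@normed_mult _ _ (fun x _ => s (ez (t m)) (pk x))); auto.
    eapply normed_le; [apply normed_atom; auto |].
    rewrite Rabs_mult, (Rabs_pos_eq (weight rho (t m))) by (apply weight_ge0; auto). lra.
  - intros n. rewrite sum_f_R0_scal. apply Rmult_le_compat_l; auto.
  - intros x z Hx.
    destruct (slice_modes p rho f B g t x Hr Hb Hs Hx) as [Hb' Hg'].
    destruct (cosine_series_multiplier _ _ B (f x) (fun k => s k (pk x)) S z Hb' Hg') as (v & H1 & H2).
    { intros k. apply (normed_bound 0 (Hk k) Hx). }
    unfold multiplier. rewrite (is_series_unique _ _ H2).
    eapply is_series_ext; [| exact H1]. intros m; simpl. unfold atom; ring.
Qed.
Arguments normed_multiplier {p} {rho} {s} {S} {f} {B}.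

(** * Smoothness and analyticity *)

(** A quadratic remainder uniform in [x]: summed against the coefficients, it differentiates a
    cosine series straight from the definition of the derivative. *)
Lemma cos_taylor1 x t : Rabs (cos (x + t) - cos x + t * sin x) <= t ^ 2.
Proof.
  assert (Hs : forall s, Rabs (sin x - sin (x + s)) <= Rabs s).
  { intros s. destruct (MVT_abs sin cos (x + s) x) as (c & Hc & _).
    - intros; apply derivable_pt_lim_sin.
    - rewrite Hc. replace (x - (x + s)) with (- s) by ring. rewrite Rabs_Ropp.
      rewrite <- (Rmult_1_l (Rabs s)) at 2. apply Rmult_le_compat_r; [apply Rabs_pos |].
      apply Rabs_cos_le1. }
  destruct (MVT_abs (fun s => cos (x + s) - cos x + s * sin x) (fun s => sin x - sin (x + s)) 0 t)
    as (c & Hc & Hr).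
  - intros c _. apply is_derive_Reals. auto_derive; [auto | ring].
  - rewrite Rplus_0_r, Rmult_0_l, Rminus_0_r, Rplus_0_r in Hc.
    replace (cos (x + t) - cos x + t * sin x - (cos x - cos x))
      with (cos (x + t) - cos x + t * sin x) in Hc by ring.
    rewrite Hc. replace (t ^ 2) with (Rabs t * Rabs t) by (rewrite <- Rabs_mult, Rabs_pos_eq; nra).
    apply Rmult_le_compat_r; [apply Rabs_pos |].
    eapply Rle_trans; [apply Hs |].
    unfold Rmin, Rmax in Hr. destruct (Rle_dec 0 t); unfold Rabs; destruct (Rcase_abs c), (Rcase_abs t); lra.
Qed.

Lemma INR_le_geometric s n : 1 < s -> INR n <= / (s - 1) * s ^ n.
Proof.
  intros Hs. pose proof (poly n (s - 1) ltac:(lra)) as H.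
  replace (1 + (s - 1)) with s in H by ring.
  apply Rmult_le_reg_l with (s - 1); [lra |].
  rewrite <- Rmult_assoc, Rinv_r, Rmult_1_l; lra.
Qed.

(** A class closed under differentiation. The phase [phi] absorbs the passage from cosine to minus
    sine as a shift by [PI / 2]; the base [r] is left free because each derivative spends part of
    the decay on the factor [n]. *)
Definition phase_series (g : R -> R) : Prop :=
  exists (c : nat -> R) (n : nat -> nat) (phi r B : R), 1 < r /\
    abs_bounded (fun m => c m * r ^ n m) B /\
    forall z, is_series (fun m => c m * cos (INR (n m) * z + phi)) (g z).

Lemma phase_series_derive g :
  phase_series g -> exists g', phase_series g' /\ forall z, is_derive g z (g' z).
Proof.
  intros (c & n & phi & r & B & Hr & Hb & Hg).
  (* [r ^ n] splits into two factors [s ^ n]. One of them absorbs [n] and leaves decay for the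
     derivative; both together absorb the [n ^ 2] of the Taylor remainder. *)
  set (s := sqrt r).
  assert (Hs : 1 < s) by (unfold s; rewrite <- sqrt_1; apply sqrt_lt_1; lra).
  assert (Hss : s * s = r) by (apply sqrt_sqrt; lra).
  set (D := / (s - 1)).
  assert (HD : 0 < D) by (apply Rinv_0_lt_compat; lra).
  assert (Hrs : forall k, r ^ k = s ^ k * s ^ k) by (intros; rewrite <- Hss; apply Rpow_mult_distr).
  assert (Hn : forall k, 0 <= INR k <= D * s ^ k)
    by (intros; split; [apply pos_INR | apply INR_le_geometric; auto]).
  assert (Hsp : forall k, 0 < s ^ k) by (intros; apply pow_lt; lra).
  assert (Hs1 : forall k, 1 <= s ^ k) by (intros; apply pow_R1_Rle; lra).
  assert (Hb1 : abs_bounded (fun m => INR (n m) * c m * s ^ n m) (D * B)).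
  { apply (@abs_bounded_le _ (fun m => D * (c m * r ^ n m)) (D * B)); [| | lra].
    - apply abs_bounded_scal_pos; [lra | auto].
    - intros m. rewrite Hrs, !Rabs_mult, !(Rabs_pos_eq (s ^ _)), (Rabs_pos_eq D), (Rabs_pos_eq (INR _))
        by (first [apply pos_INR | apply Rlt_le; auto]).
      pose proof (Hn (n m)). pose proof (Hsp (n m)). pose proof (Rabs_pos (c m)).
      apply Rle_trans with (D * s ^ n m * Rabs (c m) * s ^ n m); [| right; ring].
      apply Rmult_le_compat_r; [lra |]. apply Rmult_le_compat_r; lra. }
  assert (Hb2 : abs_bounded (fun m => INR (n m) ^ 2 * c m) (D ^ 2 * B)).
  { apply (@abs_bounded_le _ (fun m => D ^ 2 * (c m * r ^ n m)) (D ^ 2 * B)); [| | lra].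
    - apply abs_bounded_scal_pos; [apply pow_le; lra | auto].
    - intros m. pose proof (Hn (n m)). pose proof (Hsp (n m)). pose proof (Rabs_pos (c m)).
      rewrite Hrs, !Rabs_mult, !(Rabs_pos_eq (s ^ _)), (Rabs_pos_eq (D ^ 2)), (Rabs_pos_eq (INR _ ^ 2))
        by (try apply pow_le; lra).
      apply Rle_trans with ((D * s ^ n m) ^ 2 * Rabs (c m)); [| right; ring].
      apply Rmult_le_compat_r; [lra |]. apply pow_incr; lra. }
  assert (Hb1' : abs_bounded (fun m => INR (n m) * c m) (D * B)).
  { apply (abs_bounded_le Hb1); [| lra]. intros m.
    rewrite (Rabs_mult _ (s ^ n m)), (Rabs_pos_eq (s ^ n m)) by (apply Rlt_le; auto).
    pose proof (Rabs_pos (INR (n m) * c m)). pose proof (Hs1 (n m)). nra. }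
  assert (Hex : forall z, exists v, is_series (fun m => INR (n m) * c m * cos (INR (n m) * z + (phi + PI / 2))) v).
  { intros z. apply (abs_bounded_ex_series _ (D * B)). apply (abs_bounded_le Hb1'); [| lra].
    intros m. rewrite <- (Rmult_1_r (Rabs (INR (n m) * c m))).
    apply Rabs_mult_le; [lra | apply Rabs_cos_le1]. }
  destruct (functional_choice _ Hex) as [g' Hg'].
  exists g'. split.
  { exists (fun m => INR (n m) * c m), n, (phi + PI / 2), s, (D * B). auto. }
  assert (Hquad : forall z h, Rabs (g (z + h) - g z - h * g' z) <= h ^ 2 * (D ^ 2 * B)).
  { intros z h.
    pose proof (is_series_R_plus (Hg (z + h)) (is_series_R_scal (-1) _ _
      (is_series_R_plus (Hg z) (is_series_R_scal h _ _ (Hg' z))))) as H.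
    replace (g (z + h) - g z - h * g' z) with (g (z + h) + -1 * (g z + h * g' z)) by ring.
    eapply is_series_abs_bounded; [exact H |].
    apply (@abs_bounded_le _ (fun m => h ^ 2 * (INR (n m) ^ 2 * c m)) (h ^ 2 * (D ^ 2 * B))); [| | lra].
    - apply abs_bounded_scal_pos; [apply pow2_ge_0 | auto].
    - intros m. rewrite <- Rplus_assoc, (cos_plus _ (PI / 2)), cos_PI2, sin_PI2.
      replace (INR (n m) * (z + h) + phi) with (INR (n m) * z + phi + INR (n m) * h) by ring.
      pose proof (cos_taylor1 (INR (n m) * z + phi) (INR (n m) * h)) as Ht.
      replace (_ + _) with (c m * (cos (INR (n m) * z + phi + INR (n m) * h) -
         cos (INR (n m) * z + phi) + INR (n m) * h * sin (INR (n m) * z + phi))) by ring.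
      replace (h ^ 2 * (INR (n m) ^ 2 * c m)) with (c m * (INR (n m) * h) ^ 2) by ring.
      rewrite !Rabs_mult. apply Rmult_le_compat_l; [apply Rabs_pos |].
      rewrite (Rabs_pos_eq (_ ^ 2)) by apply pow2_ge_0. exact Ht. }
  intros z. apply is_derive_Reals. intros eps Heps.
  assert (HC : 0 < D ^ 2 * B + 1).
  { pose proof (abs_bounded_ge0 _ _ Hb2). lra. }
  assert (Hd : 0 < eps / (D ^ 2 * B + 1)) by (apply Rdiv_lt_0_compat; auto).
  exists (mkposreal _ Hd). intros h Hh Hlt. simpl in Hlt.
  replace ((g (z + h) - g z) / h - g' z) with ((g (z + h) - g z - h * g' z) * / h) by (field; auto).
  rewrite Rabs_mult, Rabs_inv. apply Rle_lt_trans with (Rabs h * (D ^ 2 * B)).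
  - apply Rmult_le_reg_r with (Rabs h); [apply Rabs_pos_lt; auto |].
    rewrite Rmult_assoc, Rinv_l, Rmult_1_r by (apply Rabs_no_R0; auto).
    eapply Rle_trans; [apply Hquad |]. right.
    replace (h ^ 2) with (Rabs h * Rabs h) by (rewrite <- Rabs_mult, Rabs_pos_eq; nra). ring.
  - pose proof (Rabs_pos h).
    apply Rle_lt_trans with (Rabs h * (D ^ 2 * B + 1)); [nra |].
    apply Rmult_lt_reg_r with (/ (D ^ 2 * B + 1)); [apply Rinv_0_lt_compat; auto |].
    rewrite Rmult_assoc, Rinv_r, Rmult_1_r by lra. exact Hlt.
Qed.

Lemma phase_series_smooth g : phase_series g -> smooth g.
Proof.
  intros Hg.
  assert (H : forall n, exists gn, phase_series gn /\ forall z, Derive_n g n z = gn z).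
  { induction n as [|n (gn & Hn & En)].
    - exists g; split; auto.
    - destruct (phase_series_derive gn Hn) as (g' & Hg' & Hd).
      exists g'; split; [auto |]. intros z. simpl.
      rewrite (Derive_ext _ gn) by auto. apply is_derive_unique, Hd. }
  (* [ex_derive_n] at order 0 is [True]. *)
  intros [|n] z; [exact I |].
  destruct (H n) as (gn & Hn & En). destruct (phase_series_derive gn Hn) as (g' & _ & Hd).
  simpl. apply (ex_derive_ext gn); [intros; symmetry; auto |]. exists (g' z); apply Hd.
Qed.

Lemma cosine_series_smooth g B : cosine_series g B -> smooth g.
Proof.
  intros (c & n & Hb & Hg). apply phase_series_smooth.
  exists c, n, 0, 2, B. repeat split; [lra | exact Hb |].
  intros z. eapply is_series_ext; [| apply Hg]. intros; simpl; rewrite Rplus_0_r; auto.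
Qed.

Definition same_exponents (t : mode) (i j k l : nat) : bool :=
  (Nat.eqb (ea t) i && Nat.eqb (ek t) j && Nat.eqb (eb t) k && Nat.eqb (ed t) l)%bool.

Definition exponents_le (t : mode) (N : nat) : bool :=
  (Nat.leb (ea t) N && Nat.leb (ek t) N && Nat.leb (eb t) N && Nat.leb (ed t) N)%bool.

Lemma sum_f_R0_select (i N : nat) (x : nat -> R) :
  sum_f_R0 (fun k => if Nat.eqb i k then x k else 0) N = if Nat.leb i N then x i else 0.
Proof.
  induction N; cbn [sum_f_R0].
  - destruct i; reflexivity.
  - rewrite IHN. destruct (Nat.eqb_spec i (S N)), (Nat.leb_spec i N), (Nat.leb_spec i (S N));
      try lia; subst; lra.
Qed.

Lemma cube_sum_ext N u v : (forall i j k l, u i j k l = v i j k l) -> cube_sum N u = cube_sum N v.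
Proof.
  intros E. unfold cube_sum. do 4 (apply sum_eq; intros). apply E.
Qed.

Lemma cube_sum_select (t : mode) N (X : R) :
  cube_sum N (fun i j k l => if same_exponents t i j k l then X else 0)
  = if exponents_le t N then X else 0.
Proof.
  transitivity (sum_f_R0 (fun i => if Nat.eqb (ea t) i then
    sum_f_R0 (fun j => if Nat.eqb (ek t) j then
     sum_f_R0 (fun k => if Nat.eqb (eb t) k then
      sum_f_R0 (fun l => if Nat.eqb (ed t) l then X else 0) N else 0) N else 0) N else 0) N).
  - assert (Z : forall n, sum_f_R0 (fun _ => 0) n = 0) by (induction n; simpl; lra).
    assert (Z' : forall u n, (forall k, u k = 0) -> sum_f_R0 u n = 0).
    { intros u n Hu; rewrite <- (Z n); apply sum_eq; auto. }
    unfold cube_sum, same_exponents. apply sum_eq; intros i _.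
    destruct (Nat.eqb (ea t) i); simpl; [apply sum_eq; intros j _ | repeat (apply Z'; intros); auto].
    destruct (Nat.eqb (ek t) j); simpl; [apply sum_eq; intros k _ | repeat (apply Z'; intros); auto].
    destruct (Nat.eqb (eb t) k); simpl; [apply sum_eq; intros l _; auto | repeat (apply Z'; intros); auto].
  - rewrite sum_f_R0_select, sum_f_R0_select, sum_f_R0_select, (sum_f_R0_select (ed t) N (fun _ => X)).
    unfold exponents_le.
    destruct (Nat.leb (ea t) N), (Nat.leb (ek t) N), (Nat.leb (eb t) N), (Nat.leb (ed t) N); auto.
Qed.

Lemma cube_sum_series N (u : nat -> nat -> nat -> nat -> nat -> R) v :
  (forall i j k l, is_series (fun m => u m i j k l) (v i j k l)) ->
  is_series (fun m => cube_sum N (u m)) (cube_sum N v).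
Proof.
  intros H. unfold cube_sum.
  apply (is_series_sum_f_R0 (fun i m => sum_f_R0 (fun j => sum_f_R0 (fun k =>
    sum_f_R0 (fun l => u m i j k l) N) N) N)); intros i.
  apply (is_series_sum_f_R0 (fun j m => sum_f_R0 (fun k => sum_f_R0 (fun l => u m i j k l) N) N)); intros j.
  apply (is_series_sum_f_R0 (fun k m => sum_f_R0 (fun l => u m i j k l) N)); intros k.
  apply (is_series_sum_f_R0 (fun l m => u m i j k l)); intros l. apply H.
Qed.

Lemma exponents_le_eventually (t : nat -> mode) M :
  exists N0, forall N m, (N0 <= N)%nat -> (m <= M)%nat -> exponents_le (t m) N = true.
Proof.
  assert (H : forall m N, (ea (t m) + ek (t m) + eb (t m) + ed (t m) <= N)%nat ->
              exponents_le (t m) N = true).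
  { intros m N H. unfold exponents_le. rewrite !(proj2 (Nat.leb_le _ _)) by lia. reflexivity. }
  induction M as [|M [N0 IH]].
  - exists (ea (t 0%nat) + ek (t 0%nat) + eb (t 0%nat) + ed (t 0%nat))%nat.
    intros N m HN Hm. replace m with O by lia. apply H; lia.
  - exists (N0 + (ea (t (S M)) + ek (t (S M)) + eb (t (S M)) + ed (t (S M))))%nat.
    intros N m HN Hm. destruct (Nat.eq_dec m (S M)) as [-> |]; [apply H; lia | apply IH; lia].
Qed.

(** By absolute convergence any exhaustion by selected terms has the same limit: once the first [M]
    terms are kept, the error is at most the tail of the absolute series. The cube sums are such an
    exhaustion, selecting modes by their exponents. *)
Lemma is_series_filtered_limit (u : nat -> R) (B F : R) (keep : nat -> nat -> bool) (v : nat -> R) :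
  abs_bounded u B -> is_series u F ->
  (forall M, exists N0, forall N m, (N0 <= N)%nat -> (m <= M)%nat -> keep m N = true) ->
  (forall N, is_series (fun m => if keep m N then u m else 0) (v N)) ->
  is_lim_seq v F.
Proof.
  intros Hb HF Hk Hv. apply is_lim_seq_spec. intros eps.
  destruct (nonneg_sum_le_ex_series (fun m => Rabs (u m)) B (fun m => Rabs_pos _) Hb) as [s Hs].
  pose proof (proj1 (is_series_lim_seq _ _) Hs) as L. apply is_lim_seq_spec in L.
  destruct (L eps) as [M HM]. specialize (HM M (le_n M)). simpl in HM.
  destruct (Hk M) as [N0 HN0]. exists N0. intros N HN.
  pose proof (is_series_R_plus (Hv N) (is_series_R_scal (-1) _ _ HF)) as D.
  assert (T : Rabs (sum_f_R0 (fun m => (if keep m N then u m else 0) + -1 * u m) M - (v N + -1 * F))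
              <= s - sum_f_R0 (fun m => Rabs (u m)) M).
  { apply is_series_tail_le; auto. intros m. destruct (keep m N).
    - replace (u m + -1 * u m) with 0 by ring. rewrite Rabs_R0; apply Rabs_pos.
    - rewrite Rplus_0_l. replace (-1 * u m) with (- u m) by ring. rewrite Rabs_Ropp; lra. }
  rewrite (sum_eq _ (fun _ => 0)) in T.
  - replace (sum_f_R0 (fun _ => 0) M) with 0 in T by (clear; induction M; simpl; lra).
    replace (0 - (v N + -1 * F)) with (- (v N - F)) in T by ring. rewrite Rabs_Ropp in T.
    rewrite Rabs_minus_sym in HM. pose proof (Rle_abs (s - sum_f_R0 (fun m => Rabs (u m)) M)). lra.
  - intros m Hm. rewrite HN0 by lia. ring.
Qed.

Lemma is_series_Series (u : nat -> R) (v : R) : is_series u v -> is_series u (Series u).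
Proof. intros H; rewrite (is_series_unique u v H); exact H. Qed.

(** The place where repeated modes are regrouped: all modes with the same four exponents, whatever
    their frequency, are summed into one coefficient function of [z]. *)
Lemma normed_analytic4_at p rho f B :
  0 < rho -> normed p rho f B ->
  analytic4_at (fun a k b d => f (Pt a k b d)) (pa p) (pk p) (pb p) (pd p).
Proof.
  intros Hr (_ & g & t & Hb & Hs).
  (* The factor [2 ^ n] is dropped, since only a sup norm in [z] is wanted and cosines are bounded
     by 1. *)
  set (w m := g m * rho ^ degree (t m)).
  assert (Hw : abs_bounded w B).
  { apply (abs_bounded_le Hb); [| lra]. intros m. unfold w, weight.
    rewrite <- Rmult_assoc, (Rabs_mult _ (2 ^ _)), (Rabs_pos_eq (2 ^ _)) by (apply pow_le; lra).
    rewrite <- (Rmult_1_r (Rabs _)) at 1. apply Rmult_le_compat_l; [apply Rabs_pos | apply pow2_ge1]. }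
  assert (Hrp : forall n, 0 < rho ^ n) by (intros; apply pow_lt; auto).
  assert (Hdeg : forall m i j k l, same_exponents (t m) i j k l = true ->
            degree (t m) = (i + j + k + l)%nat /\ ea (t m) = i /\ ek (t m) = j /\ eb (t m) = k /\ ed (t m) = l).
  { intros m i j k l H. unfold same_exponents in H.
    repeat (apply andb_prop in H; destruct H as [H ?]).
    repeat match goal with H : Nat.eqb _ _ = true |- _ => apply Nat.eqb_eq in H end.
    unfold degree; repeat split; lia. }
  assert (HB : forall i j k l, exists v,
     is_series (fun m => if same_exponents (t m) i j k l then Rabs (w m) else 0) v).
  { intros. apply (abs_bounded_ex_series _ B). apply (abs_bounded_le Hw); [| lra].
    intros m; destruct (same_exponents _ _ _ _ _); [rewrite Rabs_Rabsolu; lra | rewrite Rabs_R0; apply Rabs_pos]. }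
  set (D i j k l := Series (fun m => if same_exponents (t m) i j k l then Rabs (w m) else 0)).
  assert (HD : forall i j k l,
     is_series (fun m => if same_exponents (t m) i j k l then Rabs (w m) else 0) (D i j k l)).
  { intros; destruct (HB i j k l) as [v Hv]. exact (is_series_Series _ _ Hv). }
  set (u m i j k l z := if same_exponents (t m) i j k l then g m * cos (INR (ez (t m)) * z) else 0).
  assert (Hu : forall i j k l z, abs_bounded (fun m => u m i j k l z) (D i j k l * / rho ^ (i + j + k + l))).
  { intros i j k l z N.
    rewrite Rmult_comm.
    eapply Rle_trans; [| apply Rmult_le_compat_l;
      [apply Rlt_le, Rinv_0_lt_compat; auto |
       apply (is_series_nonneg_partial _ _ N) with (2 := HD i j k l)]].
    - rewrite <- sum_f_R0_scal. apply sum_Rle. intros m _. unfold u.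
      destruct (same_exponents (t m) i j k l) eqn:E; [| rewrite Rabs_R0; lra].
      destruct (Hdeg _ _ _ _ _ E) as [E' _]. unfold w. rewrite E', (Rabs_mult (g m) (rho ^ _)),
        (Rabs_pos_eq (rho ^ _)) by (apply Rlt_le; auto).
      replace (/ rho ^ (i + j + k + l) * (Rabs (g m) * rho ^ (i + j + k + l))) with (Rabs (g m) * 1).
      + apply Rabs_mult_le; [lra | apply Rabs_cos_le1].
      + field. apply Rgt_not_eq, Hrp.
    - intros m; destruct (same_exponents _ _ _ _ _); [apply Rabs_pos | lra]. }
  set (coef i j k l z := Series (fun m => u m i j k l z)).
  assert (Hcoef : forall i j k l z, is_series (fun m => u m i j k l z) (coef i j k l z)).
  { intros. destruct (abs_bounded_ex_series _ _ (Hu i j k l z)) as [v Hv].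
    exact (is_series_Series _ _ Hv). }
  exists rho, coef, (fun i j k l => D i j k l * / rho ^ (i + j + k + l)), B.
  split; [auto |]. split; [| split].
  - intros. apply (is_series_abs_bounded _ _ _ (Hcoef i j k l z) (Hu i j k l z)).
  - intros N.
    rewrite (cube_sum_ext N _ D) by (intros; field; apply Rgt_not_eq, Hrp).
    apply (is_series_le_bound (cube_sum_series N _ D HD)).
    intros n. eapply Rle_trans; [| apply (Hw n)]. apply sum_Rle; intros m _.
    rewrite cube_sum_select. destruct (exponents_le (t m) N); [lra | apply Rabs_pos].
  - intros x1 x2 x3 x4 H1 H2 H3 H4 z.
    set (x := Pt x1 x2 x3 x4).
    assert (Hx : box p rho x) by (repeat split; simpl; lra).
    apply (is_series_filtered_limit (fun m => g m * atom p (t m) x z) B (f x z)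
             (fun m N => exponents_le (t m) N)).
    + apply (abs_bounded_le Hb); [| lra]. intros m. rewrite !Rabs_mult.
      apply Rmult_le_compat_l; [apply Rabs_pos |].
      rewrite (Rabs_pos_eq (weight _ _)) by (apply weight_ge0; lra). apply atom_le; auto; lra.
    + apply Hs; auto.
    + intros M; apply exponents_le_eventually.
    + intros N.
      pose proof (cube_sum_series N (fun m i j k l => u m i j k l z *
         (x1 - pa p) ^ i * (x2 - pk p) ^ j * (x3 - pb p) ^ k * (x4 - pd p) ^ l)
         (fun i j k l => coef i j k l z *
         (x1 - pa p) ^ i * (x2 - pk p) ^ j * (x3 - pb p) ^ k * (x4 - pd p) ^ l)) as K.
      eapply is_series_ext; [| apply K].
      * intros m. simpl. rewrite <- cube_sum_select. apply cube_sum_ext. intros i j k l.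
        unfold u. destruct (same_exponents (t m) i j k l) eqn:E; [| ring].
        destruct (Hdeg _ _ _ _ _ E) as (_ & <- & <- & <- & <-).
        unfold atom, monomial, x; simpl. ring.
      * intros i j k l.
        pose proof (is_series_R_scal ((x1 - pa p) ^ i * (x2 - pk p) ^ j * (x3 - pb p) ^ k * (x4 - pd p) ^ l)
                      _ _ (Hcoef i j k l z)) as H.
        replace (coef i j k l z * (x1 - pa p) ^ i * (x2 - pk p) ^ j * (x3 - pb p) ^ k * (x4 - pd p) ^ l)
          with ((x1 - pa p) ^ i * (x2 - pk p) ^ j * (x3 - pb p) ^ k * (x4 - pd p) ^ l * coef i j k l z) by ring.
        eapply is_series_ext; [| exact H]. intros; simpl; ring.
Qed.

(** * Contractions *)

Definition dist_le (p : point) (rho : R) (f g : pfun) (d : R) : Prop :=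
  normed p rho (fun x z => f x z - g x z) d.

Lemma dist_le_refl p rho f : 0 <= rho -> dist_le p rho f f 0.
Proof.
  intros Hr. apply normed_le with (Rabs 0); [| rewrite Rabs_R0; lra].
  eapply normed_ext; [| apply normed_const; exact Hr]. intros; simpl; ring.
Qed.

Lemma dist_le_sym p rho f g d : dist_le p rho f g d -> dist_le p rho g f d.
Proof.
  intros H; apply normed_opp in H. eapply normed_ext; [| exact H]. intros; simpl; ring.
Qed.
Arguments dist_le_sym {p} {rho} {f} {g} {d}.

Lemma dist_le_triangle p rho f g h d e :
  dist_le p rho f g d -> dist_le p rho g h e -> dist_le p rho f h (d + e).
Proof.
  intros H K. eapply normed_ext; [| apply (normed_plus H K)]. intros; simpl; ring.
Qed.
Arguments dist_le_triangle {p} {rho} {f} {g} {h} {d} {e}.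

Lemma dist_le_bound p rho f g d x z :
  dist_le p rho f g d -> box p rho x -> Rabs (f x z - g x z) <= d.
Proof. intros H Hx; apply (normed_bound z H Hx). Qed.

Lemma normed_of_dist_le p rho f g d B :
  dist_le p rho f g d -> normed p rho g B -> normed p rho f (B + d).
Proof.
  intros H K. rewrite Rplus_comm.
  eapply normed_ext; [| apply (normed_plus H K)]. intros; simpl; ring.
Qed.
Arguments normed_of_dist_le {p} {rho} {f} {g} {d} {B}.

Definition lim_pfun (u : nat -> pfun) (x : point) (z : R) : R :=
  real (Lim_seq (fun m => u m x z)).

(** Takes the place of completeness: the limit minus [u n] is the telescoping sum of the increments,
    and a countable sum of normed functions is normed. *)
Lemma dist_le_lim_pfun p rho (u : nat -> pfun) d :
  0 <= rho ->
  (forall m, dist_le p rho (u (S m)) (u m) (d * (/ 2) ^ S m)) ->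
  (forall x z, box p rho x -> is_lim_seq (fun m => u m x z) (lim_pfun u x z)) /\
  forall n, dist_le p rho (lim_pfun u) (u n) (d * (/ 2) ^ n).
Proof.
  intros Hr Hd.
  assert (Hd0 : 0 <= d).
  { pose proof (normed_ge0 (Hd O)) as H. simpl in H. lra. }
  assert (Htel : forall n m x z,
    sum_f_R0 (fun k => u (S (n + k)) x z - u (n + k)%nat x z) m = u (S (n + m)) x z - u n x z).
  { intros n m x z; induction m; simpl.
    - rewrite Nat.add_0_r; ring.
    - rewrite IHm, Nat.add_succ_r. ring. }
  assert (Hsum : forall n m, sum_f_R0 (fun k => d * (/ 2) ^ S (n + k)) m <= d * (/ 2) ^ n).
  { intros n m.
    rewrite (sum_eq _ (fun k => (d * (/ 2) ^ n * / 2) * (/ 2) ^ k)).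
    - rewrite sum_f_R0_scal. pose proof (sum_pow_le (/ 2) m ltac:(lra)).
      assert (0 <= d * (/ 2) ^ n) by (apply Rmult_le_pos; [auto | apply pow_le; lra]).
      apply Rle_trans with (d * (/ 2) ^ n * / 2 * / (1 - / 2)); [| right; field].
      apply Rmult_le_compat_l; [lra | auto].
    - intros; simpl; rewrite pow_add; ring. }
  assert (Hlim : forall x z, box p rho x -> is_lim_seq (fun m => u m x z) (lim_pfun u x z)).
  { intros x z Hx.
    destruct (abs_bounded_ex_series (fun k => u (S (0 + k)) x z - u (0 + k)%nat x z) (d * (/ 2) ^ 0))
      as [l Hl].
    { intros m. eapply Rle_trans; [| apply (Hsum O m)]. apply sum_Rle; intros k _.
      apply (dist_le_bound _ _ _ _ _ _ _ (Hd (0 + k)%nat) Hx). }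
    apply is_series_lim_seq in Hl.
    assert (L : is_lim_seq (fun m => u m x z) (u O x z + l)).
    { apply is_lim_seq_incr_1. apply is_lim_seq_ext with
        (fun m => u O x z + sum_f_R0 (fun k => u (S (0 + k)) x z - u (0 + k)%nat x z) m).
      - intros m; rewrite Htel; simpl; ring.
      - apply is_lim_seq_plus'; [apply is_lim_seq_const | exact Hl]. }
    unfold lim_pfun. rewrite (is_lim_seq_unique _ _ L). exact L. }
  split; [exact Hlim |].
  intros n. apply normed_series with (f := fun k x z => u (S (n + k)) x z - u (n + k)%nat x z)
    (B := fun k => d * (/ 2) ^ S (n + k)); auto.
  - intros m; apply Hd.
  - intros x z Hx. apply is_series_lim_seq.
    apply is_lim_seq_ext with (fun m => u (m + S n)%nat x z - u n x z).
    + intros m; rewrite Htel. replace (m + S n)%nat with (S (n + m)) by lia. auto.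
    + apply is_lim_seq_minus'; [| apply is_lim_seq_const].
      apply (is_lim_seq_incr_n (fun m => u m x z)). auto.
Qed.

Fixpoint iterates (T1 T2 : pfun -> pfun -> pfun) (f0 g0 : pfun) (m : nat) : pfun * pfun :=
  match m with
  | O => (f0, g0)
  | S m => let q := iterates T1 T2 f0 g0 m in (T1 (fst q) (snd q), T2 (fst q) (snd q))
  end.

Lemma Rabs_geometric_zero (y d : R) : (forall n, Rabs y <= d * (/ 2) ^ n) -> y = 0.
Proof.
  intros H. assert (L : is_lim_seq (fun n => d * (/ 2) ^ n) 0).
  { replace (Finite 0) with (Rbar_mult d 0) by (simpl; rewrite Rmult_0_r; auto).
    apply is_lim_seq_scal_l. apply is_lim_seq_geom. rewrite Rabs_pos_eq; lra. }
  assert (Rabs y <= 0).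
  { refine (is_lim_seq_le (fun _ => Rabs y) _ (Rabs y) 0 H _ L). apply is_lim_seq_const. }
  pose proof (Rabs_pos y). destruct (Req_dec y 0); auto. pose proof (Rabs_pos_lt y); lra.
Qed.

Section FixedPoint.
Variables (T1 T2 : pfun -> pfun -> pfun) (f0 g0 : pfun) (p : point) (rho d : R).

Definition contracting : Prop :=
  forall f g f' g' e,
    dist_le p rho f f0 d -> dist_le p rho g g0 d ->
    dist_le p rho f' f0 d -> dist_le p rho g' g0 d ->
    dist_le p rho f f' e -> dist_le p rho g g' e ->
    dist_le p rho (T1 f g) (T1 f' g') (/ 2 * e) /\ dist_le p rho (T2 f g) (T2 f' g') (/ 2 * e).

Let u m := fst (iterates T1 T2 f0 g0 m).
Let v m := snd (iterates T1 T2 f0 g0 m).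

Lemma contracting_fixed_point :
  0 <= rho ->
  dist_le p rho (T1 f0 g0) f0 (/ 2 * d) -> dist_le p rho (T2 f0 g0) g0 (/ 2 * d) ->
  contracting ->
  dist_le p rho (lim_pfun u) f0 d /\ dist_le p rho (lim_pfun v) g0 d /\
  (forall m, dist_le p rho (u m) f0 d /\ dist_le p rho (v m) g0 d) /\
  forall x z, box p rho x ->
    is_lim_seq (fun m => u m x z) (lim_pfun u x z) /\
    is_lim_seq (fun m => v m x z) (lim_pfun v x z) /\
    T1 (lim_pfun u) (lim_pfun v) x z = lim_pfun u x z /\
    T2 (lim_pfun u) (lim_pfun v) x z = lim_pfun v x z.
Proof.
  intros Hr H1 H2 HT.
  assert (Hd0 : 0 <= d) by (pose proof (normed_ge0 H1); lra).
  assert (Hball : forall m, d * (1 - (/ 2) ^ m) <= d).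
  { intros m. assert (0 <= (/ 2) ^ m) by (apply pow_le; lra). nra. }
  (* The two kinds of bounds need each other: the increments sum to [d (1 - 2^-m)], which keeps the
     iterates in the ball of radius [d] where the map contracts. *)
  assert (H : forall m,
    (dist_le p rho (u m) f0 (d * (1 - (/ 2) ^ m)) /\ dist_le p rho (v m) g0 (d * (1 - (/ 2) ^ m))) /\
    (dist_le p rho (u (S m)) (u m) (d * (/ 2) ^ S m) /\ dist_le p rho (v (S m)) (v m) (d * (/ 2) ^ S m))).
  { induction m as [|m [[Iu Iv] [Ju Jv]]].
    - split; split.
      + eapply normed_le; [apply dist_le_refl; auto | simpl; lra].
      + eapply normed_le; [apply dist_le_refl; auto | simpl; lra].
      + eapply normed_le; [exact H1 | simpl; lra].
      + eapply normed_le; [exact H2 | simpl; lra].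
    - assert (Ku : dist_le p rho (u (S m)) f0 (d * (1 - (/ 2) ^ S m))).
      { eapply normed_le; [apply (dist_le_triangle Ju Iu) | simpl; lra]. }
      assert (Kv : dist_le p rho (v (S m)) g0 (d * (1 - (/ 2) ^ S m))).
      { eapply normed_le; [apply (dist_le_triangle Jv Iv) | simpl; lra]. }
      split; [auto |].
      destruct (HT (u (S m)) (v (S m)) (u m) (v m) (d * (/ 2) ^ S m)) as [Lu Lv]; auto;
        try (eapply normed_le; [eassumption | apply Hball]).
      split; (eapply normed_le; [eassumption |]); simpl; lra. }
  destruct (dist_le_lim_pfun p rho u d Hr (fun m => proj1 (proj2 (H m)))) as [Cu Du].
  destruct (dist_le_lim_pfun p rho v d Hr (fun m => proj2 (proj2 (H m)))) as [Cv Dv].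
  assert (Bu : dist_le p rho (lim_pfun u) f0 d).
  { eapply normed_le; [apply (Du O) | simpl; lra]. }
  assert (Bv : dist_le p rho (lim_pfun v) g0 d).
  { eapply normed_le; [apply (Dv O) | simpl; lra]. }
  split; [exact Bu |]. split; [exact Bv |]. split.
  { intros m. destruct (H m) as [[Iu Iv] _].
    split; (eapply normed_le; [eassumption | apply Hball]). }
  intros x z Hx. split; [auto |]. split; [auto |].
  (* The image of the limit is compared with the image of iterate [n], which is iterate [n + 1],
     hence close to the limit. *)
  assert (K : forall n, dist_le p rho (T1 (lim_pfun u) (lim_pfun v)) (lim_pfun u) (d * (/ 2) ^ n) /\
                        dist_le p rho (T2 (lim_pfun u) (lim_pfun v)) (lim_pfun v) (d * (/ 2) ^ n)).
  { intros n. destruct (H n) as [[Iu Iv] _].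
    destruct (HT (lim_pfun u) (lim_pfun v) (u n) (v n) (d * (/ 2) ^ n)) as [Lu Lv]; auto;
      try (eapply normed_le; [eassumption | apply Hball]).
    split.
    - eapply normed_le; [apply (dist_le_triangle Lu (dist_le_sym (Du (S n)))) |].
      simpl; lra.
    - eapply normed_le; [apply (dist_le_triangle Lv (dist_le_sym (Dv (S n)))) |].
      simpl; lra. }
  split; apply Rminus_diag_uniq; apply (Rabs_geometric_zero _ d); intros n;
    destruct (K n) as [K1 K2]; eapply dist_le_bound; eauto.
Qed.
End FixedPoint.

(** * The dispersion relation *)

(** Functions of kappa alone have the same norm at all base points with wave number [k], whatever
    the other three parameters are. *)
Definition knormed (k rho : R) (f : R -> R) (B : R) : Prop :=
  forall p, pk p = k -> normed p rho (fun x _ => f (pk x)) B.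

Lemma knormed_restrict k rho rho' f B C :
  knormed k rho f B -> 0 <= rho' <= rho -> B <= C -> knormed k rho' f C.
Proof. intros H ? ? p Hp. eapply normed_le; [eapply normed_restrict; [apply H; auto | auto] | auto]. Qed.

Lemma knormed_ext k rho f g B :
  (forall y, Rabs (y - k) <= rho -> f y = g y) -> knormed k rho f B -> knormed k rho g B.
Proof.
  intros E H p Hp. eapply normed_ext; [| apply H; auto].
  intros x z (_ & Hx & _). apply E. rewrite <- Hp; auto.
Qed.

Lemma knormed_mult k rho f g B C :
  knormed k rho f B -> knormed k rho g C -> knormed k rho (fun y => f y * g y) (B * C).
Proof. intros H K p Hp. apply (@normed_mult _ _ (fun x _ => f (pk x)) (fun x _ => g (pk x))); auto. Qed.
Arguments knormed_mult {k} {rho} {f} {g} {B} {C}.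

Lemma knormed_plus k rho f g B C :
  knormed k rho f B -> knormed k rho g C -> knormed k rho (fun y => f y + g y) (B + C).
Proof. intros H K p Hp. apply (@normed_plus _ _ (fun x _ => f (pk x)) (fun x _ => g (pk x))); auto. Qed.
Arguments knormed_plus {k} {rho} {f} {g} {B} {C}.

Lemma knormed_opp k rho f B : knormed k rho f B -> knormed k rho (fun y => - f y) B.
Proof. intros H p Hp. apply (@normed_opp _ _ (fun x _ => f (pk x))); auto. Qed.
Arguments knormed_opp {k} {rho} {f} {B}.

Lemma knormed_const k rho c : 0 <= rho -> knormed k rho (fun _ => c) (Rabs c).
Proof. intros H p Hp. apply normed_const; auto. Qed.

Lemma knormed_one k rho : 0 <= rho -> knormed k rho (fun _ => 1) 1.
Proof. intros H p _. apply normed_one; auto. Qed.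

Lemma knormed_pow k rho f B n : knormed k rho f B -> knormed k rho (fun y => f y ^ n) (B ^ n).
Proof. intros H p Hp. apply (normed_pow _ _ (fun x _ => f (pk x))); auto. Qed.

Lemma knormed_inv_one_minus k rho f B :
  knormed k rho f B -> B < 1 -> knormed k rho (fun y => / (1 - f y)) (/ (1 - B)).
Proof. intros H HB p Hp. apply (normed_inv_one_minus _ _ (fun x _ => f (pk x))); auto. Qed.
Arguments knormed_inv_one_minus {k} {rho} {f} {B}.

Lemma knormed_ge0 k rho f B : knormed k rho f B -> 0 <= B.
Proof. intros H. eapply normed_ge0. apply (H (Pt 0 k 0 0) eq_refl). Qed.

Lemma knormed_shrink k rho rho' f B :
  knormed k rho f B -> 0 < rho -> 0 <= rho' <= rho ->
  knormed k rho' (fun y => f y - f k) (rho' / rho * B).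
Proof.
  intros H Hr Hr' p Hp. eapply normed_ext; [| apply (normed_shrink p rho rho' _ B (H p Hp)); auto].
  intros x z _; simpl. rewrite Hp; auto.
Qed.

Lemma knormed_small_oscillation k rho f B eps :
  knormed k rho f B -> 0 < rho -> 0 < eps ->
  exists rho', 0 < rho' <= rho /\ knormed k rho' (fun y => f y - f k) eps.
Proof.
  intros H Hr He. pose proof (knormed_ge0 _ _ _ _ H) as HB.
  assert (Hq : 0 < eps / (B + eps) <= 1).
  { split; [apply Rdiv_lt_0_compat; lra |]. apply Rmult_le_reg_r with (B + eps); [lra |].
    field_simplify; lra. }
  (* The gain [rho' / rho] times [B] becomes [eps B / (B + eps)], at most [eps], and [B = 0] needs
     no separate case. *)
  exists (rho * (eps / (B + eps))). split; [nra |].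
  intros p Hp. eapply normed_le; [apply (knormed_shrink _ _ _ _ _ H Hr); [nra | auto] |].
  apply Rmult_le_reg_r with (B + eps); [lra |]. field_simplify; nra.
Qed.

(** Factor out [f k]; after shrinking the radius the relative oscillation of [f] is at most 1/2 and
    a geometric series inverts the other factor. *)
Lemma knormed_inv k rho f B :
  knormed k rho f B -> 0 < rho -> f k <> 0 ->
  exists rho' B', 0 < rho' <= rho /\ knormed k rho' (fun y => / f y) B'.
Proof.
  intros H Hr Hf. assert (Ha : 0 < Rabs (f k)) by (apply Rabs_pos_lt; auto).
  destruct (knormed_small_oscillation _ _ _ _ (Rabs (f k) / 2) H Hr ltac:(lra)) as (r' & Hr' & Ho).
  exists r', (Rabs (/ f k) * / (1 - / 2)). split; [auto |].
  assert (K : knormed k r' (fun y => - (/ f k * (f y - f k))) (/ 2)).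
  { eapply knormed_opp. replace (/ 2) with (Rabs (/ f k) * (Rabs (f k) / 2)).
    - eapply knormed_mult; [apply knormed_const; lra | exact Ho].
    - rewrite Rabs_inv; field; lra. }
  eapply knormed_ext; [| eapply knormed_mult; [apply (knormed_const k r' (/ f k)); lra |
    apply (knormed_inv_one_minus K); lra]].
  intros y Hy; simpl.
  replace (1 - - (/ f k * (f y - f k))) with (/ f k * f y) by (field; auto).
  rewrite Rinv_mult, Rinv_inv, <- Rmult_assoc, Rinv_l by auto. ring.
Qed.

(** * Hyperbolic tangent: bounds uniform in the mode number, and non-resonance *)

Lemma knormed_exp k rho c : 0 <= rho ->
  knormed k rho (fun y => exp (c * y)) (exp (c * k + Rabs c * rho)).
Proof.
  intros Hr p Hp.
  set (a j := exp (c * k) * (c ^ j * / INR (fact j))).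
  assert (Hf : forall j, 0 < / INR (fact j)) by (intros; apply Rinv_0_lt_compat, INR_fact_lt_0).
  apply normed_series with (f := fun j x z => a j * atom p (Mode 0 j 0 0 0) x z)
    (B := fun j => Rabs (a j) * weight rho (Mode 0 j 0 0 0)); auto.
  - intros m; apply normed_atom; auto.
  - intros n. rewrite exp_plus.
    assert (E : forall j, Rabs (a j) * weight rho (Mode 0 j 0 0 0)
                = exp (c * k) * (/ INR (fact j) * (Rabs c * rho) ^ j)).
    { intros j. unfold a, weight, degree; simpl. rewrite !Nat.add_0_r.
      rewrite !Rabs_mult, (Rabs_pos_eq (exp _)), (Rabs_pos_eq (/ _)), <- RPow_abs, Rpow_mult_distr
        by (apply Rlt_le; auto; apply exp_pos). ring. }
    rewrite (sum_eq _ _ _ (fun j _ => E j)), sum_f_R0_scal.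
    apply Rmult_le_compat_l; [apply Rlt_le, exp_pos |].
    apply (is_series_nonneg_partial (fun j => / INR (fact j) * (Rabs c * rho) ^ j)).
    + intros j. apply Rmult_le_pos; [apply Rlt_le; auto |].
      apply pow_le, Rmult_le_pos; [apply Rabs_pos | auto].
    + eapply is_series_ext; [| apply (is_exp_Reals (Rabs c * rho))].
      intros j; unfold scal; simpl; unfold mult; simpl. rewrite pow_n_pow; ring.
  - intros x z Hx.
    replace (exp (c * pk x)) with (exp (c * k) * exp (c * (pk x - k)))
      by (rewrite <- exp_plus; f_equal; ring).
    eapply is_series_ext; [| apply is_series_R_scal; apply (is_exp_Reals (c * (pk x - k)))].
    intros j; unfold scal; simpl; unfold mult; simpl. rewrite pow_n_pow.
    unfold a, atom, monomial; simpl. rewrite Hp, Rmult_0_l, cos_0, Rpow_mult_distr. ring.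
Qed.

(** The hyperbolic tangent in the variable [exp (-2 x)]: the multiple [n x] becomes the [n]-th
    power, and no growing exponential occurs, so estimates are uniform in [n]. *)
Definition tanh_of_exp (a : R) : R := (1 - a) / (1 + a).

Lemma tanh_eq x : Defs.tanh x = tanh_of_exp (exp (-2 * x)).
Proof.
  unfold Defs.tanh, tanh_of_exp. replace (-2 * x) with (- x + - x) by ring.
  rewrite exp_plus. replace (exp x) with (/ exp (- x)) by (rewrite <- exp_Ropp; f_equal; ring).
  pose proof (exp_pos (- x)). field. nra.
Qed.

Lemma exp_INR_mult n x : exp (-2 * (INR n * x)) = exp (-2 * x) ^ n.
Proof.
  induction n; [simpl; rewrite Rmult_0_l, Rmult_0_r; apply exp_0 |].
  rewrite S_INR. replace (-2 * ((INR n + 1) * x)) with (-2 * x + -2 * (INR n * x)) by ring.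
  rewrite exp_plus, IHn; reflexivity.
Qed.

Lemma exp_lt1 x : x < 0 -> exp x < 1.
Proof. intros; rewrite <- exp_0; apply exp_increasing; auto. Qed.

Lemma tanh_of_exp_pos a : 0 < a < 1 -> 0 < tanh_of_exp a.
Proof. intros; apply Rdiv_lt_0_compat; lra. Qed.

(** Strict subadditivity of tanh: in its addition formula the denominator exceeds 1. *)
Lemma tanh_of_exp_mult_lt a b : 0 < a < 1 -> 0 < b < 1 ->
  tanh_of_exp (a * b) < tanh_of_exp a + tanh_of_exp b.
Proof.
  intros Ha Hb. pose proof (tanh_of_exp_pos a Ha) as Pa. pose proof (tanh_of_exp_pos b Hb) as Pb.
  assert (E : tanh_of_exp (a * b) * (1 + tanh_of_exp a * tanh_of_exp b) = tanh_of_exp a + tanh_of_exp b).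
  { unfold tanh_of_exp. field. nra. }
  assert (0 < tanh_of_exp (a * b)) by (apply tanh_of_exp_pos; nra).
  rewrite <- E. assert (0 < tanh_of_exp a * tanh_of_exp b) by nra. nra.
Qed.

Lemma tanh_of_exp_pow_lt a n : 0 < a < 1 -> (2 <= n)%nat ->
  tanh_of_exp (a ^ n) < INR n * tanh_of_exp a.
Proof.
  intros Ha Hn.
  assert (Hp : forall m, (1 <= m)%nat -> 0 < a ^ m < 1).
  { intros m Hm; split; [apply pow_lt; lra |]. rewrite <- (pow1 m).
    destruct m as [|m]; [lia |]. simpl. pose proof (pow_incr a 1 m ltac:(lra)).
    rewrite pow1 in *. pose proof (pow_lt a m ltac:(lra)). nra. }
  induction Hn as [| n Hn IH].
  - simpl pow. rewrite Rmult_1_r. replace (INR 2) with 2 by reflexivity.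
    pose proof (tanh_of_exp_mult_lt a a Ha Ha); lra.
  - pose proof (tanh_of_exp_mult_lt a (a ^ n) Ha (Hp n ltac:(lia))).
    rewrite S_INR. simpl pow. lra.
Qed.

Lemma tanh_pos x : 0 < x -> 0 < Defs.tanh x.
Proof.
  intros; rewrite tanh_eq; apply tanh_of_exp_pos; split; [apply exp_pos | apply exp_lt1; lra].
Qed.

Lemma tanh_lt x : 0 < x -> Defs.tanh x < x.
Proof.
  intros Hx.
  (* Twice [y cosh y - sinh y], which vanishes at 0 and has the positive derivative [2 y sinh y]. *)
  destruct (MVT_cor2 (fun y => y * (exp y + exp (- y)) - (exp y - exp (- y)))
             (fun y => y * (exp y - exp (- y))) 0 x Hx) as (c & Hc & Hc').
  - intros c _. apply is_derive_Reals. auto_derive; [auto | ring].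
  - rewrite Ropp_0, exp_0, Rmult_0_l in Hc.
    assert (exp (- c) < exp c) by (apply exp_increasing; lra).
    assert (0 < c * (exp c - exp (- c)) * (x - 0)).
    { apply Rmult_lt_0_compat; [apply Rmult_lt_0_compat |]; lra. }
    unfold Defs.tanh. pose proof (exp_pos x). pose proof (exp_pos (- x)).
    apply Rmult_lt_reg_r with (exp x + exp (- x)); [lra |].
    unfold Rdiv; rewrite Rmult_assoc, Rinv_l, Rmult_1_r by lra. lra.
Qed.

Lemma cww2_pos_eq x : 0 < x -> cww2 x = Defs.tanh x / x.
Proof.
  intros Hx. unfold cww2, cww. destruct (Req_EM_T x 0); [lra |].
  rewrite <- Rsqr_pow2. apply Rsqr_sqrt. apply Rlt_le, Rdiv_lt_0_compat; [apply tanh_pos; auto | auto].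
Qed.

Lemma cww_pos x : 0 < x -> 0 < cww x.
Proof.
  intros Hx. unfold cww. destruct (Req_EM_T x 0); [lra |].
  apply sqrt_lt_R0, Rdiv_lt_0_compat; [apply tanh_pos; auto | auto].
Qed.

Lemma cww2_pos x : 0 < x -> 0 < cww2 x.
Proof. intros; unfold cww2; apply pow_lt, cww_pos; auto. Qed.

Lemma cww2_lt1 x : 0 < x -> cww2 x < 1.
Proof.
  intros Hx. rewrite cww2_pos_eq by auto. apply Rmult_lt_reg_r with x; [auto |].
  unfold Rdiv; rewrite Rmult_assoc, Rinv_l, Rmult_1_r, Rmult_1_l by lra. apply tanh_lt; auto.
Qed.

Definition speed_ratio (n : nat) (k : R) : R := cww2 (INR n * k) / cww2 k.

Lemma speed_ratio_eq n k : 0 < k -> (1 <= n)%nat ->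
  speed_ratio n k = / INR n * (tanh_of_exp (exp (-2 * k) ^ n) * / tanh_of_exp (exp (-2 * k))).
Proof.
  intros Hk Hn. unfold speed_ratio.
  assert (0 < INR n) by (apply lt_0_INR; lia).
  rewrite !cww2_pos_eq by (auto; apply Rmult_lt_0_compat; auto).
  rewrite !tanh_eq, exp_INR_mult. pose proof (tanh_pos k Hk) as Ht. rewrite tanh_eq in Ht.
  field. lra.
Qed.

(** Non-resonance: no higher harmonic has the phase speed of the first one, since
    [tanh (n k) < n tanh k]. *)
Lemma speed_ratio_lt1 n k : 0 < k -> (2 <= n)%nat -> speed_ratio n k < 1.
Proof.
  intros Hk Hn. rewrite speed_ratio_eq by (auto; lia).
  assert (Ha : 0 < exp (-2 * k) < 1) by (split; [apply exp_pos | apply exp_lt1; lra]).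
  pose proof (tanh_of_exp_pow_lt _ n Ha Hn). pose proof (tanh_of_exp_pos _ Ha).
  assert (0 < INR n) by (apply lt_0_INR; lia).
  apply Rmult_lt_reg_r with (INR n * tanh_of_exp (exp (-2 * k))); [apply Rmult_lt_0_compat; auto |].
  field_simplify; lra.
Qed.

Lemma knormed_tanh_power k : 0 < k -> exists C, forall n, (1 <= n)%nat ->
  knormed k (k / 2) (fun y => tanh_of_exp (exp (-2 * y) ^ n)) C /\
  knormed k (k / 2) (fun y => / tanh_of_exp (exp (-2 * y) ^ n)) C.
Proof.
  intros Hk. set (q := exp (- k)).
  assert (Hq : 0 < q < 1) by (split; [apply exp_pos | apply exp_lt1; lra]).
  exists ((1 + q) * / (1 - q)). intros n Hn.
  (* On radius [k / 2] the exponent is at most [-2 k + k], so the exponential has norm [q < 1], and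
     powers only decrease it. This makes the bound independent of [n]. *)
  assert (E : knormed k (k / 2) (fun y => exp (-2 * y) ^ n) q).
  { eapply knormed_restrict; [apply knormed_pow, (knormed_exp k (k / 2) (-2)); lra | lra |].
    replace (-2 * k + Rabs (-2) * (k / 2)) with (- k) by (rewrite Rabs_left by lra; field).
    fold q. destruct n as [|n]; [lia |]. simpl. pose proof (pow_incr q 1 n ltac:(lra)) as P.
    rewrite pow1 in P. nra. }
  assert (P : forall y, Rabs (y - k) <= k / 2 -> 0 < exp (-2 * y) ^ n < 1).
  { intros y Hy. split; [apply pow_lt, exp_pos |]. rewrite <- exp_INR_mult.
    apply Rabs_le_between in Hy.
    assert (0 < INR n) by (apply lt_0_INR; lia). apply exp_lt1. nra. }
  assert (K1 : knormed k (k / 2) (fun _ => 1) 1).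
  { intros p _; apply normed_one; lra. }
  pose proof (knormed_opp E) as E'.
  pose proof (knormed_plus K1 E) as A1.
  pose proof (knormed_plus K1 E') as A2.
  pose proof (knormed_inv_one_minus E ltac:(lra)) as B1.
  pose proof (knormed_inv_one_minus E' ltac:(lra)) as B2.
  split.
  - eapply knormed_ext; [| apply (knormed_mult A2 B2)].
    intros y Hy; simpl. specialize (P y Hy). unfold tanh_of_exp. field. lra.
  - eapply knormed_ext; [| apply (knormed_mult A1 B1)].
    intros y Hy; simpl. specialize (P y Hy). unfold tanh_of_exp. field. lra.
Qed.

Lemma knormed_inv_var k : 0 < k -> knormed k (k / 2) (fun y => / y) (2 / k).
Proof.
  intros Hk.
  assert (K : knormed k (k / 2) (fun y => - (/ k * (y - k))) (/ 2)).
  { intros p Hp. eapply normed_le;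
      [eapply normed_ext; [| apply (normed_atom p (k / 2) (- / k) (Mode 0 1 0 0 0)); lra] |].
    - intros; unfold atom, monomial; simpl. rewrite Hp, Rmult_0_l, cos_0. ring.
    - rewrite Rabs_Ropp, Rabs_inv, Rabs_pos_eq by lra. unfold weight; simpl. right; field; lra. }
  pose proof (knormed_inv_one_minus K ltac:(lra)) as K'.
  pose proof (knormed_const k (k / 2) (/ k) ltac:(lra)) as C.
  eapply knormed_restrict; [| split; [|apply Rle_refl]; lra |].
  - eapply knormed_ext; [| apply (knormed_mult C K')].
    intros y Hy; simpl. apply Rabs_le_between in Hy. field. split; lra.
  - rewrite Rabs_inv, Rabs_pos_eq by lra. right; field; lra.
Qed.

(** The decay in [n] is the explicit factor of [speed_ratio_eq]; the tanh factors are bounded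
    uniformly. *)
Lemma knormed_speed_ratio k : 0 < k -> exists C, 0 < C /\ forall n, (1 <= n)%nat ->
  knormed k (k / 2) (speed_ratio n) (C / INR n).
Proof.
  intros Hk. destruct (knormed_tanh_power k Hk) as [C HC].
  exists (C * C + 1). split; [nra |]. intros n Hn.
  assert (0 < INR n) by (apply lt_0_INR; lia).
  destruct (HC n Hn) as [A _]. destruct (HC 1%nat (le_n _)) as [_ B].
  pose proof (knormed_const k (k / 2) (/ INR n) ltac:(lra)) as D.
  eapply knormed_restrict; [| split; [|apply Rle_refl]; lra |].
  - eapply knormed_ext; [| apply (knormed_mult D (knormed_mult A B))].
    intros y Hy; simpl. apply Rabs_le_between in Hy. rewrite speed_ratio_eq by (auto; lra).
    rewrite Rmult_1_r; auto.
  - rewrite Rabs_inv, Rabs_pos_eq by lra. unfold Rdiv. rewrite Rmult_comm.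
    apply Rmult_le_compat_r; [apply Rlt_le, Rinv_0_lt_compat; auto | lra].
Qed.

(** Inverse of the linearization off its excluded modes: mode 0 is fixed by the zero mean and mode 1
    by the normalization of the profile, so both get the value 0. *)
Definition resolvent_symbol (n : nat) (k : R) : R :=
  if Nat.ltb n 2 then 0 else / (1 - speed_ratio n k).

Definition resolvent_ratio_symbol (n : nat) (k : R) : R :=
  resolvent_symbol n k * speed_ratio n k.

(** The point is one radius for all [n]. Beyond [N > 2 C] the ratio has norm at most 1/2 and a
    geometric series needs no shrinking; below [N] each mode may shrink the radius, but only
    finitely often. *)
Lemma knormed_resolvent k : 0 < k -> exists rho K, 0 < rho <= k / 2 /\ 0 < K /\ forall n,
  knormed k rho (resolvent_symbol n) K /\ knormed k rho (resolvent_ratio_symbol n) K.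
Proof.
  intros Hk. destruct (knormed_speed_ratio k Hk) as (C & HC & Hs).
  destruct (INR_unbounded (2 * C)) as [N HN].
  assert (Z : forall rho, 0 <= rho -> knormed k rho (fun _ => 0) 0).
  { intros rho Hr p _. apply normed_zero; auto. }
  assert (F : forall M, exists rho K, 0 < rho <= k / 2 /\ 0 < K /\
             forall n, (n < M)%nat -> knormed k rho (resolvent_symbol n) K).
  { induction M as [|M (rho & K & Hr & HK & IH)].
    - exists (k / 2), 1. split; [lra |]. split; [lra |]. intros; lia.
    - destruct (Nat.ltb_spec M 2) as [HM | HM].
      + exists rho, K. split; [lra |]. split; [lra |]. intros n Hn.
        destruct (Nat.ltb_spec n M); [auto |].
        eapply knormed_restrict; [| split; [|apply Rle_refl]; lra | apply Rlt_le, HK].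
        eapply knormed_ext; [| apply (Z rho); lra].
        intros; unfold resolvent_symbol. replace (Nat.ltb n 2) with true; auto.
        symmetry; apply Nat.ltb_lt; lia.
      + pose proof (knormed_one k (k / 2) ltac:(lra)) as K1.
        pose proof (knormed_plus K1 (knormed_opp (Hs M ltac:(lia)))) as K2.
        destruct (knormed_inv _ _ _ _ K2 ltac:(lra)) as (r' & B' & Hr' & HB').
        { pose proof (speed_ratio_lt1 M k Hk HM). lra. }
        exists (Rmin rho r'), (Rmax K B').
        pose proof (Rmin_l rho r'). pose proof (Rmin_r rho r').
        assert (0 < Rmin rho r') by (apply Rmin_glb_lt; lra).
        pose proof (Rmax_l K B'). pose proof (Rmax_r K B').
        split; [lra |]. split; [lra |]. intros n Hn.
        destruct (Nat.eq_dec n M) as [-> | Hne].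
        * apply knormed_restrict with (rho := r') (B := B'); [| lra | lra].
          eapply knormed_ext; [| apply HB'].
          intros y _; unfold resolvent_symbol. replace (Nat.ltb M 2) with false; auto.
          symmetry; apply Nat.ltb_ge; auto.
        * eapply knormed_restrict; [apply IH; lia | lra | lra]. }
  destruct (F N) as (rho & K & Hr & HK & HF).
  set (K' := Rmax K 2). pose proof (Rmax_l K 2) as M1. pose proof (Rmax_r K 2) as M2.
  fold K' in M1, M2.
  assert (G : forall n, knormed k rho (resolvent_symbol n) K').
  { intros n. destruct (Nat.ltb_spec n N) as [Hn | Hn].
    - eapply knormed_restrict; [apply HF; auto | lra | auto].
    - destruct (Nat.ltb_spec n 2) as [Hn2 | Hn2].
      + apply knormed_restrict with (rho := rho) (B := 0); [| lra | lra].
        eapply knormed_ext; [| apply (Z rho); lra].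
        intros; unfold resolvent_symbol. replace (Nat.ltb n 2) with true; auto.
        symmetry; apply Nat.ltb_lt; lia.
      + assert (HnN : INR N <= INR n) by (apply le_INR; auto).
        assert (Hh : C / INR n <= / 2).
        { apply Rmult_le_reg_r with (INR n); [lra |]. field_simplify; lra. }
        pose proof (knormed_restrict _ _ rho _ _ (/ 2) (Hs n ltac:(lia)) ltac:(lra) Hh) as S1.
        pose proof (knormed_inv_one_minus S1 ltac:(lra)) as S2.
        eapply knormed_restrict; [| split; [|apply Rle_refl]; lra |].
        * eapply knormed_ext; [| exact S2].
          intros; unfold resolvent_symbol. replace (Nat.ltb n 2) with false; auto.
          symmetry; apply Nat.ltb_ge; lia.
        * replace (/ (1 - / 2)) with 2 by field. exact M2. }
  exists rho, (K' * (C + 1)). split; [lra |]. split; [nra |]. intros n. split.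
  - eapply knormed_restrict; [apply G | lra | nra].
  - destruct (Nat.ltb_spec n 2) as [Hn2 | Hn2].
    + apply knormed_restrict with (rho := rho) (B := 0); [| lra | nra].
      eapply knormed_ext; [| apply (Z rho); lra].
      intros; unfold resolvent_ratio_symbol, resolvent_symbol. replace (Nat.ltb n 2) with true; [ring |].
      symmetry; apply Nat.ltb_lt; lia.
    + assert (1 <= INR n) by (apply (le_INR 1); lia).
      assert (C / INR n <= C).
      { apply Rmult_le_reg_r with (INR n); [lra |]. field_simplify; nra. }
      apply knormed_restrict with (rho := rho) (B := K' * (C + 1)); [| lra | lra].
      unfold resolvent_ratio_symbol. eapply knormed_mult; [apply G |].
      eapply knormed_restrict; [apply Hs; lia | lra | lra].
Qed.

Lemma knormed_cww2 k : 0 < k -> exists C, knormed k (k / 2) cww2 C.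
Proof.
  intros Hk. destruct (knormed_tanh_power k Hk) as [C HC].
  exists (C * (2 / k)). destruct (HC 1%nat (le_n _)) as [A _].
  eapply knormed_ext; [| apply (knormed_mult A (knormed_inv_var k Hk))].
  intros y Hy; simpl. apply Rabs_le_between in Hy.
  rewrite cww2_pos_eq, tanh_eq, Rmult_1_r by lra. reflexivity.
Qed.

(* The square root of an analytic function is obtained from the fixed point equation
   [y = (X - y^2) / 2] for [1 + y = sqrt (1 + X)]. *)
Lemma knormed_cww k : 0 < k -> exists rho C, 0 < rho <= k / 2 /\ knormed k rho cww C.
Proof.
  intros Hk. destruct (knormed_cww2 k Hk) as [C HC].
  pose proof (cww2_pos k Hk) as HS. set (S := cww2 k) in *.
  destruct (knormed_small_oscillation _ _ _ _ (S / 4) HC ltac:(lra) ltac:(lra)) as (rho & Hr & Ho).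
  fold S in Ho.
  exists rho, (sqrt S * (1 + / 2)). split; [auto |]. intros p Hp.
  set (X := fun (x : point) (_ : R) => / S * (cww2 (pk x) - S)).
  assert (HX : normed p rho X (/ 4)).
  { replace (/ 4) with (Rabs (/ S) * (S / 4)).
    - apply (normed_scal p rho (/ S) (fun x _ => cww2 (pk x) - S)). apply Ho; auto.
    - rewrite Rabs_inv, Rabs_pos_eq by lra. field; lra. }
  set (zero := fun (_ : point) (_ : R) => 0).
  set (T1 := fun (f _ : pfun) (x : point) (z : R) => / 2 * (X x z - f x z * f x z)).
  (* The fixed point lemma is about pairs; the second component is a dummy. *)
  set (T2 := fun (_ _ : pfun) => zero).
  assert (Hn : forall f, dist_le p rho f zero (/ 2) -> normed p rho f (/ 2)).
  { intros f Hf. eapply normed_ext; [| exact Hf]. intros; unfold zero; ring. }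
  assert (H2 : Rabs (/ 2) = / 2) by (apply Rabs_pos_eq; lra).
  destruct (contracting_fixed_point T1 T2 zero zero p rho (/ 2)) as (Y1 & _ & _ & Y3).
  - lra.
  - eapply normed_le; [eapply normed_ext; [| apply (normed_scal p rho (/ 2) X); exact HX] | lra].
    intros; unfold T1, zero; simpl; ring.
  - eapply normed_le; [apply dist_le_refl; lra | lra].
  - intros f g f' g' e Hf Hg Hf' Hg' He He'. split.
    + apply normed_le with (/ 2 * ((/ 2 + / 2) * e)); [| lra].
      rewrite <- H2 at 1.
      eapply normed_ext; [| apply (normed_scal p rho (/ 2)); eapply normed_mult;
        [eapply normed_plus; [apply Hn, Hf' | apply Hn, Hf] | eapply dist_le_sym, He]].
      intros; unfold T1; simpl; ring.
    + pose proof (normed_ge0 He).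
      eapply normed_le; [apply dist_le_refl; lra | lra].
  - set (Y := lim_pfun _) in Y1.
    assert (HY : normed p rho Y (/ 2)) by (apply Hn; exact Y1).
    assert (H1 : normed p rho (fun _ _ => 1) 1).
    { apply normed_one; lra. }
    pose proof (sqrt_lt_R0 S HS) as Hq.
    rewrite <- (Rabs_pos_eq (sqrt S)) by lra.
    eapply normed_ext; [| apply (normed_scal p rho (sqrt S) _ _ (normed_plus H1 HY))].
    intros x z Hx. destruct (Y3 x z Hx) as (_ & _ & EY & _). fold Y in EY. unfold T1, X in EY.
    pose proof (@normed_bound _ _ _ _ x z HY Hx) as B. apply Rabs_le_between in B.
    destruct Hx as (_ & Hx & _). rewrite Hp in Hx. apply Rabs_le_between in Hx.
    pose proof (cww_pos (pk x) ltac:(lra)) as Hc.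
    assert (E : Rsqr (sqrt S * (1 + Y x z)) = Rsqr (cww (pk x))).
    { rewrite Rsqr_mult, Rsqr_sqrt, (Rsqr_pow2 (cww _)) by lra. fold (cww2 (pk x)).
      assert (S * (/ S * (cww2 (pk x) - S)) = cww2 (pk x) - S) by (field; lra).
      unfold Rsqr. nra. }
    (* The bound 1/2 on [Y] makes [1 + Y] positive, which selects the positive square root. *)
    apply Rsqr_inj; [nra | lra | exact E].
Qed.

(** * The normalized profile *)

Lemma fa_minus f g B C k : cosine_series f B -> cosine_series g C ->
  fa (fun z => f z - g z) k = fa f k - fa g k.
Proof.
  intros Hf Hg.
  rewrite (fa_ext _ (fun z => f z + -1 * g z)) by (intros; ring).
  rewrite (fa_plus _ _ B C); [rewrite (fa_scal _ _ C); [ring | auto] | auto |].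
  destruct Hg as (c & n & Hb & Hs). exists (fun m => -1 * c m), n. split.
  - apply (abs_bounded_le Hb); [| lra]. intros m. rewrite !Rabs_mult.
    replace (Rabs (-1)) with 1 by (rewrite Rabs_left; lra). lra.
  - intros z. eapply is_series_ext; [| apply is_series_R_scal, Hs]. intros; simpl; ring.
Qed.

Lemma multiplier_minus p rho s S f g B C x z :
  (forall k, normed p rho (fun y _ => s k (pk y)) S) -> normed p rho f B -> normed p rho g C ->
  box p rho x ->
  multiplier s (fun y w => f y w - g y w) x z = multiplier s f x z - multiplier s g x z.
Proof.
  intros Hs Hf Hg Hx. unfold multiplier at 1. apply is_series_unique.
  replace (multiplier s f x z - multiplier s g x z)
    with (multiplier s f x z + -1 * multiplier s g x z) by ring.
  eapply is_series_ext; [| eapply is_series_R_plus;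
    [apply (multiplier_series p rho s S f B x z); auto |
     apply is_series_R_scal; apply (multiplier_series p rho s S g C x z); auto]].
  intros k; simpl. rewrite (fa_minus _ _ B C); [ring | eapply normed_slice; eauto ..].
Qed.

(** * Lipschitz calculus on a ball around the starting pair *)

Section Lipschitz.
Variables (p : point) (rho : R) (f0 g0 : pfun) (d : R).

(** Size and Lipschitz constant travel together because the product rule needs both. The contraction
    constants below are then computed by following the syntax of the maps. *)
Definition lipschitz (T : pfun -> pfun -> pfun) (L S : R) : Prop :=
  forall f g f' g' e,
    dist_le p rho f f0 d -> dist_le p rho g g0 d ->
    dist_le p rho f' f0 d -> dist_le p rho g' g0 d ->
    dist_le p rho f f' e -> dist_le p rho g g' e ->
    normed p rho (T f g) S /\ dist_le p rho (T f g) (T f' g') (L * e).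

Lemma lipschitz_size T L S f g : 0 <= rho ->
  lipschitz T L S -> dist_le p rho f f0 d -> dist_le p rho g g0 d -> normed p rho (T f g) S.
Proof.
  intros Hr H Hf Hg. apply (H f g f g 0); auto; apply dist_le_refl; auto.
Qed.

Lemma contracting_of_lipschitz T1 T2 L1 L2 S1 S2 :
  lipschitz T1 L1 S1 -> lipschitz T2 L2 S2 -> L1 <= / 2 -> L2 <= / 2 ->
  contracting T1 T2 f0 g0 p rho d.
Proof.
  intros H1 H2 HL1 HL2 f g f' g' e A B C D E F.
  pose proof (normed_ge0 E).
  split; (eapply normed_le; [first [apply (H1 f g f' g' e); auto | apply (H2 f g f' g' e); auto] | nra]).
Qed.

Lemma lipschitz_le T L S L' S' : lipschitz T L S -> L <= L' -> S <= S' -> lipschitz T L' S'.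
Proof.
  intros H HL HS f g f' g' e A B C D E F.
  pose proof (normed_ge0 E).
  destruct (H f g f' g' e) as [U V]; auto.
  split; (eapply normed_le; [eassumption |]); nra.
Qed.

Lemma lipschitz_fst B : normed p rho f0 B -> lipschitz (fun f _ => f) 1 (B + d).
Proof.
  intros H f g f' g' e A ? ? ? E F. split.
  - eapply normed_of_dist_le; eauto.
  - rewrite Rmult_1_l; auto.
Qed.

Lemma lipschitz_snd B : normed p rho g0 B -> lipschitz (fun _ g => g) 1 (B + d).
Proof.
  intros H f g f' g' e ? A ? ? E F. split.
  - eapply normed_of_dist_le; eauto.
  - rewrite Rmult_1_l; auto.
Qed.

Lemma lipschitz_const h S : normed p rho h S -> lipschitz (fun _ _ => h) 0 S.
Proof.
  intros H f g f' g' e A B C D E F. split; [auto |]. rewrite Rmult_0_l.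
  apply dist_le_refl. eapply normed_radius_ge0; eauto.
Qed.

Lemma lipschitz_plus T T' L L' S S' : lipschitz T L S -> lipschitz T' L' S' ->
  lipschitz (fun f g x z => T f g x z + T' f g x z) (L + L') (S + S').
Proof.
  intros H H' f g f' g' e A B C D E F.
  destruct (H f g f' g' e) as [U V]; auto. destruct (H' f g f' g' e) as [U' V']; auto. split.
  - eapply normed_plus; auto.
  - rewrite Rmult_plus_distr_r.
    eapply normed_ext; [| apply (normed_plus V V')]. intros; simpl; ring.
Qed.

Lemma lipschitz_scal c T L S : 0 <= c -> lipschitz T L S ->
  lipschitz (fun f g x z => c * T f g x z) (c * L) (c * S).
Proof.
  intros Hc H f g f' g' e A B C D E F. destruct (H f g f' g' e) as [U V]; auto.
  apply (normed_scal _ _ c) in U. apply (normed_scal _ _ c) in V. rewrite Rabs_pos_eq in U, V by auto.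
  split; [exact U |]. rewrite Rmult_assoc. eapply normed_ext; [| exact V]. intros; simpl; ring.
Qed.

Lemma lipschitz_opp T L S : lipschitz T L S -> lipschitz (fun f g x z => - T f g x z) L S.
Proof.
  intros H f g f' g' e A B C D E F. destruct (H f g f' g' e) as [U V]; auto.
  apply normed_opp in U. apply normed_opp in V.
  split; [exact U |]. eapply normed_ext; [| exact V]. intros; simpl; ring.
Qed.

Lemma lipschitz_minus T T' L L' S S' : lipschitz T L S -> lipschitz T' L' S' ->
  lipschitz (fun f g x z => T f g x z - T' f g x z) (L + L') (S + S').
Proof. intros H H'. eapply lipschitz_plus; [auto | apply lipschitz_opp; auto]. Qed.

Lemma lipschitz_mult T T' L L' S S' : lipschitz T L S -> lipschitz T' L' S' ->
  lipschitz (fun f g x z => T f g x z * T' f g x z) (L * S' + S * L') (S * S').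
Proof.
  intros H H' f g f' g' e A B C D E F.
  destruct (H f g f' g' e) as [U V]; auto. destruct (H' f g f' g' e) as [U' V']; auto.
  destruct (H f' g' f g e) as [U2 _]; auto using dist_le_sym. split.
  - eapply normed_mult; auto.
  - replace ((L * S' + S * L') * e) with (L * e * S' + S * (L' * e)) by ring.
    eapply normed_ext; [| apply (normed_plus (normed_mult V U')
      (normed_mult U2 V'))]. intros; simpl; ring.
Qed.

Lemma lipschitz_fa T L S k : lipschitz T L S ->
  lipschitz (fun f g x _ => fa (T f g x) k) L S.
Proof.
  intros H f g f' g' e A B C D E F. destruct (H f g f' g' e) as [U V]; auto.
  destruct (H f' g' f g e) as [U' _]; auto using dist_le_sym. split.
  - apply normed_fa; auto.
  - eapply normed_ext; [| apply (normed_fa _ _ _ _ k V)].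
    intros x z Hx; simpl. apply (fa_minus _ _ S S); eapply normed_slice; eauto.
Qed.

Lemma lipschitz_multiplier s K T L S :
  (forall k, normed p rho (fun y _ => s k (pk y)) K) -> lipschitz T L S ->
  lipschitz (fun f g => multiplier s (T f g)) (K * L) (K * S).
Proof.
  intros Hs H f g f' g' e A B C D E F. destruct (H f g f' g' e) as [U V]; auto.
  destruct (H f' g' f g e) as [U' _]; auto using dist_le_sym. split.
  - eapply normed_multiplier; auto.
  - rewrite Rmult_assoc. eapply normed_ext; [| apply (@normed_multiplier _ _ s K _ _ Hs V)].
    intros x z Hx; simpl. eapply multiplier_minus; eauto.
Qed.
End Lipschitz.
Arguments lipschitz_plus {p rho f0 g0 d T T' L L' S S'}.
Arguments lipschitz_minus {p rho f0 g0 d T T' L L' S S'}.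
Arguments lipschitz_mult {p rho f0 g0 d T T' L L' S S'}.
Arguments lipschitz_size {p rho f0 g0 d T L S f g}.

Definition cos_pfun : pfun := fun _ z => cos z.
Definition opp_cos_pfun : pfun := fun _ z => - cos z.

(** The quadratic part of [w^2 / 2]: if [(1 + a f) (1 + a g) = 1], then [(1 + a g)^2 / 2 = 1/2 - a f
    + a^2 quad f g]. *)
Definition quad (f g : pfun) (x : point) (z : R) : R :=
  / 2 * (g x z * g x z) - f x z * g x z.

(** With [Q] for [quad f g], mode 1 fixes the ratio of the scaling factors through [1 - a Q_1].
    Inserting this in mode [n] gives [(1 - l_n) F_n = a (Q_n - Q_1 l_n F_n)], which is solved here
    for [n >= 2]. *)
Definition profile_defect (f g : pfun) (x : point) (z : R) : R :=
  multiplier resolvent_symbol (quad f g) x z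
  - fa (quad f g x) 1 * multiplier resolvent_ratio_symbol f x z.

Definition profile_map1 (f g : pfun) (x : point) (z : R) : R :=
  cos z + pa x * profile_defect f g x z.

(** The constraint reads [g = - f - a f g]. Here [f] is replaced by [profile_map1 f g], so all
    dependence on the iterates carries the factor [a]; keeping [- f] would cost a Lipschitz constant
    1. *)
Definition profile_map2 (f g : pfun) (x : point) (z : R) : R :=
  - cos z - pa x * (profile_defect f g x z + f x z * g x z).

Definition profile_iterates : nat -> pfun * pfun :=
  iterates profile_map1 profile_map2 cos_pfun opp_cos_pfun.

Definition profile_h : pfun := lim_pfun (fun m => fst (profile_iterates m)).
Definition profile_w : pfun := lim_pfun (fun m => snd (profile_iterates m)).

Lemma normed_cos_pfun p rho : 0 <= rho -> normed p rho cos_pfun 2.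
Proof.
  intros Hr. apply normed_le with (2 ^ 1); [| lra].
  eapply normed_ext; [| apply (normed_cos p rho 1); auto].
  intros; simpl; rewrite Rmult_1_l; auto.
Qed.

Lemma normed_opp_cos_pfun p rho : 0 <= rho -> normed p rho opp_cos_pfun 2.
Proof. intros Hr. eapply normed_opp, (normed_cos_pfun p rho Hr). Qed.

Section ProfileContraction.
Variables (p : point) (rho K A : R).
Hypotheses (Hr : 0 <= rho) (HA : Rabs (pa p) + rho <= A)
  (HK : forall n, normed p rho (fun x _ => resolvent_symbol n (pk x)) K)
  (HK' : forall n, normed p rho (fun x _ => resolvent_ratio_symbol n (pk x)) K).

Notation lip := (lipschitz p rho cos_pfun opp_cos_pfun 1).

(** The cosine has norm 2, so on the unit ball both arguments have norm at most 3:
    [9 = (3 + 3) / 2 + (3 + 3)] and [27 / 2 = 9 / 2 + 9]. *)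
Lemma lipschitz_quad : lip quad 9 (27 / 2).
Proof.
  pose proof (lipschitz_fst p rho cos_pfun opp_cos_pfun 1 2 (normed_cos_pfun p rho Hr)) as H1.
  pose proof (lipschitz_snd p rho cos_pfun opp_cos_pfun 1 2 (normed_opp_cos_pfun p rho Hr)) as H2.
  eapply lipschitz_le; [eapply lipschitz_minus;
    [apply lipschitz_scal; [| eapply lipschitz_mult; [exact H2 | exact H2]] |
     eapply lipschitz_mult; [exact H1 | exact H2]] | |]; lra.
Qed.

Lemma lipschitz_profile_defect : lip profile_defect (99 / 2 * K) (54 * K).
Proof.
  pose proof (lipschitz_fst p rho cos_pfun opp_cos_pfun 1 2 (normed_cos_pfun p rho Hr)) as H1.
  pose proof lipschitz_quad as HQ.
  eapply lipschitz_le; [eapply lipschitz_minus;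
    [apply (lipschitz_multiplier _ _ _ _ _ _ _ _ _ _ HK HQ) |
     eapply lipschitz_mult; [apply (lipschitz_fa _ _ _ _ _ _ _ _ 1 HQ) |
       apply (lipschitz_multiplier _ _ _ _ _ _ _ _ _ _ HK' H1)]] | |]; lra.
Qed.

Lemma normed_pa_le : normed p rho (fun x _ => pa x) A.
Proof. eapply normed_le; [apply normed_pa; auto | auto]. Qed.

(** The second map is the more demanding one: it needs [A (54 K + 9) <= 1/2] for the first increment
    and [A (99/2 K + 6) <= 1/2] for the contraction. The hypothesis on [A (K + 1)] covers both. *)
Lemma profile_fixed_point :
  A * (K + 1) <= / 120 ->
  let u m := fst (profile_iterates m) in
  let v m := snd (profile_iterates m) in
  dist_le p rho profile_h cos_pfun 1 /\ dist_le p rho profile_w opp_cos_pfun 1 /\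
  (forall m, dist_le p rho (u m) cos_pfun 1 /\ dist_le p rho (v m) opp_cos_pfun 1) /\
  forall x z, box p rho x ->
    is_lim_seq (fun m => u m x z) (profile_h x z) /\
    is_lim_seq (fun m => v m x z) (profile_w x z) /\
    profile_map1 profile_h profile_w x z = profile_h x z /\
    profile_map2 profile_h profile_w x z = profile_w x z.
Proof.
  intros HAK.
  assert (HK0 : 0 <= K) by (eapply normed_ge0; apply (HK O)).
  assert (HA0 : 0 <= A) by (eapply normed_ge0, normed_pa_le).
  pose proof (lipschitz_const p rho cos_pfun opp_cos_pfun 1 _ _ normed_pa_le) as La.
  pose proof (lipschitz_const p rho cos_pfun opp_cos_pfun 1 _ _ (normed_cos_pfun p rho Hr)) as Lc.
  pose proof (lipschitz_const p rho cos_pfun opp_cos_pfun 1 _ _ (normed_opp_cos_pfun p rho Hr)) as Lc'.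
  pose proof (lipschitz_fst p rho cos_pfun opp_cos_pfun 1 2 (normed_cos_pfun p rho Hr)) as H1.
  pose proof (lipschitz_snd p rho cos_pfun opp_cos_pfun 1 2 (normed_opp_cos_pfun p rho Hr)) as H2.
  pose proof lipschitz_profile_defect as HD.
  pose proof (lipschitz_mult La HD) as L1.
  pose proof (lipschitz_mult La
    (lipschitz_plus HD (lipschitz_mult H1 H2))) as L2.
  assert (Z1 : dist_le p rho cos_pfun cos_pfun 1).
  { eapply normed_le; [apply dist_le_refl; auto | lra]. }
  assert (Z2 : dist_le p rho opp_cos_pfun opp_cos_pfun 1).
  { eapply normed_le; [apply dist_le_refl; auto | lra]. }
  apply contracting_fixed_point; auto.
  - eapply normed_le; [eapply normed_ext; [|
      apply (lipschitz_size Hr L1 Z1 Z2)] | nra].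
    intros; unfold profile_map1, cos_pfun; simpl; ring.
  - eapply normed_le; [eapply normed_ext; [|
      eapply normed_opp, (lipschitz_size Hr L2 Z1 Z2)] | nra].
    intros; unfold profile_map2, opp_cos_pfun; simpl; ring.
  - eapply contracting_of_lipschitz;
      [apply (lipschitz_plus Lc L1) |
       apply (lipschitz_minus Lc' L2) | nra | nra].
Qed.
End ProfileContraction.

(** * The symmetry that changes the sign of the amplitude *)

Definition reflect (x : point) : point := Pt (- pa x) (pk x) (pb x) (pd x).

(** As [cos (z + PI) = - cos z], reversing the amplitude translates the wave by half a period: [a F]
    at [-a] is the translate of [a F] at [a]. *)
Definition antiperiodic (f : pfun) (x : point) : Prop :=
  forall z, f (reflect x) z = - f x (z + PI).

Lemma multiplier_reflect s f x (e B : R) z :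
  cosine_series (f x) B -> (forall w, f (reflect x) w = e * f x (w + PI)) ->
  multiplier s f (reflect x) z = e * multiplier s f x (z + PI).
Proof.
  intros Hf E. unfold multiplier. rewrite <- Series_scal_l. apply Series_ext. intros k.
  rewrite (fa_ext _ _ k E), (fa_scal _ _ B), (fa_shift_PI _ B), cos_INR_plus_PI; auto.
  - simpl. ring.
  - apply cosine_series_shift_PI; auto.
Qed.

Lemma profile_maps_antiperiodic f g x B :
  cosine_series (f x) B -> cosine_series (quad f g x) B ->
  antiperiodic f x -> antiperiodic g x ->
  antiperiodic (profile_map1 f g) x /\ antiperiodic (profile_map2 f g) x.
Proof.
  intros Cf Cq Af Ag.
  assert (Eq : forall w, quad f g (reflect x) w = 1 * quad f g x (w + PI)).
  { intros w. unfold quad. rewrite Af, Ag. ring. }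
  assert (Ef : forall w, f (reflect x) w = -1 * f x (w + PI)).
  { intros w. rewrite Af. ring. }
  assert (E1 : fa (quad f g (reflect x)) 1 = - fa (quad f g x) 1).
  { rewrite (fa_ext _ _ 1 Eq), (fa_scal _ _ B), (fa_shift_PI _ B); auto; [ring |].
    apply cosine_series_shift_PI; auto. }
  assert (ED : forall z, profile_defect f g (reflect x) z = profile_defect f g x (z + PI)).
  { intros z. unfold profile_defect.
    rewrite E1, (multiplier_reflect _ _ _ 1 B z Cq Eq), (multiplier_reflect _ _ _ (-1) B z Cf Ef). ring. }
  split; intros z; unfold profile_map1, profile_map2; rewrite ED, neg_cos; simpl.
  - ring.
  - rewrite Af, Ag. ring.
Qed.

(** * The speed equations *)

(** Nothing is asked of [pb p] and [pd p], which the profile does not see. The values of [a] in the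
    box reach up to [2 r]. *)
Definition profile_radius (k r K : R) : Prop :=
  forall p rho, pk p = k -> Rabs (pa p) <= r -> 0 <= rho <= r ->
    (forall n, normed p rho (fun x _ => resolvent_symbol n (pk x)) K) /\
    (forall n, normed p rho (fun x _ => resolvent_ratio_symbol n (pk x)) K) /\
    normed p rho profile_h 3 /\ normed p rho profile_w 3 /\
    (forall m, normed p rho (fst (profile_iterates m)) 3 /\ normed p rho (snd (profile_iterates m)) 3) /\
    forall x z, box p rho x ->
      is_lim_seq (fun m => fst (profile_iterates m) x z) (profile_h x z) /\
      is_lim_seq (fun m => snd (profile_iterates m) x z) (profile_w x z) /\
      profile_map1 profile_h profile_w x z = profile_h x z /\
      profile_map2 profile_h profile_w x z = profile_w x z.

Lemma profile_radius_exists k : 0 < k ->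
  exists r K, 0 < r <= k / 2 /\ r <= 1 /\ 0 < K /\ profile_radius k r K.
Proof.
  intros Hk. destruct (knormed_resolvent k Hk) as (r0 & K & Hr0 & HK & Hn).
  (* The amplitude bound [A] is [2 r1], base point plus radius, which meets the threshold
     [1 / (120 (K + 1))]. *)
  set (r1 := / (240 * (K + 1))).
  assert (Hr1 : 0 < r1 <= 1).
  { split; [apply Rinv_0_lt_compat; lra |]. rewrite <- Rinv_1. apply Rinv_le_contravar; lra. }
  exists (Rmin r0 r1), K.
  pose proof (Rmin_l r0 r1). pose proof (Rmin_r r0 r1).
  assert (0 < Rmin r0 r1) by (apply Rmin_glb_lt; lra).
  split; [lra |]. split; [lra |]. split; [lra |].
  intros p rho Hp Ha Hrho.
  assert (HK1 : forall n, normed p rho (fun x _ => resolvent_symbol n (pk x)) K).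
  { intros n. eapply normed_restrict; [apply (proj1 (Hn n)); auto | lra]. }
  assert (HK2 : forall n, normed p rho (fun x _ => resolvent_ratio_symbol n (pk x)) K).
  { intros n. eapply normed_restrict; [apply (proj2 (Hn n)); auto | lra]. }
  split; [auto |]. split; [auto |].
  destruct (profile_fixed_point p rho K (2 * r1) (proj1 Hrho) ltac:(lra) HK1 HK2) as (A & B & C & D).
  { unfold r1. right. field. lra. }
  split; [eapply normed_le; [apply (normed_of_dist_le A (normed_cos_pfun p rho (proj1 Hrho))) | lra] |].
  split; [eapply normed_le; [apply (normed_of_dist_le B (normed_opp_cos_pfun p rho (proj1 Hrho))) | lra] |].
  split; [| exact D].
  intros m; destruct (C m) as [C1 C2]. split.
  - eapply normed_le; [apply (normed_of_dist_le C1 (normed_cos_pfun p rho (proj1 Hrho))) | lra].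
  - eapply normed_le; [apply (normed_of_dist_le C2 (normed_opp_cos_pfun p rho (proj1 Hrho))) | lra].
Qed.

Lemma normed_quad p rho f g B C :
  normed p rho f B -> normed p rho g C -> normed p rho (quad f g) (/ 2 * (C * C) + B * C).
Proof.
  intros Hf Hg. eapply normed_minus; [| eapply normed_mult; auto].
  assert (H2 : Rabs (/ 2) = / 2) by (apply Rabs_pos_eq; lra). rewrite <- H2 at 1.
  apply (normed_scal p rho (/ 2) (fun x z => g x z * g x z)). eapply normed_mult; auto.
Qed.
Arguments normed_quad {p} {rho} {f} {g} {B} {C}.

Definition profile_quad : pfun := quad profile_h profile_w.

(** The only traces of the profile in the scalar equations. [theta1] corrects the relation of the
    scaling factors forced by mode 1, [La cww2 = nu^2 (1 - theta1)]; [theta0] is the mean of the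
    quadratic part of [w^2 / 2]. *)
Definition theta1 (x : point) : R := pa x * fa (profile_quad x) 1.
Definition theta0 (x : point) : R := pa x * (pa x * fa (profile_quad x) 0).

Lemma profile_antiperiodic k r K x :
  profile_radius k r K -> pk x = k -> Rabs (pa x) <= r -> 0 <= r ->
  antiperiodic profile_h x /\ antiperiodic profile_w x.
Proof.
  intros H Hx Ha Hr.
  destruct (H x 0 Hx Ha ltac:(lra)) as (_ & _ & _ & _ & N & L).
  assert (Ha' : Rabs (pa (reflect x)) <= r) by (simpl; rewrite Rabs_Ropp; auto).
  destruct (H (reflect x) 0 Hx Ha' ltac:(lra)) as (_ & _ & _ & _ & _ & L').
  (* The symmetry holds along the iteration and passes to the pointwise limit; uniqueness of the
     fixed point is not invoked. *)
  assert (It : forall m, antiperiodic (fst (profile_iterates m)) x /\ antiperiodic (snd (profile_iterates m)) x).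
  { induction m as [|m [IH1 IH2]].
    - split; intros z; simpl; unfold cos_pfun, opp_cos_pfun; rewrite neg_cos; ring.
    - destruct (N m) as [N1 N2].
      apply (profile_maps_antiperiodic _ _ x (27 / 2)); auto.
      + eapply normed_slice; [apply (normed_le _ _ _ _ _ N1); lra | apply box_center; lra].
      + eapply normed_slice; [eapply normed_le; [apply (normed_quad N1 N2) | lra] | apply box_center; lra]. }
  split; intros z.
  - destruct (L x (z + PI) (box_center _ _ (Rle_refl 0))) as (L1 & _).
    destruct (L' (reflect x) z (box_center _ _ (Rle_refl 0))) as (L1' & _).
    apply is_lim_seq_opp in L1. apply is_lim_seq_unique in L1. apply is_lim_seq_unique in L1'.
    rewrite (Lim_seq_ext _ (fun m => - fst (profile_iterates m) x (z + PI))) in L1'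
      by (intros m; apply (proj1 (It m) z)).
    rewrite L1 in L1'. simpl in L1'. congruence.
  - destruct (L x (z + PI) (box_center _ _ (Rle_refl 0))) as (_ & L1 & _).
    destruct (L' (reflect x) z (box_center _ _ (Rle_refl 0))) as (_ & L1' & _).
    apply is_lim_seq_opp in L1. apply is_lim_seq_unique in L1. apply is_lim_seq_unique in L1'.
    rewrite (Lim_seq_ext _ (fun m => - snd (profile_iterates m) x (z + PI))) in L1'
      by (intros m; apply (proj2 (It m) z)).
    rewrite L1 in L1'. simpl in L1'. congruence.
Qed.

Lemma theta_reflect k r K x :
  profile_radius k r K -> pk x = k -> Rabs (pa x) <= r -> 0 <= r ->
  theta1 (reflect x) = theta1 x /\ theta0 (reflect x) = theta0 x.
Proof.
  intros H Hx Ha Hr.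
  destruct (profile_antiperiodic _ _ _ _ H Hx Ha Hr) as [A1 A2].
  destruct (H x 0 Hx Ha ltac:(lra)) as (_ & _ & N1 & N2 & _ & _).
  assert (C : cosine_series (profile_quad x) (/ 2 * (3 * 3) + 3 * 3)).
  { eapply normed_slice; [apply (normed_quad N1 N2) | apply box_center; lra]. }
  assert (Q : forall n, fa (profile_quad (reflect x)) n = (-1) ^ n * fa (profile_quad x) n).
  { intros n. rewrite <- (fa_shift_PI _ _ n C). apply fa_ext. intros z.
    unfold profile_quad, quad. rewrite A1, A2. ring. }
  unfold theta1, theta0. rewrite !Q. simpl. split; ring.
Qed.

(** The quotient of [c] by [cww], with [nu = cww (1 + v)] and [La = (1 + v)^2 (1 - theta1)]. The
    first equation [c - nu La = (1 - c^2) b1] contains [(1 + v)^3]; the term [3 v] cancels its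
    linear part, so the equation for [e] has no linear term in [v] alone. *)
Definition speed_factor (e v : pfun) (x : point) (z : R) : R := 1 + (3 * v x z + e x z).

Definition speed_defect (e v : pfun) (x : point) (z : R) : R :=
  1 - cww2 (pk x) * (speed_factor e v x z * speed_factor e v x z).

Definition speed_cubic (e v : pfun) (x : point) (z : R) : R :=
  3 * (v x z * v x z) + v x z * (v x z * v x z)
  - theta1 x * ((1 + v x z) * ((1 + v x z) * (1 + v x z))).

Definition speed_map1 (e v : pfun) (x : point) (z : R) : R :=
  speed_cubic e v x z + pb x * / cww (pk x) * speed_defect e v x z.

(** The mean of the second equation, with the linear occurrence of [e] replaced by [speed_map1].
    What remains linear is [2 (1 - cww2) v], hence the prefactor. *)
Definition speed_map2 (e v : pfun) (x : point) (z : R) : R :=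
  / (2 * (1 - cww2 (pk x))) *
  (cww2 (pk x) * (speed_cubic e v x z + / 2 * ((3 * v x z + e x z) * (3 * v x z + e x z)))
   + (cww (pk x) * pb x + pd x) * speed_defect e v x z
   - (1 + / 2 * cww2 (pk x)) * (v x z * v x z)
   + (theta1 x - cww2 (pk x) * theta0 x) * ((1 + v x z) * (1 + v x z))).

Definition zero_pfun : pfun := fun _ _ => 0.

Definition speed_iterates : nat -> pfun * pfun :=
  iterates speed_map1 speed_map2 zero_pfun zero_pfun.

Definition speed_e : pfun := lim_pfun (fun m => fst (speed_iterates m)).
Definition speed_v : pfun := lim_pfun (fun m => snd (speed_iterates m)).

Lemma speed_iterates_const m x z z' :
  fst (speed_iterates m) x z = fst (speed_iterates m) x z' /\
  snd (speed_iterates m) x z = snd (speed_iterates m) x z'.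
Proof.
  induction m as [|m [IH1 IH2]]; [split; reflexivity |].
  change (speed_iterates (S m)) with
    (speed_map1 (fst (speed_iterates m)) (snd (speed_iterates m)),
     speed_map2 (fst (speed_iterates m)) (snd (speed_iterates m))). cbn [fst snd].
  unfold speed_map1, speed_map2, speed_cubic, speed_defect, speed_factor. rewrite IH1, IH2. auto.
Qed.

Lemma speed_const x z z' : speed_e x z = speed_e x z' /\ speed_v x z = speed_v x z'.
Proof.
  unfold speed_e, speed_v, lim_pfun. split; f_equal; apply Lim_seq_ext; intros m;
    apply (speed_iterates_const m x z z').
Qed.

Lemma speed_iterates_reflect m x z :
  theta1 (reflect x) = theta1 x -> theta0 (reflect x) = theta0 x ->
  fst (speed_iterates m) (reflect x) z = fst (speed_iterates m) x z /\
  snd (speed_iterates m) (reflect x) z = snd (speed_iterates m) x z.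
Proof.
  intros H1 H0. induction m as [|m [IH1 IH2]]; [split; reflexivity |].
  change (speed_iterates (S m)) with
    (speed_map1 (fst (speed_iterates m)) (snd (speed_iterates m)),
     speed_map2 (fst (speed_iterates m)) (snd (speed_iterates m))). cbn [fst snd].
  unfold speed_map1, speed_map2, speed_cubic, speed_defect, speed_factor. rewrite IH1, IH2, H1, H0. auto.
Qed.

Lemma speed_reflect x z :
  theta1 (reflect x) = theta1 x -> theta0 (reflect x) = theta0 x ->
  speed_e (reflect x) z = speed_e x z /\ speed_v (reflect x) z = speed_v x z.
Proof.
  intros H1 H0. unfold speed_e, speed_v, lim_pfun. split; f_equal; apply Lim_seq_ext; intros m;
    apply (speed_iterates_reflect m x z H1 H0).
Qed.

Section SpeedContraction.
Variables (p : point) (rho M eps : R).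
Hypotheses (Hr : 0 <= rho) (HM : 1 <= M)
  (Hs : normed p rho (fun x _ => cww2 (pk x)) M) (Hc : normed p rho (fun x _ => cww (pk x)) M)
  (Hi : normed p rho (fun x _ => / cww (pk x)) M)
  (Hq : normed p rho (fun x _ => / (2 * (1 - cww2 (pk x)))) M)
  (H1 : normed p rho (fun x _ => theta1 x) eps) (H0 : normed p rho (fun x _ => theta0 x) eps)
  (Hb : normed p rho (fun x _ => pb x) eps) (Hd : normed p rho (fun x _ => pd x) eps).

Lemma normed_zero_pfun : normed p rho zero_pfun 0.
Proof. apply (normed_zero p rho Hr). Qed.

Notation lip d := (lipschitz p rho zero_pfun zero_pfun d).
Notation lc d H := (lipschitz_const p rho zero_pfun zero_pfun d _ _ H).

(** Every term is at least quadratic in the unknowns or carries a parameter of size [eps], hence the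
    factor [d + eps]. The bound on [d] keeps [1 + v] and [speed_factor] below 2 in norm; at most
    three coefficients of norm [M] are multiplied. *)
Lemma lipschitz_speed_maps d : 0 <= d <= / 4 ->
  lip d speed_map1 (80 * (M * M * M) * (d + eps)) (26 * (M * M * M) * (d + eps)) /\
  lip d speed_map2 (80 * (M * M * M) * (d + eps)) (26 * (M * M * M) * (d + eps)).
Proof.
  intros Hd'.
  assert (He : 0 <= eps) by (eapply normed_ge0; exact H1).
  assert (M2 : M <= M * M) by nra. assert (M3 : M * M <= M * M * M) by nra.
  assert (B1 : M * eps <= M * M * M * eps) by (apply Rmult_le_compat_r; lra).
  assert (B2 : M * M * eps <= M * M * M * eps) by (apply Rmult_le_compat_r; lra).
  assert (B0 : 1 * eps <= M * M * M * eps) by (apply Rmult_le_compat_r; lra).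
  assert (C1 : M * d <= M * M * M * d) by (apply Rmult_le_compat_r; lra).
  assert (C2 : M * M * d <= M * M * M * d) by (apply Rmult_le_compat_r; lra).
  assert (C0 : 1 * d <= M * M * M * d) by (apply Rmult_le_compat_r; lra).
  assert (D0 : 0 <= d * d <= / 4 * d) by nra.
  assert (D1 : 0 <= d * d * d <= / 16 * d) by nra.
  pose proof (lipschitz_fst p rho zero_pfun zero_pfun d 0 normed_zero_pfun) as LE.
  pose proof (lipschitz_snd p rho zero_pfun zero_pfun d 0 normed_zero_pfun) as LV.
  rewrite Rplus_0_l in LE, LV.
  pose proof (lc d (normed_one p rho Hr)) as L1.
  assert (L1V : lip d (fun _ v x z => 1 + v x z) 1 2).
  { eapply lipschitz_le; [apply (lipschitz_plus L1 LV) | lra | lra]. }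
  assert (LV2 : lip d (fun _ v x z => v x z * v x z) (2 * d) (d * d)).
  { eapply lipschitz_le; [apply (lipschitz_mult LV LV) | lra | lra]. }
  assert (L1V2 : lip d (fun _ v x z => (1 + v x z) * (1 + v x z)) 4 4).
  { eapply lipschitz_le; [apply (lipschitz_mult L1V L1V) | lra | lra]. }
  assert (L1V3 : lip d (fun _ v x z => (1 + v x z) * ((1 + v x z) * (1 + v x z))) 12 8).
  { eapply lipschitz_le; [apply (lipschitz_mult L1V L1V2) | lra | lra]. }
  assert (LC : lip d (fun e v x z => 3 * v x z + e x z) 4 (4 * d)).
  { eapply lipschitz_le; [apply (lipschitz_plus
      (lipschitz_scal p rho zero_pfun zero_pfun d 3 _ _ _ ltac:(lra) LV) LE) | lra | lra]. }
  assert (LF : lip d speed_factor 4 2).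
  { eapply lipschitz_le; [apply (lipschitz_plus L1 LC) | lra | lra]. }
  assert (LD : lip d speed_defect (16 * M) (1 + 4 * M)).
  { eapply lipschitz_le; [apply (lipschitz_minus L1
      (lipschitz_mult (lc d Hs)
        (lipschitz_mult LF LF))) | lra | lra]. }
  assert (LCub : lip d speed_cubic (7 * d + 12 * eps) (d + 8 * eps)).
  { eapply lipschitz_le; [apply (lipschitz_minus
      (lipschitz_plus (lipschitz_scal p rho zero_pfun zero_pfun d 3 _ _ _ ltac:(lra) LV2)
        (lipschitz_mult LV LV2))
      (lipschitz_mult (lc d H1) L1V3)) | nra | nra]. }
  split.
  - eapply lipschitz_le; [apply (lipschitz_plus LCub
      (lipschitz_mult (lc d (normed_mult Hb Hi)) LD)) | lra | lra].
  - pose proof (lipschitz_mult LC LC) as LC2.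
    assert (Hhalf : normed p rho (fun x _ => 1 + / 2 * cww2 (pk x)) (1 + / 2 * M)).
    { apply (@normed_plus p rho (fun _ _ => 1) (fun x _ => / 2 * cww2 (pk x)));
        [apply normed_one; auto |].
      assert (E2 : Rabs (/ 2) = / 2) by (apply Rabs_pos_eq; lra). rewrite <- E2 at 1.
      apply (normed_scal p rho (/ 2) (fun x _ => cww2 (pk x))); auto. }
    pose proof (normed_plus (normed_mult Hc Hb) Hd) as Hcb.
    pose proof (normed_minus H1 (normed_mult Hs H0)) as Hth.
    assert (LX : lip d (fun e v x z => cww2 (pk x) * (speed_cubic e v x z + / 2 * ((3 * v x z + e x z) * (3 * v x z + e x z))))
              (M * (23 * d + 12 * eps)) (M * (3 * d + 8 * eps))).
    { eapply lipschitz_le; [apply (lipschitz_mult (lc d Hs)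
        (lipschitz_plus LCub
          (lipschitz_scal p rho zero_pfun zero_pfun d (/ 2) _ _ _ ltac:(lra) LC2))) | |].
      - rewrite Rmult_0_l, Rplus_0_l. apply Rmult_le_compat_l; lra.
      - apply Rmult_le_compat_l; lra. }
    eapply lipschitz_le; [apply (lipschitz_mult (lc d Hq)
      (lipschitz_plus
        (lipschitz_minus
          (lipschitz_plus LX
             (lipschitz_mult (lc d Hcb) LD))
          (lipschitz_mult (lc d Hhalf) LV2))
        (lipschitz_mult (lc d Hth) L1V2))) | |].
    + lra.
    + assert (M * (d * d) <= / 4 * (M * d)) by nra.
      assert (M * M * (d * d) <= / 4 * (M * M * d)) by nra. lra.
Qed.

Lemma speed_fixed_point :
  80 * (M * M * M) * (52 * (M * M * M) * eps + eps) <= / 2 ->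
  normed p rho speed_e (52 * (M * M * M) * eps) /\
  normed p rho speed_v (52 * (M * M * M) * eps) /\
  forall x z, box p rho x ->
    speed_map1 speed_e speed_v x z = speed_e x z /\
    speed_map2 speed_e speed_v x z = speed_v x z.
Proof.
  intros Hcond. set (d := 52 * (M * M * M) * eps) in *.
  assert (He : 0 <= eps) by (eapply normed_ge0; exact H1).
  assert (M3 : 1 <= M * M * M) by nra.
  assert (Hd4 : 0 <= d <= / 4).
  { split; [unfold d; apply Rmult_le_pos; lra |]. nra. }
  assert (Z : forall e, 0 <= e -> dist_le p rho zero_pfun zero_pfun e).
  { intros e He'. eapply normed_le; [apply dist_le_refl; auto | auto]. }
  assert (E : forall f e, dist_le p rho f zero_pfun e -> normed p rho f e).
  { intros f e Hf. eapply normed_ext; [| exact Hf]. intros; unfold zero_pfun; ring. }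
  assert (E' : forall f e, normed p rho f e -> dist_le p rho f zero_pfun e).
  { intros f e Hf. eapply normed_ext; [| exact Hf]. intros; unfold zero_pfun; ring. }
  (* At radius 0 the ball is the starting point, so the size constant bounds the first iterate by
     [26 M^3 eps], half of [d]. *)
  destruct (lipschitz_speed_maps 0 ltac:(lra)) as [S1 S2].
  destruct (lipschitz_speed_maps d Hd4) as [L1 L2].
  destruct (contracting_fixed_point speed_map1 speed_map2 zero_pfun zero_pfun p rho d) as (F1 & F2 & _ & F3); auto.
  - apply E'. eapply normed_le; [apply (lipschitz_size Hr S1); apply Z; lra |].
    unfold d; lra.
  - apply E'. eapply normed_le; [apply (lipschitz_size Hr S2); apply Z; lra |].
    unfold d; lra.
  - eapply contracting_of_lipschitz; [exact L1 | exact L2 | lra | lra].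
  - split; [apply E; exact F1 |]. split; [apply E; exact F2 |].
    intros x z Hx. destruct (F3 x z Hx) as (_ & _ & G1 & G2). auto.
Qed.
End SpeedContraction.

(** * Traveling waves *)

Definition small_params (r : R) (p : point) (rho : R) : Prop :=
  Rabs (pa p) + rho <= r /\ Rabs (pb p) + rho <= r /\ Rabs (pd p) + rho <= r.

(** In [wr_speed] the size [s] is free: [s = r] gives analyticity near a base point, and [s = tau x]
    gives the smallness of the scalar unknowns needed for the expansions. *)
Record wave_radius (k r K M C : R) : Prop := {
  wr_pos : 0 < r <= k / 2;
  wr_le1 : r <= / 4;
  wr_profile : profile_radius k r K;
  wr_norms : forall p rho, pk p = k -> 0 <= rho <= r ->
    normed p rho (fun x _ => cww2 (pk x)) M /\ normed p rho (fun x _ => cww (pk x)) M /\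
    normed p rho (fun x _ => / cww (pk x)) M /\
    normed p rho (fun x _ => / (2 * (1 - cww2 (pk x)))) M;
  wr_theta : forall p rho, pk p = k -> 0 <= rho -> Rabs (pa p) + rho <= r ->
    normed p rho (fun x _ => theta1 x) (14 * (Rabs (pa p) + rho)) /\
    normed p rho (fun x _ => theta0 x) (14 * (Rabs (pa p) + rho));
  wr_speed : forall p rho s, pk p = k -> 0 <= rho -> s <= r -> small_params s p rho ->
    normed p rho speed_e (C * s) /\ normed p rho speed_v (C * s) /\
    forall x z, box p rho x ->
      speed_map1 speed_e speed_v x z = speed_e x z /\
      speed_map2 speed_e speed_v x z = speed_v x z }.
Arguments wr_pos {k r K M C}.
Arguments wr_profile {k r K M C}.
Arguments wr_norms {k r K M C}.
Arguments wr_theta {k r K M C}.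
Arguments wr_speed {k r K M C}.

Lemma normed_theta k r K p rho :
  profile_radius k r K -> pk p = k -> 0 <= rho -> Rabs (pa p) + rho <= r -> r <= 1 ->
  normed p rho (fun x _ => theta1 x) (14 * (Rabs (pa p) + rho)) /\
  normed p rho (fun x _ => theta0 x) (14 * (Rabs (pa p) + rho)).
Proof.
  intros H Hp Hr Ha Hr1. pose proof (Rabs_pos (pa p)).
  destruct (H p rho Hp ltac:(lra) ltac:(lra)) as (_ & _ & N1 & N2 & _ & _).
  assert (Q : normed p rho profile_quad (27 / 2)).
  { eapply normed_le; [apply (normed_quad N1 N2) | lra]. }
  pose proof (normed_pa p rho Hr) as A.
  split.
  - eapply normed_le; [apply (normed_mult A (normed_fa _ _ _ _ 1 Q)) | nra].
  - eapply normed_le; [apply (normed_mult A (normed_mult A (normed_fa _ _ _ _ 0 Q))) |].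
    assert (0 <= Rabs (pa p) + rho <= 1) by lra. nra.
Qed.

Lemma knormed_coefficients k : 0 < k -> exists rho M, 0 < rho <= k / 2 /\ 1 <= M /\
  knormed k rho cww2 M /\ knormed k rho cww M /\ knormed k rho (fun y => / cww y) M /\
  knormed k rho (fun y => / (2 * (1 - cww2 y))) M.
Proof.
  intros Hk. destruct (knormed_cww k Hk) as (r1 & C1 & Hr1 & H1).
  destruct (knormed_cww2 k Hk) as (C2 & H2).
  destruct (knormed_inv _ _ _ _ H1 ltac:(lra)) as (r3 & C3 & Hr3 & H3).
  { pose proof (cww_pos k Hk); lra. }
  pose proof (knormed_const k (k / 2) 2 ltac:(lra)) as K2.
  pose proof (knormed_mult K2
    (knormed_plus (knormed_one k (k / 2) ltac:(lra)) (knormed_opp H2))) as H4'.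
  destruct (knormed_inv _ _ _ _ H4' ltac:(lra)) as (r4 & C4 & Hr4 & H4).
  { pose proof (cww2_lt1 k Hk); lra. }
  set (M := Rmax 1 (Rmax (Rmax C1 C2) (Rmax C3 C4))).
  pose proof (Rmax_l 1 (Rmax (Rmax C1 C2) (Rmax C3 C4))) as M1.
  pose proof (Rmax_r 1 (Rmax (Rmax C1 C2) (Rmax C3 C4))) as M2.
  pose proof (Rmax_l (Rmax C1 C2) (Rmax C3 C4)) as M3. pose proof (Rmax_r (Rmax C1 C2) (Rmax C3 C4)) as M4.
  pose proof (Rmax_l C1 C2). pose proof (Rmax_r C1 C2). pose proof (Rmax_l C3 C4). pose proof (Rmax_r C3 C4).
  fold M in M1, M2.
  exists (Rmin r3 r4), M.
  pose proof (Rmin_l r3 r4). pose proof (Rmin_r r3 r4).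
  assert (0 < Rmin r3 r4) by (apply Rmin_glb_lt; lra).
  split; [lra |]. split; [lra |].
  split; [eapply knormed_restrict; [exact H2 | lra | lra] |].
  split; [eapply knormed_restrict; [exact H1 | lra | lra] |].
  split; [eapply knormed_restrict; [exact H3 | lra | lra] |].
  eapply knormed_restrict; [exact H4 | lra | lra].
Qed.

Lemma wave_radius_exists k : 0 < k -> exists r K M C, wave_radius k r K M C.
Proof.
  intros Hk. destruct (profile_radius_exists k Hk) as (r1 & K & Hr1 & Hr1' & HK & H1).
  destruct (knormed_coefficients k Hk) as (r2 & M & Hr2 & HM & N1 & N2 & N3 & N4).
  set (P := M * M * M). assert (HP : 1 <= P) by (unfold P; nra).
  (* With [eps = 14 s], where 14 comes from [normed_theta], the hypothesis of [speed_fixed_point]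
     holds with 1/4 in place of 1/2. *)
  set (r3 := / (4 * 80 * P * (52 * P + 1) * 14)).
  assert (Hr3 : 0 < r3).
  { unfold r3. apply Rinv_0_lt_compat. nra. }
  set (r := Rmin (/ 4) (Rmin r1 (Rmin r2 r3))).
  pose proof (Rmin_l (/ 4) (Rmin r1 (Rmin r2 r3))). pose proof (Rmin_r (/ 4) (Rmin r1 (Rmin r2 r3))).
  pose proof (Rmin_l r1 (Rmin r2 r3)). pose proof (Rmin_r r1 (Rmin r2 r3)).
  pose proof (Rmin_l r2 r3). pose proof (Rmin_r r2 r3). fold r in H, H0.
  assert (Hr : 0 < r) by (repeat apply Rmin_glb_lt; lra).
  assert (Hprof : profile_radius k r K).
  { intros p rho Hp Ha Hrho. apply H1; lra. }
  assert (Hnorms : forall p rho, pk p = k -> 0 <= rho <= r ->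
    normed p rho (fun x _ => cww2 (pk x)) M /\ normed p rho (fun x _ => cww (pk x)) M /\
    normed p rho (fun x _ => / cww (pk x)) M /\
    normed p rho (fun x _ => / (2 * (1 - cww2 (pk x)))) M).
  { intros p rho Hp Hrho. split; [| split; [| split]].
    - apply (knormed_restrict _ _ rho _ _ M N1); lra.
    - apply (knormed_restrict _ _ rho _ _ M N2); lra.
    - apply (knormed_restrict _ _ rho _ _ M N3); lra.
    - apply (knormed_restrict _ _ rho _ _ M N4); lra. }
  exists r, K, M, (52 * P * 14).
  constructor; auto; try lra.
  - intros p rho Hp Hrho Ha. apply (normed_theta k r K); auto; lra.
  - intros p rho s Hp Hrho Hs (Ha & Hb & Hd).
    pose proof (Rabs_pos (pa p)). pose proof (Rabs_pos (pb p)). pose proof (Rabs_pos (pd p)).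
    destruct (Hnorms p rho Hp ltac:(lra)) as (A1 & A2 & A3 & A4).
    destruct (normed_theta k r K p rho Hprof Hp Hrho ltac:(lra) ltac:(lra)) as [T1 T0].
    replace (52 * P * 14 * s) with (52 * P * (14 * s)) by ring.
    apply (speed_fixed_point p rho M (14 * s)); auto.
    + eapply normed_le; [exact T1 | lra].
    + eapply normed_le; [exact T0 | lra].
    + eapply normed_le; [apply normed_pb; auto | lra].
    + eapply normed_le; [apply normed_pd; auto | lra].
    + fold P. replace (80 * P * (52 * P * (14 * s) + 14 * s)) with (s * (80 * P * (52 * P + 1) * 14)) by ring.
      apply Rle_trans with (r3 * (80 * P * (52 * P + 1) * 14)).
      * apply Rmult_le_compat_r; [nra | lra].
      * unfold r3. apply Rle_trans with (/ 4); [right; field; nra | lra].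
Qed.

Lemma fa_multiplier p rho s S f B x k :
  (forall n, normed p rho (fun y _ => s n (pk y)) S) -> normed p rho f B -> box p rho x ->
  fa (multiplier s f x) k = s k (pk x) * fa (f x) k.
Proof.
  intros Hs Hf Hx. destruct (normed_slice Hf Hx) as (c & n & Hb & Hg).
  apply abs_bounded_drop_pow2 in Hb.
  assert (HS : forall j, Rabs (s j (pk x)) <= S).
  { intros j. apply (@normed_bound _ _ _ _ x 0 (Hs j) Hx). }
  assert (Hb' : abs_bounded (fun m => s (n m) (pk x) * c m) (S * B)).
  { intros N. assert (0 <= S) by (eapply Rle_trans; [apply Rabs_pos | apply (HS O)]).
    apply Rle_trans with (sum_f_R0 (fun m => S * Rabs (c m)) N).
    - apply sum_Rle; intros m _. apply Rabs_mult_le; [apply HS | lra].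
    - rewrite sum_f_R0_scal. apply Rmult_le_compat_l; auto. }
  assert (Hm : forall z, is_series (fun m => s (n m) (pk x) * c m * cos (INR (n m) * z)) (multiplier s f x z)).
  { intros z. destruct (cosine_series_multiplier c n B (f x) (fun j => s j (pk x)) S z Hb Hg HS) as (v & H1 & H2).
    unfold multiplier. rewrite (is_series_unique _ _ H2). exact H1. }
  eapply is_series_uniq; [apply (cosine_series_fa _ _ _ _ k Hb' Hm) |].
  eapply is_series_ext; [| apply is_series_R_scal, (cosine_series_fa _ _ _ _ k Hb Hg)].
  intros m; simpl. destruct (Nat.eqb_spec (n m) k) as [-> |]; ring.
Qed.

Section Waves.
Variables (k r K M C : R).
Hypotheses (Hk : 0 < k) (HW : wave_radius k r K M C).

Lemma profile_modes x n : pk x = k -> Rabs (pa x) <= r ->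
  fa (profile_h x) n = (if Nat.eqb 1 n then 1 else 0) +
    pa x * (resolvent_symbol n k * fa (profile_quad x) n
            - fa (profile_quad x) 1 * (resolvent_ratio_symbol n k * fa (profile_h x) n)).
Proof.
  intros Hx Ha. pose proof (wr_pos HW).
  destruct (wr_profile HW x 0 Hx Ha ltac:(lra)) as (N1 & N2 & N3 & N4 & _ & E).
  pose proof (normed_quad N3 N4) as Q. fold profile_quad in Q.
  pose proof (box_center x 0 (Rle_refl 0)) as Bx.
  pose proof (normed_slice (normed_multiplier N1 Q) Bx) as S1.
  pose proof (normed_slice (normed_multiplier N2 N3) Bx) as S2.
  rewrite <- Hx at 1 2.
  rewrite <- (fa_multiplier _ _ _ _ _ _ _ n N1 Q Bx), <- (fa_multiplier _ _ _ _ _ _ _ n N2 N3 Bx).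
  rewrite <- (fa_cos 1 n).
  set (m1 := multiplier resolvent_symbol profile_quad) in *.
  set (m2 := multiplier resolvent_ratio_symbol profile_h) in *.
  pose proof (normed_scal _ _ (fa (profile_quad x) 1) _ _ (normed_multiplier N2 N3)) as N5.
  pose proof (normed_minus (normed_multiplier N1 Q) N5) as N6.
  pose proof (normed_scal _ _ (pa x) _ _ N6) as N7.
  pose proof (normed_slice N5 Bx) as S5. pose proof (normed_slice N6 Bx) as S6.
  pose proof (normed_slice N7 Bx) as S7. fold m1 m2 in S5, S6, S7.
  rewrite (fa_ext (profile_h x) (fun z => cos (INR 1 * z) + pa x * (m1 x z - fa (profile_quad x) 1 * m2 x z))).
  - rewrite (fa_plus _ _ _ _ _ (normed_slice (normed_cos x 0 1 (Rle_refl 0)) Bx) S7).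
    rewrite (fa_scal _ _ _ _ S6), (fa_minus _ _ _ _ _ S1 S5), (fa_scal _ _ _ _ S2). reflexivity.
  - intros z. destruct (E x z Bx) as (_ & _ & E1 & _). rewrite <- E1 at 1.
    unfold profile_map1, profile_defect. simpl. rewrite Rmult_1_l. reflexivity.
Qed.

(* The solvability relation of mode [n]: [theta1] makes it hold for [n = 1]. *)
Lemma profile_mode_relation x n : pk x = k -> Rabs (pa x) <= r -> (1 <= n)%nat ->
  cww2 (INR n * k) * (1 - theta1 x) * fa (profile_h x) n
  = cww2 k * (fa (profile_h x) n - pa x * fa (profile_quad x) n).
Proof.
  intros Hx Ha Hn. pose proof (profile_modes x n Hx Ha) as E. pose proof (cww2_pos k Hk) as Hc.
  destruct (Nat.eq_dec n 1) as [-> | Hn1].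
  - assert (E1 : fa (profile_h x) 1 = 1).
    { rewrite E. change (resolvent_ratio_symbol 1 k) with (0 * speed_ratio 1 k).
      change (resolvent_symbol 1 k) with 0. simpl. ring. }
    rewrite E1. simpl INR. rewrite Rmult_1_l. unfold theta1. ring.
  - unfold resolvent_ratio_symbol, resolvent_symbol in E.
    replace (Nat.ltb n 2) with false in E by (symmetry; apply Nat.ltb_ge; lia).
    replace (Nat.eqb 1 n) with false in E by (symmetry; apply Nat.eqb_neq; lia).
    pose proof (speed_ratio_lt1 n k Hk ltac:(lia)) as L.
    replace (cww2 (INR n * k)) with (speed_ratio n k * cww2 k) by (unfold speed_ratio; field; lra).
    set (l := speed_ratio n k) in *. set (Fn := fa (profile_h x) n) in *.
    set (Qn := fa (profile_quad x) n) in *. unfold theta1. set (Q1 := fa (profile_quad x) 1) in *.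
    assert (E' : (1 - l) * Fn = pa x * (Qn - Q1 * l * Fn)).
    { rewrite E at 1. field. lra. }
    nra.
Qed.

Lemma profile_mode0 x : pk x = k -> Rabs (pa x) <= r -> fa (profile_h x) 0 = 0.
Proof.
  intros Hx Ha. rewrite (profile_modes x 0 Hx Ha).
  unfold resolvent_ratio_symbol, resolvent_symbol. simpl. ring.
Qed.

End Waves.

(** The argument [z] is a dummy that keeps the speed in the type of the fixed point theory; see
    [wave_c_const]. *)
Definition wave_c (x : point) (z : R) : R := cww (pk x) * speed_factor speed_e speed_v x z.

Definition wave_depth (x : point) (z : R) : R :=
  (1 + speed_v x z) * (1 + speed_v x z) * (1 - theta1 x).

Definition wave_eta (x : point) (z : R) : R :=
  wave_depth x z * (1 + pa x * profile_h x z) - 1.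

Definition wave_u (x : point) (z : R) : R :=
  wave_c x z - cww (pk x) * (1 + speed_v x z) * (1 + pa x * profile_w x z).

Lemma cww_sq y : cww y * cww y = cww2 y.
Proof. unfold cww2; ring. Qed.

Section Waves2.
Variables (k r K M C : R).
Hypotheses (Hk : 0 < k) (HW : wave_radius k r K M C).

(** The second identity exhibits the function that the multiplier must produce from [eta]:
    [nu^2 (a F - a^2 Q)] plus a constant in which [theta0] compensates the mean of [Q]. In the
    proof, [P1] is the product constraint, [P2] the first equation and [P3] the mean of the
    second. *)
Lemma wave_algebra x z : pk x = k -> small_params r x 0 ->
  let c := wave_c x z in
  - c * wave_eta x z + wave_u x z + wave_u x z * wave_eta x z = (1 - c ^ 2) * pb x /\
  c * wave_u x z - / 2 * wave_u x z ^ 2 + (1 - c ^ 2) * pd x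
  = cww2 k * (1 + speed_v x z) ^ 2 *
      (pa x * profile_h x z - pa x * (pa x * profile_quad x z))
    + (wave_depth x z - 1 + cww2 k * (1 + speed_v x z) ^ 2 * theta0 x).
Proof.
  intros Hx Hsm. pose proof (wr_pos HW) as Hr.
  assert (Ha : Rabs (pa x) <= r) by (destruct Hsm; lra).
  pose proof (box_center x 0 (Rle_refl 0)) as Bx.
  destruct (wr_profile HW x 0 Hx Ha ltac:(lra)) as (_ & _ & _ & _ & _ & E).
  destruct (E x z Bx) as (_ & _ & E1 & E2). clear E.
  destruct (wr_speed HW x 0 r Hx (Rle_refl 0) (Rle_refl r) Hsm) as (_ & _ & S).
  destruct (S x z Bx) as (S1 & S2). clear S.
  assert (G : profile_w x z = - profile_h x z - pa x * (profile_h x z * profile_w x z)).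
  { rewrite <- E1 at 1. rewrite <- E2 at 1. unfold profile_map1, profile_map2. ring. }
  unfold speed_map1 in S1. unfold speed_map2 in S2.
  pose proof (cww_pos k Hk) as Hcw. pose proof (cww_sq k) as Hsq. pose proof (cww2_lt1 k Hk) as Hlt.
  unfold speed_defect, speed_cubic in *.
  unfold wave_eta, wave_u, wave_depth, wave_c, profile_quad, quad.
  set (sf := speed_factor speed_e speed_v x z) in *.
  assert (Hsf : sf = 1 + (3 * speed_v x z + speed_e x z)) by reflexivity.
  rewrite Hx in *.
  set (e := speed_e x z) in *. set (v := speed_v x z) in *. set (cw := cww k) in *.
  set (s := cww2 k) in *. set (t1 := theta1 x) in *. set (t0 := theta0 x) in *.
  set (h := profile_h x z) in *. set (w := profile_w x z) in *. set (a := pa x) in *.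
  set (b := pb x) in *. set (d := pd x) in *. clearbody sf e v cw s t1 t0 h w a b d.
  assert (P1 : (1 + a * h) * (1 + a * w) = 1).
  { replace ((1 + a * h) * (1 + a * w)) with (1 + a * (h + w + a * (h * w))) by ring.
    rewrite G at 1. ring. }
  assert (P2 : cw * sf - b * (1 - s * (sf * sf)) = cw * ((1 + v) * ((1 + v) * (1 + v))) * (1 - t1)).
  { replace (b * (1 - s * (sf * sf))) with (cw * (b * / cw * (1 - s * (sf * sf)))) by (field; lra).
    replace (b * / cw * (1 - s * (sf * sf))) with
      (e - (3 * (v * v) + v * (v * v) - t1 * ((1 + v) * ((1 + v) * (1 + v))))) by lra.
    rewrite Hsf. ring. }
  assert (P3 : 1 + / 2 * s * (sf * sf) + d * (1 - s * (sf * sf))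
               = (1 + v) * (1 + v) * (1 - t1) + s * ((1 + v) * (1 + v)) * (/ 2 + t0)).
  { assert (S2' : 2 * (1 - s) * v = s * (3 * (v * v) + v * (v * v) - t1 * ((1 + v) * ((1 + v) * (1 + v))) +
           / 2 * ((3 * v + e) * (3 * v + e))) + (cw * b + d) * (1 - s * (sf * sf)) -
        (1 + / 2 * s) * (v * v) + (t1 - s * t0) * ((1 + v) * (1 + v))).
    { rewrite <- S2 at 1. field. lra. }
    assert (S3 : s * e = s * (3 * (v * v) + v * (v * v) - t1 * ((1 + v) * ((1 + v) * (1 + v))))
                  + cw * b * (1 - s * (sf * sf))).
    { rewrite <- S1, <- Hsq at 1. rewrite <- Hsq. field. lra. }
    assert (S4 : s * (sf * sf) = s + 2 * s * (3 * v + e) + s * ((3 * v + e) * (3 * v + e)))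
      by (rewrite Hsf; ring).
    lra. }
  split.
  - assert (L : (- (cw * sf) * ((1 + v) * (1 + v) * (1 - t1) * (1 + a * h) - 1) +
       (cw * sf - cw * (1 + v) * (1 + a * w)) +
       (cw * sf - cw * (1 + v) * (1 + a * w)) * ((1 + v) * (1 + v) * (1 - t1) * (1 + a * h) - 1))
       = cw * sf - cw * ((1 + v) * ((1 + v) * (1 + v))) * (1 - t1) * ((1 + a * h) * (1 + a * w))) by ring.
    rewrite L, P1, Rmult_1_r, <- P2. replace ((cw * sf) ^ 2) with (s * (sf * sf)) by (rewrite <- Hsq; ring).
    ring.
  - assert (W : (1 + a * w) * (1 + a * w) = 1 - 2 * a * h + 2 * (a * (a * (/ 2 * (w * w) - h * w)))).
    { assert (Gw : a * w = - a * h - a * a * (h * w)) by (rewrite G at 1; ring). lra. }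
    replace ((cw * sf) ^ 2) with (s * (sf * sf)) by (rewrite <- Hsq; ring).
    assert (L : cw * sf * (cw * sf - cw * (1 + v) * (1 + a * w)) -
       / 2 * (cw * sf - cw * (1 + v) * (1 + a * w)) ^ 2
       = / 2 * s * (sf * sf) - / 2 * s * ((1 + v) * (1 + v)) * ((1 + a * w) * (1 + a * w)))
      by (rewrite <- Hsq; field).
    rewrite L, W. lra.
Qed.

Lemma wave_solves x : pk x = k -> small_params r x 0 ->
  tw_system k (pb x) (pd x) (wave_c x 0) (wave_eta x) (wave_u x).
Proof.
  intros Hx Hsm z. pose proof (wr_pos HW) as Hr.
  assert (Ha : Rabs (pa x) <= r) by (destruct Hsm; lra).
  assert (Ec : wave_c x 0 = wave_c x z).
  { unfold wave_c, speed_factor. destruct (speed_const x 0 z) as [-> ->]. auto. }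
  rewrite Ec. destruct (wave_algebra x z Hx Hsm) as [A1 A2].
  split; [exact A1 |].
  exists (wave_c x z * wave_u x z - / 2 * wave_u x z ^ 2 + (1 - wave_c x z ^ 2) * pd x).
  split; [| ring]. rewrite A2. clear A1 A2 Ec.
  pose proof (box_center x 0 (Rle_refl 0)) as Bx.
  destruct (wr_profile HW x 0 Hx Ha ltac:(lra)) as (_ & _ & N3 & N4 & _ & _).
  pose proof (normed_slice N3 Bx) as CF.
  pose proof (normed_slice (normed_quad N3 N4) Bx) as CQ. fold profile_quad in CQ.
  set (V := speed_v x 0). set (La := wave_depth x 0).
  assert (EV : forall y, speed_v x y = V) by (intros y; apply (speed_const x y 0)).
  assert (EL : forall y, wave_depth x y = La) by (intros y; unfold La, wave_depth; rewrite !EV; auto).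
  assert (Eeta : forall y, wave_eta x y = La * pa x * profile_h x y + (La - 1) * cos (INR 0 * y)).
  { intros y. unfold wave_eta. rewrite EL. simpl. rewrite Rmult_0_l, cos_0. ring. }
  pose proof (normed_slice (normed_scal _ _ (La * pa x) _ _ N3) Bx) as C1.
  pose proof (normed_cos x 0 0 (Rle_refl 0)) as N0.
  pose proof (normed_slice (normed_scal _ _ (La - 1) _ _ N0) Bx) as C2.
  assert (Ceta : cosine_series (wave_eta x) (Rabs (La * pa x) * 3 + Rabs (La - 1) * 2 ^ 0)).
  { apply (@normed_slice x 0 wave_eta); [| exact Bx].
    eapply normed_ext; [| apply (normed_plus (normed_scal _ _ (La * pa x) _ _ N3)
      (normed_scal _ _ (La - 1) _ _ N0))].
    intros y w Hy; simpl. destruct Hy as (Y1 & Y2 & Y3 & Y4).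
    assert (y = x).
    { destruct x, y; simpl in *.
      apply Rabs_le_between in Y1, Y2, Y3, Y4. f_equal; lra. }
    subst y. rewrite Eeta. reflexivity. }
  assert (Hfa : forall n, fa (wave_eta x) n = La * pa x * fa (profile_h x) n + (La - 1) * (if Nat.eqb 0 n then 1 else 0)).
  { intros n. rewrite (fa_ext _ _ n Eeta), (fa_plus _ _ _ _ n C1 C2).
    rewrite (fa_scal _ _ _ n CF), (fa_scal _ _ _ n (normed_slice N0 Bx)), fa_cos. reflexivity. }
  rewrite EV, EL. unfold fourier_mult.
  (* The Fourier series of the target, its constant placed at frequency 0; the equality is then
     checked mode by mode. *)
  pose proof (is_series_R_plus (is_series_R_scal (cww2 k * (1 + V) ^ 2) _ _
    (is_series_R_plus (is_series_R_scal (pa x) _ _ (cosine_series_fourier _ _ z CF))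
      (is_series_R_scal (-1) _ _ (is_series_R_scal (pa x * pa x) _ _ (cosine_series_fourier _ _ z CQ)))))
    (is_series_single 0 (La - 1 + cww2 k * (1 + V) ^ 2 * theta0 x))) as S.
  match type of S with is_series _ ?v => match goal with |- is_series _ ?v' =>
    replace v' with v by ring end end.
  refine (is_series_R_ext _ _ _ _ S). clear S.
  intros n; cbv beta. rewrite (cosine_series_fb0 _ _ n Ceta), Hfa.
  destruct n as [|n].
  - change (INR 0) with 0. cbn [Nat.eqb]. rewrite !Rmult_0_l, cos_0, (profile_mode0 k r K M C HW x Hx Ha).
    (* Mode 0: the convention [cww 0 = 1] leaves means unchanged, the profile has mean zero, and
       [theta0] cancels the mean of [Q]. *)
    assert (Z : cww2 0 = 1) by (unfold cww2, cww; destruct (Req_EM_T 0 0); [ring | lra]).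
    rewrite Z. unfold theta0. ring.
  - cbn [Nat.eqb].
    pose proof (profile_mode_relation k r K M C Hk HW x (S n) Hx Ha ltac:(lia)) as R1.
    assert (EL' : La = (1 + V) * (1 + V) * (1 - theta1 x)) by reflexivity.
    rewrite EL'.
    transitivity ((1 + V) * (1 + V) * pa x * cos (INR (S n) * z) *
      (cww2 k * (fa (profile_h x) (S n) - pa x * fa (profile_quad x) (S n)))); [ring |].
    rewrite <- R1. ring.
Qed.
End Waves2.

(** * Expansion of the profile *)

Definition tau (x : point) : R := Rabs (pa x) + Rabs (pb x) + Rabs (pd x).

(* [f = O(|a|^i (|a| + |b1| + |b2|)^j)] in the weighted Wiener norm in [z], for the wave number [k]
   and as the other parameters tend to [0]. *)
Definition big_o (k : R) (i j : nat) (f : pfun) : Prop :=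
  exists C r, 0 < r /\ 0 <= C /\ forall x, pk x = k -> tau x < r ->
    normed x 0 f (C * (Rabs (pa x) ^ i * tau x ^ j)).

Lemma tau_ge0 x : 0 <= tau x.
Proof. unfold tau; pose proof (Rabs_pos (pa x)); pose proof (Rabs_pos (pb x)); pose proof (Rabs_pos (pd x)); lra. Qed.

Lemma Rabs_pa_le_tau x : Rabs (pa x) <= tau x.
Proof. unfold tau; pose proof (Rabs_pos (pb x)); pose proof (Rabs_pos (pd x)); lra. Qed.

Lemma big_o_weight_ge0 i j x : 0 <= Rabs (pa x) ^ i * tau x ^ j.
Proof. apply Rmult_le_pos; apply pow_le; [apply Rabs_pos | apply tau_ge0]. Qed.

Lemma box0_eq x y : box x 0 y -> y = x.
Proof.
  intros (Y1 & Y2 & Y3 & Y4). destruct x, y; simpl in *.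
  apply Rabs_le_between in Y1, Y2, Y3, Y4. f_equal; lra.
Qed.

Section BigO.
Variable k : R.

Lemma big_o_ext r i j f g : 0 < r ->
  (forall x z, pk x = k -> tau x < r -> f x z = g x z) -> big_o k i j f -> big_o k i j g.
Proof.
  intros Hr E (C & r' & Hr' & HC & H). exists C, (Rmin r r').
  split; [apply Rmin_glb_lt; auto |]. split; [auto |]. intros x Hx Ht.
  pose proof (Rmin_l r r'). pose proof (Rmin_r r r').
  eapply normed_ext; [| apply H; auto; lra].
  intros y z Hy. rewrite (box0_eq _ _ Hy). apply E; auto; lra.
Qed.

Lemma big_o_eq i j f g : (forall x z, pk x = k -> f x z = g x z) -> big_o k i j f -> big_o k i j g.
Proof. intros E; apply (big_o_ext 1); [lra | intros; auto]. Qed.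

Lemma big_o_plus i j f g : big_o k i j f -> big_o k i j g -> big_o k i j (fun x z => f x z + g x z).
Proof.
  intros (C & r & Hr & HC & H) (C' & r' & Hr' & HC' & H'). exists (C + C'), (Rmin r r').
  split; [apply Rmin_glb_lt; auto |]. split; [lra |]. intros x Hx Ht.
  pose proof (Rmin_l r r'). pose proof (Rmin_r r r').
  rewrite Rmult_plus_distr_r. eapply normed_plus; [apply H | apply H']; auto; lra.
Qed.

Lemma big_o_opp i j f : big_o k i j f -> big_o k i j (fun x z => - f x z).
Proof.
  intros (C & r & Hr & HC & H). exists C, r. split; [auto |]. split; [auto |].
  intros x Hx Ht. apply (@normed_opp x 0 f); auto.
Qed.

Lemma big_o_minus i j f g : big_o k i j f -> big_o k i j g -> big_o k i j (fun x z => f x z - g x z).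
Proof. intros H H'. apply big_o_plus; [auto | apply big_o_opp; auto]. Qed.

Lemma big_o_mult i j i' j' f g : big_o k i j f -> big_o k i' j' g ->
  big_o k (i + i') (j + j') (fun x z => f x z * g x z).
Proof.
  intros (C & r & Hr & HC & H) (C' & r' & Hr' & HC' & H'). exists (C * C'), (Rmin r r').
  split; [apply Rmin_glb_lt; auto |]. split; [apply Rmult_le_pos; auto |]. intros x Hx Ht.
  pose proof (Rmin_l r r'). pose proof (Rmin_r r r').
  eapply normed_le; [eapply normed_mult; [apply H | apply H']; auto; lra |].
  rewrite !pow_add. right; ring.
Qed.

(** Powers of [|a|] can be traded for powers of [tau] since [|a| <= tau]; surplus powers are dropped
    once [tau < 1]. *)
Lemma big_o_weaken i j i' j' f : big_o k i j f -> (i' <= i)%nat -> (i' + j' <= i + j)%nat ->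
  big_o k i' j' f.
Proof.
  intros (C & r & Hr & HC & H) Hi Hj. exists C, (Rmin 1 r).
  split; [apply Rmin_glb_lt; lra |]. split; [auto |]. intros x Hx Ht.
  pose proof (Rmin_l 1 r). pose proof (Rmin_r 1 r).
  eapply normed_le; [apply H; auto; lra |]. apply Rmult_le_compat_l; [auto |].
  replace i with (i' + (i - i'))%nat by lia. rewrite pow_add, Rmult_assoc.
  apply Rmult_le_compat_l; [apply pow_le, Rabs_pos |].
  pose proof (tau_ge0 x).
  apply Rle_trans with (tau x ^ (i - i') * tau x ^ j).
  - apply Rmult_le_compat_r; [apply pow_le; auto |].
    apply pow_incr; split; [apply Rabs_pos | apply Rabs_pa_le_tau].
  - rewrite <- pow_add. replace (i - i' + j)%nat with (j' + (i - i' + j - j'))%nat by lia.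
    rewrite pow_add. rewrite <- (Rmult_1_r (tau x ^ j')) at 2.
    apply Rmult_le_compat_l; [apply pow_le; auto |].
    rewrite <- (pow1 (i - i' + j - j')). apply pow_incr; lra.
Qed.

Lemma big_o_bounded C r f : 0 < r -> 0 <= C ->
  (forall x, pk x = k -> tau x < r -> normed x 0 f C) -> big_o k 0 0 f.
Proof.
  intros Hr HC H. exists C, r. split; [auto |]. split; [auto |]. intros x Hx Ht.
  eapply normed_le; [apply H; auto | simpl; lra].
Qed.

Lemma big_o_const c : big_o k 0 0 (fun _ _ => c).
Proof.
  apply (big_o_bounded (Rabs c) 1); [lra | apply Rabs_pos |].
  intros; apply normed_const; lra.
Qed.

Lemma big_o_scal c i j f : big_o k i j f -> big_o k i j (fun x z => c * f x z).
Proof. intros H. apply (big_o_mult 0 0 i j _ _ (big_o_const c) H). Qed.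

Lemma big_o_cos n : big_o k 0 0 (fun _ z => cos (INR n * z)).
Proof.
  apply (big_o_bounded (2 ^ n) 1); [lra | apply pow_le; lra |].
  intros; apply normed_cos; lra.
Qed.

Lemma big_o_pa : big_o k 1 0 (fun x _ => pa x).
Proof.
  exists 1, 1. split; [lra |]. split; [lra |]. intros x _ _.
  eapply normed_le; [apply normed_pa; lra |]. simpl; lra.
Qed.

Lemma big_o_pb : big_o k 0 1 (fun x _ => pb x).
Proof.
  exists 1, 1. split; [lra |]. split; [lra |]. intros x _ _.
  eapply normed_le; [apply normed_pb; lra |]. unfold tau.
  pose proof (Rabs_pos (pa x)); pose proof (Rabs_pos (pd x)). simpl; lra.
Qed.

Lemma big_o_pd : big_o k 0 1 (fun x _ => pd x).
Proof.
  exists 1, 1. split; [lra |]. split; [lra |]. intros x _ _.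
  eapply normed_le; [apply normed_pd; lra |]. unfold tau.
  pose proof (Rabs_pos (pa x)); pose proof (Rabs_pos (pb x)). simpl; lra.
Qed.

Lemma big_o_fa i j f n : big_o k i j f -> big_o k i j (fun x _ => fa (f x) n).
Proof.
  intros (C & r & Hr & HC & H). exists C, r. split; [auto |]. split; [auto |]. intros x Hx Ht.
  apply normed_fa; auto.
Qed.

Lemma big_o_multiplier s K r0 i j f : 0 < r0 ->
  (forall x, pk x = k -> tau x < r0 -> forall n, normed x 0 (fun y _ => s n (pk y)) K) ->
  big_o k i j f -> big_o k i j (multiplier s f).
Proof.
  intros Hr0 Hs (C & r & Hr & HC & H). exists (Rabs K * C), (Rmin r0 r).
  split; [apply Rmin_glb_lt; lra |]. split; [apply Rmult_le_pos; [apply Rabs_pos | auto] |].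
  intros x Hx Ht. pose proof (Rmin_l r0 r). pose proof (Rmin_r r0 r).
  eapply normed_le; [eapply normed_multiplier; [apply Hs; auto; lra | apply H; auto; lra] |].
  rewrite <- Rmult_assoc. apply Rmult_le_compat_r; [apply big_o_weight_ge0 |].
  apply Rmult_le_compat_r; [auto | apply Rle_abs].
Qed.

Lemma big_o_bound i j f : big_o k i j f -> exists C r, 0 < r /\ 0 <= C /\
  forall x z, pk x = k -> tau x < r -> Rabs (f x z) <= C * (Rabs (pa x) ^ i * tau x ^ j).
Proof.
  intros (C & r & Hr & HC & H). exists C, r. split; [auto |]. split; [auto |]. intros x z Hx Ht.
  eapply normed_bound; [apply H; auto | apply box_center; lra].
Qed.

Lemma big_o_of_const_bound C r i j f : 0 < r -> 0 <= C ->
  (forall x z, pk x = k -> tau x < r ->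
     f x z = f x 0 /\ Rabs (f x 0) <= C * (Rabs (pa x) ^ i * tau x ^ j)) ->
  big_o k i j f.
Proof.
  intros Hr HC H. exists C, r. split; [auto |]. split; [auto |]. intros x Hx Ht.
  eapply normed_le; [eapply normed_ext; [| apply (normed_const x 0 (f x 0)); lra] | apply (H x 0); auto].
  intros y z Hy. rewrite (box0_eq _ _ Hy). symmetry; apply H; auto.
Qed.
End BigO.

Lemma cosine_series_scal_cos c n : cosine_series (fun z => c * cos (INR n * z)) (Rabs c * 2 ^ n).
Proof.
  pose (x := Pt 0 0 0 0).
  apply (@normed_slice x 0 (fun _ z => c * cos (INR n * z)) (Rabs c * 2 ^ n) x); [| apply box_center; lra].
  apply (normed_scal x 0 c (fun _ z => cos (INR n * z))). apply normed_cos; lra.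
Qed.

Lemma cosine_series_plus f g B C : cosine_series f B -> cosine_series g C ->
  cosine_series (fun z => f z + g z) (B + C).
Proof.
  assert (L : forall h D, cosine_series h D -> normed (Pt 0 0 0 0) 0 (fun _ => h) D).
  { intros h D (c & n & Hb & Hs). split; [lra |].
    exists c, (fun m => Mode 0 0 0 0 (n m)). split.
    - eapply abs_bounded_ext; [| exact Hb]. intros; unfold weight; simpl; ring.
    - intros x Hx z. refine (is_series_R_ext _ _ _ _ (Hs z)).
      intros m; unfold atom, monomial; simpl; ring. }
  intros Hf Hg.
  apply (@normed_slice (Pt 0 0 0 0) 0 (fun _ z => f z + g z) (B + C) (Pt 0 0 0 0));
    [| apply box_center; lra].
  apply (@normed_plus _ _ (fun _ => f) (fun _ => g)); auto.
Qed.

Lemma fa_trig_poly3 c0 c1 c2 c3 n :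
  fa (fun z => c0 * cos (INR 0 * z) + c1 * cos (INR 1 * z) + c2 * cos (INR 2 * z) + c3 * cos (INR 3 * z)) n
  = c0 * (if Nat.eqb 0 n then 1 else 0) + c1 * (if Nat.eqb 1 n then 1 else 0)
    + c2 * (if Nat.eqb 2 n then 1 else 0) + c3 * (if Nat.eqb 3 n then 1 else 0).
Proof.
  pose proof (cosine_series_scal_cos c0 0) as H0. pose proof (cosine_series_scal_cos c1 1) as H1.
  pose proof (cosine_series_scal_cos c2 2) as H2. pose proof (cosine_series_scal_cos c3 3) as H3.
  pose proof (cosine_series_plus _ _ _ _ H0 H1) as H01.
  pose proof (cosine_series_plus _ _ _ _ H01 H2) as H012.
  assert (E : forall c m, fa (fun z => c * cos (INR m * z)) n = c * (if Nat.eqb m n then 1 else 0)).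
  { intros c m. pose proof (cosine_series_scal_cos 1 m) as Hm.
    rewrite <- (fa_cos m n).
    rewrite (fa_ext _ (fun z => c * (1 * cos (INR m * z)))) by (intros; ring).
    rewrite (fa_scal _ _ _ n Hm). f_equal. apply fa_ext. intros; ring. }
  rewrite (fa_plus _ _ _ _ n H012 H3), (fa_plus _ _ _ _ n H01 H2), (fa_plus _ _ _ _ n H0 H1).
  rewrite !E. reflexivity.
Qed.

Lemma cos_INR_1 z : cos (INR 1 * z) = cos z.
Proof. simpl; rewrite Rmult_1_l; auto. Qed.

Lemma cos_INR_0 z : cos (INR 0 * z) = 1.
Proof. simpl; rewrite Rmult_0_l, cos_0; auto. Qed.

Lemma cos_INR_2 z : cos (INR 2 * z) = 2 * (cos z * cos z) - 1.
Proof. replace (INR 2 * z) with (2 * z) by (simpl; ring). rewrite cos_2a_cos. ring. Qed.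

Lemma cos_INR_3 z : cos (INR 3 * z) = 4 * (cos z * (cos z * cos z)) - 3 * cos z.
Proof.
  replace (INR 3 * z) with (2 * z + z) by (simpl; ring).
  rewrite cos_plus, cos_2a_cos, sin_2a. pose proof (sin2_cos2 z) as H. unfold Rsqr in H.
  replace (2 * sin z * cos z * sin z) with (2 * cos z * (sin z * sin z)) by ring.
  replace (sin z * sin z) with (1 - cos z * cos z) by lra. ring.
Qed.

Section ProfileExpansion.
Variables (k r K M C : R).
Hypotheses (Hk : 0 < k) (HW : wave_radius k r K M C).

(** The leading quadratic term [3/2 cos^2 z] has second harmonic 3/4; [second_harmonic] identifies
    the product with the coefficient in the theorem. *)
Let h2 := 3 / 4 * resolvent_symbol 2 k.

Lemma profile_point x : pk x = k -> tau x < r ->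
  (forall n, normed x 0 (fun y _ => resolvent_symbol n (pk y)) K) /\
  (forall n, normed x 0 (fun y _ => resolvent_ratio_symbol n (pk y)) K) /\
  normed x 0 profile_h 3 /\ normed x 0 profile_w 3 /\
  forall z, profile_h x z = cos z + pa x * profile_defect profile_h profile_w x z /\
    profile_w x z = - profile_h x z - pa x * (profile_h x z * profile_w x z).
Proof.
  intros Hx Ht. pose proof (wr_pos HW). pose proof (Rabs_pa_le_tau x).
  destruct (wr_profile HW x 0 Hx ltac:(lra) ltac:(lra)) as (N1 & N2 & N3 & N4 & _ & E).
  split; [auto |]. split; [auto |]. split; [auto |]. split; [auto |].
  intros z. destruct (E x z (box_center x 0 (Rle_refl 0))) as (_ & _ & E1 & E2).
  split; [symmetry; exact E1 |].
  rewrite <- E1 at 1. rewrite <- E2 at 1. unfold profile_map1, profile_map2. ring.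
Qed.

Lemma r_pos : 0 < r.
Proof. apply (wr_pos HW). Qed.

Lemma big_o_cos1 : big_o k 0 0 (fun _ z => cos z).
Proof. apply (big_o_eq k _ _ (fun _ z => cos (INR 1 * z))); [intros; apply cos_INR_1 | apply big_o_cos]. Qed.

Lemma big_o_cos2 : big_o k 0 0 (fun _ z => cos (2 * z)).
Proof.
  apply (big_o_eq k _ _ (fun _ z => cos (INR 2 * z))); [intros; simpl; f_equal; ring | apply big_o_cos].
Qed.

Lemma big_o_h : big_o k 0 0 profile_h.
Proof. apply (big_o_bounded k 3 r); [apply r_pos | lra |]. intros; apply profile_point; auto. Qed.

Lemma big_o_w : big_o k 0 0 profile_w.
Proof. apply (big_o_bounded k 3 r); [apply r_pos | lra |]. intros; apply profile_point; auto. Qed.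

Lemma big_o_Q : big_o k 0 0 profile_quad.
Proof.
  apply big_o_minus.
  - apply big_o_scal. apply (big_o_mult k 0 0 0 0); apply big_o_w.
  - apply (big_o_mult k 0 0 0 0); [apply big_o_h | apply big_o_w].
Qed.

Lemma big_o_resolvent i j f : big_o k i j f -> big_o k i j (multiplier resolvent_symbol f).
Proof. apply (big_o_multiplier k _ K r); [apply r_pos |]. intros; apply profile_point; auto. Qed.

Lemma big_o_resolvent_ratio i j f : big_o k i j f -> big_o k i j (multiplier resolvent_ratio_symbol f).
Proof. apply (big_o_multiplier k _ K r); [apply r_pos |]. intros; apply profile_point; auto. Qed.

Lemma profile_h_order1 : big_o k 1 0 (fun x z => profile_h x z - cos z).
Proof.
  apply (big_o_ext k r _ _ (fun x z => pa x * profile_defect profile_h profile_w x z)); [apply r_pos | |].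
  - intros x z Hx Ht. destruct (profile_point x Hx Ht) as (_ & _ & _ & _ & E).
    destruct (E z) as [E1 _]. lra.
  - apply (big_o_mult k 1 0 0 0); [apply big_o_pa |]. apply big_o_minus.
    + apply big_o_resolvent, big_o_Q.
    + apply (big_o_mult k 0 0 0 0); [apply big_o_fa, big_o_Q | apply big_o_resolvent_ratio, big_o_h].
Qed.

Lemma profile_w_order1 : big_o k 1 0 (fun x z => profile_w x z + cos z).
Proof.
  apply (big_o_ext k r _ _ (fun x z => - (profile_h x z - cos z) - pa x * (profile_h x z * profile_w x z)));
    [apply r_pos | |].
  - intros x z Hx Ht. destruct (profile_point x Hx Ht) as (_ & _ & _ & _ & E).
    destruct (E z) as [_ E2]. lra.
  - apply big_o_minus; [apply big_o_opp, profile_h_order1 |].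
    apply (big_o_mult k 1 0 0 0); [apply big_o_pa |].
    apply (big_o_mult k 0 0 0 0); [apply big_o_h | apply big_o_w].
Qed.

Lemma profile_hw_order1 : big_o k 1 0 (fun x z => profile_h x z * profile_w x z + cos z * cos z).
Proof.
  apply (big_o_eq k _ _ (fun x z => (profile_h x z - cos z) * profile_w x z + cos z * (profile_w x z + cos z))).
  { intros; ring. }
  apply big_o_plus.
  - apply (big_o_mult k 1 0 0 0); [apply profile_h_order1 | apply big_o_w].
  - apply (big_o_mult k 0 0 1 0); [apply big_o_cos1 | apply profile_w_order1].
Qed.

Lemma profile_quad_order1 :
  big_o k 1 0 (fun x z => profile_quad x z - 3 / 2 * (cos z * cos z)).
Proof.
  apply (big_o_eq k _ _ (fun x z => / 2 * ((profile_w x z + cos z) * (profile_w x z - cos z))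
    - (profile_h x z * profile_w x z + cos z * cos z))).
  { intros; unfold profile_quad, quad; field. }
  apply big_o_minus; [| apply profile_hw_order1].
  apply big_o_scal, (big_o_mult k 1 0 0 0); [apply profile_w_order1 |].
  apply big_o_minus; [apply big_o_w | apply big_o_cos1].
Qed.

Lemma fa_quad_leading n :
  fa (fun z => 3 / 2 * (cos z * cos z)) n
  = 3 / 4 * (if Nat.eqb 0 n then 1 else 0) + 3 / 4 * (if Nat.eqb 2 n then 1 else 0).
Proof.
  rewrite (fa_ext _ (fun z => 3 / 4 * cos (INR 0 * z) + 0 * cos (INR 1 * z) + 3 / 4 * cos (INR 2 * z)
    + 0 * cos (INR 3 * z))).
  - rewrite fa_trig_poly3. ring.
  - intros z. rewrite cos_INR_0, cos_INR_2. field.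
Qed.

Lemma normed_quad_leading x : normed x 0 (fun _ z => 3 / 2 * (cos z * cos z)) (Rabs (3 / 2) * (2 * 2)).
Proof.
  apply (normed_scal x 0 (3 / 2) (fun _ z => cos z * cos z)).
  apply (@normed_mult x 0 (fun _ z => cos z) (fun _ z => cos z)); apply normed_cos_pfun; lra.
Qed.

Lemma resolvent_quad_leading x z : pk x = k ->
  multiplier resolvent_symbol (fun _ z => 3 / 2 * (cos z * cos z)) x z = h2 * cos (2 * z).
Proof.
  intros Hx. unfold multiplier. apply is_series_unique. rewrite Hx.
  refine (is_series_R_ext _ _ _ _ (is_series_single 2 (h2 * cos (2 * z)))).
  intros n; cbv beta. rewrite fa_quad_leading.
  destruct n as [|[|[|n]]]; unfold h2; cbn [Nat.eqb]; try ring.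
  - change (resolvent_symbol 0 k) with 0. ring.
  - replace (INR 2) with 2 by (simpl; ring). ring.
Qed.

(** The leading quadratic term has no first harmonic, so the part of the defect that carries [Q_1]
    is one order smaller and only the resolvent contributes. *)
Lemma profile_h_order2 : big_o k 2 0 (fun x z => profile_h x z - cos z - pa x * (h2 * cos (2 * z))).
Proof.
  apply (big_o_ext k r _ _ (fun x z => pa x *
    (multiplier resolvent_symbol (fun y w => profile_quad y w - 3 / 2 * (cos w * cos w)) x z
     - fa (profile_quad x) 1 * multiplier resolvent_ratio_symbol profile_h x z))); [apply r_pos | |].
  - intros x z Hx Ht. destruct (profile_point x Hx Ht) as (N1 & _ & N3 & N4 & E).
    destruct (E z) as [E1 _].
    pose proof (normed_quad N3 N4) as NQ. fold profile_quad in NQ.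
    rewrite (multiplier_minus x 0 _ _ _ _ _ _ x z N1 NQ (normed_quad_leading x)
      (box_center x 0 (Rle_refl 0))).
    rewrite (resolvent_quad_leading x z Hx). rewrite E1 at 1. unfold profile_defect, profile_quad. ring.
  - apply (big_o_mult k 1 0 1 0); [apply big_o_pa |]. apply big_o_minus.
    + apply big_o_resolvent, profile_quad_order1.
    + apply (big_o_mult k 1 0 0 0); [| apply big_o_resolvent_ratio, big_o_h].
      apply (big_o_ext k r _ _ (fun x _ => fa (fun z => profile_quad x z - 3 / 2 * (cos z * cos z)) 1));
        [apply r_pos | |].
      * intros x z Hx Ht. destruct (profile_point x Hx Ht) as (_ & _ & N3 & N4 & _).
        pose proof (box_center x 0 (Rle_refl 0)) as Bx.
        pose proof (normed_quad N3 N4) as NQ. fold profile_quad in NQ.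
        rewrite (fa_minus _ _ _ _ 1 (normed_slice NQ Bx)
          (normed_slice (normed_quad_leading x) Bx)).
        rewrite fa_quad_leading. simpl Nat.eqb. cbv iota. unfold profile_quad. ring.
      * apply (big_o_fa k 1 0 (fun x z => profile_quad x z - 3 / 2 * (cos z * cos z))), profile_quad_order1.
Qed.

Lemma profile_w_order2 :
  big_o k 2 0 (fun x z => profile_w x z + cos z + pa x * (h2 * cos (2 * z)) - pa x * (cos z * cos z)).
Proof.
  apply (big_o_ext k r _ _ (fun x z => - (profile_h x z - cos z - pa x * (h2 * cos (2 * z)))
     - pa x * (profile_h x z * profile_w x z + cos z * cos z))); [apply r_pos | |].
  - intros x z Hx Ht. destruct (profile_point x Hx Ht) as (_ & _ & _ & _ & E).
    destruct (E z) as [_ E2]. lra.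
  - apply big_o_minus; [apply big_o_opp, profile_h_order2 |].
    apply (big_o_mult k 1 0 1 0); [apply big_o_pa | apply profile_hw_order1].
Qed.

(** The expansion of [quad] to first order in [a] at [F = cos + a phi],
    [G = - cos + a (cos^2 - phi)], where [phi = h2 cos 2z]. *)
Definition quad_expansion (x : point) (z : R) : R :=
  3 / 2 * (cos z * cos z)
  + pa x * (3 * (h2 * cos (2 * z)) * cos z - 2 * (cos z * (cos z * cos z))).

Lemma profile_quad_order2 : big_o k 2 0 (fun x z => profile_quad x z - quad_expansion x z).
Proof.
  pose (phi := fun (_ : point) z => h2 * cos (2 * z)).
  pose (gam := fun (_ : point) z => cos z * cos z - h2 * cos (2 * z)).
  assert (Hphi : big_o k 0 0 phi) by apply big_o_scal, big_o_cos2.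
  assert (Hgam : big_o k 0 0 gam).
  { apply big_o_minus; [apply (big_o_mult k 0 0 0 0); apply big_o_cos1 | apply Hphi]. }
  assert (Happ : big_o k 0 0 (fun x z => - cos z + pa x * gam x z)).
  { apply big_o_plus; [apply big_o_opp, big_o_cos1 |].
    apply (big_o_weaken k 1 0); [| lia | lia].
    apply (big_o_mult k 1 0 0 0); [apply big_o_pa | exact Hgam]. }
  assert (Happ2 : big_o k 0 0 (fun x z => cos z + pa x * phi x z)).
  { apply big_o_plus; [apply big_o_cos1 |].
    apply (big_o_weaken k 1 0); [| lia | lia].
    apply (big_o_mult k 1 0 0 0); [apply big_o_pa | exact Hphi]. }
  apply (big_o_eq k _ _ (fun x z =>
    / 2 * ((profile_w x z + cos z + pa x * (h2 * cos (2 * z)) - pa x * (cos z * cos z))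
           * (profile_w x z + (- cos z + pa x * gam x z)))
    - (profile_h x z - cos z - pa x * (h2 * cos (2 * z))) * profile_w x z
    - (cos z + pa x * phi x z)
      * (profile_w x z + cos z + pa x * (h2 * cos (2 * z)) - pa x * (cos z * cos z))
    + pa x * (pa x * (/ 2 * (gam x z * gam x z) - phi x z * gam x z)))).
  { intros; unfold profile_quad, quad, quad_expansion, gam, phi; field. }
  apply big_o_plus; [apply big_o_minus; [apply big_o_minus |] |].
  - apply big_o_scal, (big_o_mult k 2 0 0 0); [apply profile_w_order2 |].
    apply big_o_plus; [apply big_o_w | apply Happ].
  - apply (big_o_mult k 2 0 0 0); [apply profile_h_order2 | apply big_o_w].
  - apply (big_o_mult k 0 0 2 0); [apply Happ2 | apply profile_w_order2].
  - apply (big_o_mult k 1 0 1 0); [apply big_o_pa |].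
    apply (big_o_mult k 1 0 0 0); [apply big_o_pa |].
    apply big_o_minus; [apply big_o_scal |]; apply (big_o_mult k 0 0 0 0); auto.
Qed.

Lemma quad_expansion_trig x :
  forall z, quad_expansion x z =
    3 / 4 * cos (INR 0 * z) + pa x * (3 / 2 * h2 - 3 / 2) * cos (INR 1 * z) + 3 / 4 * cos (INR 2 * z)
    + pa x * (3 / 2 * h2 - / 2) * cos (INR 3 * z).
Proof.
  intros z. unfold quad_expansion. replace (2 * z) with (INR 2 * z) by (simpl; ring).
  rewrite cos_INR_0, cos_INR_1, cos_INR_2, cos_INR_3. field.
Qed.

Lemma big_o_fa_quad n : big_o k 2 0 (fun x _ => fa (profile_quad x) n - fa (quad_expansion x) n).
Proof.
  apply (big_o_ext k r _ _ (fun x _ => fa (fun z => profile_quad x z - quad_expansion x z) n));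
    [apply r_pos | |].
  - intros x z Hx Ht. destruct (profile_point x Hx Ht) as (_ & _ & N3 & N4 & _).
    pose proof (box_center x 0 (Rle_refl 0)) as Bx.
    assert (CE : exists B, cosine_series (quad_expansion x) B).
    { eexists. pose proof (cosine_series_plus _ _ _ _ (cosine_series_plus _ _ _ _ (cosine_series_plus _ _ _ _
        (cosine_series_scal_cos (3 / 4) 0) (cosine_series_scal_cos (pa x * (3 / 2 * h2 - 3 / 2)) 1))
        (cosine_series_scal_cos (3 / 4) 2)) (cosine_series_scal_cos (pa x * (3 / 2 * h2 - / 2)) 3)) as H.
      destruct H as (c & m & Hb & Hs). exists c, m. split; [exact Hb |].
      intros y. rewrite quad_expansion_trig. apply Hs. }
    destruct CE as [B CE].
    apply (fa_minus _ _ _ _ n (normed_slice (normed_quad N3 N4) Bx) CE).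
  - apply (big_o_fa k 2 0 (fun x z => profile_quad x z - quad_expansion x z)), profile_quad_order2.
Qed.

(** The first harmonic of the quadratic term starts at order [a]: [3 h2 cos 2z cos z] contributes
    [3/2 h2] and [- 2 cos^3 z] contributes [- 3/2]. *)
Lemma theta1_order3 : big_o k 3 0 (fun x _ => theta1 x - pa x ^ 2 * (3 / 2 * (h2 - 1))).
Proof.
  apply (big_o_eq k _ _ (fun x _ => pa x * (fa (profile_quad x) 1 - fa (quad_expansion x) 1))).
  - intros x z _. rewrite (fa_ext _ _ 1 (quad_expansion_trig x)), fa_trig_poly3. unfold theta1. cbn [Nat.eqb]. field.
  - apply (big_o_mult k 1 0 2 0 (fun x _ => pa x)); [apply big_o_pa | apply big_o_fa_quad].
Qed.

Lemma theta0_order3 : big_o k 3 0 (fun x _ => theta0 x - pa x ^ 2 * (3 / 4)).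
Proof.
  apply (big_o_weaken k 4 0); [| lia | lia].
  apply (big_o_eq k _ _ (fun x _ => pa x * (pa x * (fa (profile_quad x) 0 - fa (quad_expansion x) 0)))).
  - intros x z _. rewrite (fa_ext _ _ 0 (quad_expansion_trig x)), fa_trig_poly3. unfold theta0. cbn [Nat.eqb]. field.
  - apply (big_o_mult k 1 0 3 0 (fun x _ => pa x)); [apply big_o_pa |].
    apply (big_o_mult k 1 0 2 0 (fun x _ => pa x)); [apply big_o_pa | apply big_o_fa_quad].
Qed.
End ProfileExpansion.

(** * Expansion of the waves *)

(** For small [tau] the coefficients of the linear system have column sums at most 1/2, so
    [|f1| + |f2|] on the right is absorbed on the left. *)
Lemma big_o_absorb k i j (f1 f2 a11 a12 a21 a22 r1 r2 : pfun) r : 0 < r ->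
  (forall x z, f1 x z = f1 x 0) -> (forall x z, f2 x z = f2 x 0) ->
  big_o k 0 1 a11 -> big_o k 0 1 a12 -> big_o k 0 1 a21 -> big_o k 0 1 a22 ->
  big_o k i j r1 -> big_o k i j r2 ->
  (forall x z, pk x = k -> tau x < r ->
     f1 x z = a11 x z * f1 x z + a12 x z * f2 x z + r1 x z /\
     f2 x z = a21 x z * f1 x z + a22 x z * f2 x z + r2 x z) ->
  big_o k i j f1 /\ big_o k i j f2.
Proof.
  intros Hr c1 c2 A11 A12 A21 A22 R1 R2 E.
  apply big_o_bound in A11, A12, A21, A22, R1, R2.
  destruct A11 as (C11 & s11 & P11 & Q11 & A11). destruct A12 as (C12 & s12 & P12 & Q12 & A12).
  destruct A21 as (C21 & s21 & P21 & Q21 & A21). destruct A22 as (C22 & s22 & P22 & Q22 & A22).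
  destruct R1 as (C1 & s1 & P1 & Q1 & R1). destruct R2 as (C2 & s2 & P2 & Q2 & R2).
  set (T := C11 + C12 + C21 + C22 + 1).
  set (s := Rmin r (Rmin (Rmin s11 s12) (Rmin (Rmin s21 s22) (Rmin (Rmin s1 s2) (/ (2 * T)))))).
  assert (HT : 1 <= T) by (unfold T; lra).
  assert (Hs : 0 < s).
  { repeat apply Rmin_glb_lt; auto. apply Rinv_0_lt_compat; lra. }
  assert (H : forall x z, pk x = k -> tau x < s ->
     Rabs (f1 x z) + Rabs (f2 x z) <= 2 * (C1 + C2) * (Rabs (pa x) ^ i * tau x ^ j)).
  { intros x z Hx Ht.
    assert (Hm : tau x < r /\ tau x < s11 /\ tau x < s12 /\ tau x < s21 /\ tau x < s22 /\
                 tau x < s1 /\ tau x < s2 /\ tau x < / (2 * T)).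
    { unfold s in Ht. repeat split; (eapply Rlt_le_trans; [exact Ht |]);
        repeat first [apply Rle_refl | (eapply Rle_trans; [apply Rmin_l |]; apply Rle_refl)
          | (eapply Rle_trans; [apply Rmin_l |]; eapply Rle_trans; [apply Rmin_l |]; apply Rle_refl)
          | (eapply Rle_trans; [apply Rmin_l |]; eapply Rle_trans; [apply Rmin_r |]; apply Rle_refl)
          | (eapply Rle_trans; [apply Rmin_r |])]. }
    destruct Hm as (m0 & m1 & m2 & m3 & m4 & m5 & m6 & m7).
    specialize (A11 x z Hx m1). specialize (A12 x z Hx m2). specialize (A21 x z Hx m3).
    specialize (A22 x z Hx m4). specialize (R1 x z Hx m5). specialize (R2 x z Hx m6).
    destruct (E x z Hx m0) as [E1 E2].
    replace (Rabs (pa x) ^ 0 * tau x ^ 1) with (tau x) in A11, A12, A21, A22 by ring.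
    assert (HTt : T * tau x <= / 2).
    { apply Rle_trans with (T * / (2 * T)); [apply Rmult_le_compat_l; lra | right; field; lra]. }
    pose proof (tau_ge0 x).
    set (w := Rabs (pa x) ^ i * tau x ^ j) in *.
    assert (B1 : Rabs (f1 x z) <= Rabs (a11 x z) * Rabs (f1 x z) + Rabs (a12 x z) * Rabs (f2 x z) + Rabs (r1 x z)).
    { rewrite E1 at 1. eapply Rle_trans; [apply Rabs_triang |]. apply Rplus_le_compat_r.
      eapply Rle_trans; [apply Rabs_triang |]. rewrite !Rabs_mult. lra. }
    assert (B2 : Rabs (f2 x z) <= Rabs (a21 x z) * Rabs (f1 x z) + Rabs (a22 x z) * Rabs (f2 x z) + Rabs (r2 x z)).
    { rewrite E2 at 1. eapply Rle_trans; [apply Rabs_triang |]. apply Rplus_le_compat_r.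
      eapply Rle_trans; [apply Rabs_triang |]. rewrite !Rabs_mult. lra. }
    pose proof (Rabs_pos (f1 x z)) as Z1. pose proof (Rabs_pos (f2 x z)) as Z2.
    assert (G1 : (Rabs (a11 x z) + Rabs (a21 x z)) * Rabs (f1 x z) <= / 2 * Rabs (f1 x z)).
    { apply Rmult_le_compat_r; auto. unfold T in HTt. nra. }
    assert (G2 : (Rabs (a12 x z) + Rabs (a22 x z)) * Rabs (f2 x z) <= / 2 * Rabs (f2 x z)).
    { apply Rmult_le_compat_r; auto. unfold T in HTt. nra. }
    lra. }
  split; apply (big_o_of_const_bound k (2 * (C1 + C2)) s); auto; try lra;
    intros x z Hx Ht; (split; [auto |]); specialize (H x 0 Hx Ht);
    pose proof (Rabs_pos (f1 x 0)); pose proof (Rabs_pos (f2 x 0)); lra.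
Qed.

(** The values at this point are [eta0], [u0] and [c0]; subtracting them is what produces the factor
    [|a|] in the remainders. *)
Definition at0 (x : point) : point := Pt 0 (pk x) (pb x) (pd x).

(** * Comparison of the speed equations with their case of zero amplitude *)

Section SpeedExpansion.
Variables (k r K M C : R).
Hypotheses (Hk : 0 < k) (HW : wave_radius k r K M C).

Let h2 := 3 / 4 * resolvent_symbol 2 k.
Let s := cww2 k.
Let cw := cww k.
Let q := / (2 * (1 - s)).
Let h0 := 3 / 4 * (s / (s - 1)).

Let V : pfun := speed_v.
Let E : pfun := speed_e.
Let V0 : pfun := fun x z => speed_v (at0 x) z.
Let E0 : pfun := fun x z => speed_e (at0 x) z.
Let dV : pfun := fun x z => V x z - V0 x z.
Let dE : pfun := fun x z => E x z - E0 x z.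

Lemma tau_at0 x : tau (at0 x) <= tau x.
Proof. unfold tau, at0; simpl. rewrite Rabs_R0. pose proof (Rabs_pos (pa x)); lra. Qed.

Lemma small_params_tau x : small_params (tau x) x 0.
Proof.
  unfold small_params, tau.
  pose proof (Rabs_pos (pa x)); pose proof (Rabs_pos (pb x)); pose proof (Rabs_pos (pd x)). lra.
Qed.

Lemma speed_amplitudes x z : pk x = k -> tau x < r ->
  Rabs (E x z) <= Rabs C * tau x /\ Rabs (V x z) <= Rabs C * tau x.
Proof.
  intros Hx Ht.
  destruct (wr_speed HW x 0 (tau x) Hx (Rle_refl 0) ltac:(lra) (small_params_tau x)) as (N1 & N2 & _).
  pose proof (@normed_bound _ _ _ _ x z N1 (box_center x 0 (Rle_refl 0))).
  pose proof (@normed_bound _ _ _ _ x z N2 (box_center x 0 (Rle_refl 0))).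
  assert (C * tau x <= Rabs C * tau x) by (apply Rmult_le_compat_r; [apply tau_ge0 | apply Rle_abs]).
  unfold E, V; lra.
Qed.

Lemma big_o_speed : big_o k 0 1 V /\ big_o k 0 1 E /\ big_o k 0 1 V0 /\ big_o k 0 1 E0.
Proof.
  pose proof (r_pos k r K M C HW) as Hr. pose proof (Rabs_pos C).
  split; [| split; [| split]]; apply (big_o_of_const_bound k (Rabs C) r); auto;
    intros x z Hx Ht; (split; [apply speed_const |]);
    replace (Rabs (pa x) ^ 0 * tau x ^ 1) with (tau x) by ring;
    try (apply speed_amplitudes; auto).
  - pose proof (tau_at0 x). eapply Rle_trans; [apply (speed_amplitudes (at0 x)); auto; lra |].
    apply Rmult_le_compat_l; auto.
  - pose proof (tau_at0 x). eapply Rle_trans; [apply (speed_amplitudes (at0 x)); auto; lra |].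
    apply Rmult_le_compat_l; auto.
Qed.

Lemma speed_equations x z : pk x = k -> tau x < r ->
  E x z = 3 * (V x z * V x z) + V x z * (V x z * V x z)
     - theta1 x * ((1 + V x z) * ((1 + V x z) * (1 + V x z)))
     + pb x * / cw * (1 - s * ((1 + (3 * V x z + E x z)) * (1 + (3 * V x z + E x z)))) /\
  V x z = q * (s * ((3 * (V x z * V x z) + V x z * (V x z * V x z)
     - theta1 x * ((1 + V x z) * ((1 + V x z) * (1 + V x z))))
       + / 2 * ((3 * V x z + E x z) * (3 * V x z + E x z)))
   + (cw * pb x + pd x) * (1 - s * ((1 + (3 * V x z + E x z)) * (1 + (3 * V x z + E x z))))
   - (1 + / 2 * s) * (V x z * V x z)
   + (theta1 x - s * theta0 x) * ((1 + V x z) * (1 + V x z))).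
Proof.
  intros Hx Ht.
  destruct (wr_speed HW x 0 (tau x) Hx (Rle_refl 0) ltac:(lra) (small_params_tau x)) as (_ & _ & F).
  destruct (F x z (box_center x 0 (Rle_refl 0))) as [F1 F2].
  unfold speed_map1, speed_map2, speed_cubic, speed_defect, speed_factor in F1, F2.
  rewrite Hx in F1, F2. fold s cw q in F1, F2. fold E V in F1, F2.
  split; symmetry; [exact F1 | exact F2].
Qed.

Lemma speed_equations0 x z : pk x = k -> tau x < r ->
  E0 x z = 3 * (V0 x z * V0 x z) + V0 x z * (V0 x z * V0 x z)
     + pb x * / cw * (1 - s * ((1 + (3 * V0 x z + E0 x z)) * (1 + (3 * V0 x z + E0 x z)))) /\
  V0 x z = q * (s * ((3 * (V0 x z * V0 x z) + V0 x z * (V0 x z * V0 x z))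
       + / 2 * ((3 * V0 x z + E0 x z) * (3 * V0 x z + E0 x z)))
   + (cw * pb x + pd x) * (1 - s * ((1 + (3 * V0 x z + E0 x z)) * (1 + (3 * V0 x z + E0 x z))))
   - (1 + / 2 * s) * (V0 x z * V0 x z)).
Proof.
  intros Hx Ht. pose proof (tau_at0 x) as Hat.
  destruct (speed_equations (at0 x) z Hx ltac:(lra)) as [F1 F2].
  assert (T1 : theta1 (at0 x) = 0) by (unfold theta1, at0; cbn [pa]; ring).
  assert (T0 : theta0 (at0 x) = 0) by (unfold theta0, at0; cbn [pa]; ring).
  rewrite T1 in F1, F2. rewrite T0 in F2.
  change (V (at0 x) z) with (V0 x z) in F1, F2. change (E (at0 x) z) with (E0 x z) in F1, F2.
  change (pb (at0 x)) with (pb x) in F1, F2. change (pd (at0 x)) with (pd x) in F2.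
  split.
  - rewrite F1 at 1. ring.
  - rewrite F2 at 1. ring.
Qed.

Lemma s_lt1 : 0 < s < 1.
Proof. split; [apply cww2_pos; auto | apply cww2_lt1; auto]. Qed.

Lemma cw_pos : 0 < cw.
Proof. apply cww_pos; auto. Qed.

Lemma cw_sq : cw * cw = s.
Proof. apply cww_sq. Qed.

Let ampl : pfun := fun x _ => cw * pb x + pd x.

Lemma big_o_ampl : big_o k 0 1 ampl.
Proof. apply big_o_plus; [apply big_o_scal, big_o_pb | apply big_o_pd]. Qed.

Lemma big_o_theta1 : big_o k 2 0 (fun x _ => theta1 x).
Proof.
  apply (big_o_eq k _ _ (fun x _ => (theta1 x - pa x ^ 2 * (3 / 2 * (h2 - 1)))
     + (3 / 2 * (h2 - 1)) * (pa x * pa x))); [intros; ring |].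
  apply big_o_plus.
  - apply (big_o_weaken k 3 0); [apply (theta1_order3 k r K M C HW) | lia | lia].
  - apply big_o_scal, (big_o_mult k 1 0 1 0); apply big_o_pa.
Qed.

Lemma big_o_theta0 : big_o k 2 0 (fun x _ => theta0 x).
Proof.
  apply (big_o_eq k _ _ (fun x _ => (theta0 x - pa x ^ 2 * (3 / 4)) + (3 / 4) * (pa x * pa x))); [intros; ring |].
  apply big_o_plus.
  - apply (big_o_weaken k 3 0); [apply (theta0_order3 k r K M C HW) | lia | lia].
  - apply big_o_scal, (big_o_mult k 1 0 1 0); apply big_o_pa.
Qed.

Lemma big_o_one_plus f : big_o k 0 1 f -> big_o k 0 0 (fun x z => 1 + f x z).
Proof.
  intros H. apply big_o_plus; [apply big_o_const |].
  apply (big_o_weaken k 0 1); [exact H | lia | lia].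
Qed.

Lemma big_o_V2 : big_o k 0 0 (fun x z => (1 + V x z) * (1 + V x z)).
Proof. apply (big_o_mult k 0 0 0 0); apply big_o_one_plus, big_o_speed. Qed.

Lemma big_o_V3 : big_o k 0 0 (fun x z => (1 + V x z) * ((1 + V x z) * (1 + V x z))).
Proof. apply (big_o_mult k 0 0 0 0); [apply big_o_one_plus, big_o_speed | apply big_o_V2]. Qed.

Let speed_sum : pfun := fun x z => (3 * V x z + E x z) + (3 * V0 x z + E0 x z).

Lemma big_o_speed_sum : big_o k 0 1 speed_sum.
Proof.
  destruct big_o_speed as (H1 & H2 & H3 & H4).
  apply big_o_plus; apply big_o_plus; auto; apply big_o_scal; auto.
Qed.

(** The divided difference of [3 v^2 + v^3] between [V0] and [V]. *)
Let slope_V : pfun := fun x z =>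
  3 * (V x z + V0 x z) + (V x z * V x z + V x z * V0 x z + V0 x z * V0 x z).

Lemma big_o_slope_V : big_o k 0 1 slope_V.
Proof.
  destruct big_o_speed as (H1 & H2 & H3 & H4). apply big_o_plus.
  - apply big_o_scal, big_o_plus; auto.
  - apply (big_o_weaken k 0 2); [| lia | lia].
    apply big_o_plus; [apply big_o_plus |]; apply (big_o_mult k 0 1 0 1); auto.
Qed.

(** Minus the divided difference of [speed_defect] with respect to [3 v + e]. It is not small; in
    [aE2] and [aV2] it is multiplied by [b1] or by the combination [ampl]. *)
Let slope_D : pfun := fun x z => s * (2 + speed_sum x z).

Lemma big_o_slope_D : big_o k 0 0 slope_D.
Proof.
  apply big_o_scal, big_o_plus; [apply big_o_const |].
  apply (big_o_weaken k 0 1); [apply big_o_speed_sum | lia | lia].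
Qed.

Let aE2 : pfun := fun x z => - / cw * (pb x * slope_D x z).
Let aE1 : pfun := fun x z => slope_V x z + 3 * aE2 x z.
Let rE : pfun := fun x z => - (theta1 x * ((1 + V x z) * ((1 + V x z) * (1 + V x z)))).
Let aV2 : pfun := fun x z => q * (s * / 2 * speed_sum x z - ampl x z * slope_D x z).
Let aV1 : pfun := fun x z =>
  q * (s * slope_V x z - (1 + / 2 * s) * (V x z + V0 x z)) + 3 * aV2 x z.
Let rV : pfun := fun x z =>
  q * (s * rE x z + (theta1 x - s * theta0 x) * ((1 + V x z) * (1 + V x z))).

Lemma big_o_slopes : big_o k 0 1 aE1 /\ big_o k 0 1 aE2 /\ big_o k 0 1 aV1 /\ big_o k 0 1 aV2.
Proof.
  destruct big_o_speed as (H1 & H2 & H3 & H4).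
  assert (A : big_o k 0 1 aE2).
  { apply big_o_scal, (big_o_mult k 0 1 0 0 (fun x _ => pb x)); [apply big_o_pb | apply big_o_slope_D]. }
  assert (B : big_o k 0 1 aV2).
  { apply big_o_scal, big_o_minus; [apply big_o_scal, big_o_speed_sum |].
    apply (big_o_mult k 0 1 0 0); [apply big_o_ampl | apply big_o_slope_D]. }
  split; [| split; [auto | split; [| auto]]].
  - apply big_o_plus; [apply big_o_slope_V | apply big_o_scal, A].
  - apply big_o_plus; [| apply big_o_scal, B].
    apply big_o_scal, big_o_minus; [apply big_o_scal, big_o_slope_V | apply big_o_scal, big_o_plus; auto].
Qed.

Lemma big_o_thetas : big_o k 2 0 (fun x _ => theta1 x - s * theta0 x).
Proof.
  apply big_o_minus; [apply big_o_theta1 |].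
  apply (big_o_scal k s 2 0 (fun x _ => theta0 x)), big_o_theta0.
Qed.

Lemma big_o_rest : big_o k 2 0 rE /\ big_o k 2 0 rV.
Proof.
  assert (A : big_o k 2 0 rE).
  { apply big_o_opp, (big_o_mult k 2 0 0 0 (fun x _ => theta1 x)); [apply big_o_theta1 | apply big_o_V3]. }
  split; [exact A |]. apply big_o_scal, big_o_plus; [apply big_o_scal, A |].
  apply (big_o_mult k 2 0 0 0 (fun x _ => theta1 x - s * theta0 x)); [apply big_o_thetas | apply big_o_V2].
Qed.

Lemma speed_difference x z : pk x = k -> tau x < r ->
  dV x z = aV1 x z * dV x z + aV2 x z * dE x z + rV x z /\
  dE x z = aE1 x z * dV x z + aE2 x z * dE x z + rE x z.
Proof.
  intros Hx Ht. destruct (speed_equations x z Hx Ht) as [F1 F2].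
  destruct (speed_equations0 x z Hx Ht) as [G1 G2].
  unfold dV, dE, aV1, aV2, aE1, aE2, rV, rE, slope_V, slope_D, speed_sum, ampl.
  set (v := V x z) in *. set (e := E x z) in *. set (v0 := V0 x z) in *. set (e0 := E0 x z) in *.
  clearbody v e v0 e0. split.
  - rewrite F2 at 1. rewrite G2 at 1. ring.
  - rewrite F1 at 1. rewrite G1 at 1. ring.
Qed.

(** A first, crude pass: the inhomogeneity consists of [theta1] and [theta0], both [O(a^2)].
    Reinserting this bound in the linear system then gives the leading terms up to [O(a^2 tau)]. *)
Lemma big_o_difference : big_o k 2 0 dV /\ big_o k 2 0 dE.
Proof.
  destruct big_o_slopes as (A1 & A2 & A3 & A4). destruct big_o_rest as (R1 & R2).
  apply (big_o_absorb k 2 0 dV dE aV1 aV2 aE1 aE2 rV rE r); auto.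
  - apply (r_pos k r K M C HW).
  - intros x z. unfold dV, V, V0. destruct (speed_const x z 0) as [_ ->].
    destruct (speed_const (at0 x) z 0) as [_ ->]. auto.
  - intros x z. unfold dE, E, E0. destruct (speed_const x z 0) as [-> _].
    destruct (speed_const (at0 x) z 0) as [-> _]. auto.
  - intros x z Hx Ht. apply speed_difference; auto.
Qed.

Lemma big_o_times_theta f g : big_o k 0 1 f -> big_o k 2 0 g -> big_o k 2 1 (fun x z => f x z * g x z).
Proof. apply (big_o_mult k 0 1 2 0). Qed.

Lemma speed_e_difference : big_o k 2 1 (fun x z => dE x z + theta1 x).
Proof.
  destruct big_o_slopes as (A1 & A2 & _ & _). destruct big_o_difference as (D1 & D2).
  destruct big_o_speed as (HV & _).
  apply (big_o_ext k r _ _ (fun x z => aE1 x z * dV x z + aE2 x z * dE x z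
    - (V x z * (3 + 3 * V x z + V x z * V x z)) * theta1 x)); [apply (r_pos k r K M C HW) | |].
  - intros x z Hx Ht. destruct (speed_difference x z Hx Ht) as [_ F]. symmetry. rewrite F at 1. unfold rE. ring.
  - apply big_o_minus; [apply big_o_plus; apply big_o_times_theta; auto |].
    apply (big_o_times_theta (fun x z => V x z * (3 + 3 * V x z + V x z * V x z)) (fun x _ => theta1 x));
      [| apply big_o_theta1].
    apply (big_o_mult k 0 1 0 0); [auto |].
    assert (HV' : big_o k 0 0 V) by (apply (big_o_weaken k 0 1); [auto | lia | lia]).
    apply big_o_plus; [apply big_o_plus; [apply big_o_const | apply big_o_scal, HV'] |].
    apply (big_o_mult k 0 0 0 0); auto.
Qed.

(** The inhomogeneity at [V = 0] is [q ((1 - s) theta1 - s theta0)], and [q (1 - s) = 1/2]. *)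
Lemma speed_v_difference :
  big_o k 2 1 (fun x z => dV x z - (/ 2 * theta1 x - q * s * theta0 x)).
Proof.
  destruct big_o_slopes as (_ & _ & A1 & A2). destruct big_o_difference as (D1 & D2).
  destruct big_o_speed as (HV & _). pose proof s_lt1.
  assert (HV' : big_o k 0 0 V) by (apply (big_o_weaken k 0 1); [auto | lia | lia]).
  apply (big_o_ext k r _ _ (fun x z => aV1 x z * dV x z + aV2 x z * dE x z
    + q * (- s * ((V x z * (3 + 3 * V x z + V x z * V x z)) * theta1 x)
           + (V x z * (2 + V x z)) * (theta1 x - s * theta0 x)))); [apply (r_pos k r K M C HW) | |].
  - intros x z Hx Ht. destruct (speed_difference x z Hx Ht) as [F _]. symmetry. rewrite F at 1. unfold rV, rE.
    unfold q. field. lra.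
  - apply big_o_plus; [apply big_o_plus; apply big_o_times_theta; auto |].
    apply big_o_scal, big_o_plus.
    + apply big_o_scal.
      apply (big_o_times_theta (fun x z => V x z * (3 + 3 * V x z + V x z * V x z)) (fun x _ => theta1 x));
        [| apply big_o_theta1].
      apply (big_o_mult k 0 1 0 0); [auto |].
      apply big_o_plus; [apply big_o_plus; [apply big_o_const | apply big_o_scal, HV'] |].
      apply (big_o_mult k 0 0 0 0); auto.
    + apply (big_o_times_theta (fun x z => V x z * (2 + V x z)) (fun x _ => theta1 x - s * theta0 x));
        [| apply big_o_thetas].
      apply (big_o_mult k 0 1 0 0); [auto |]. apply big_o_plus; [apply big_o_const | auto].
Qed.

Lemma speed_sq : big_o k 0 2 (fun x z => (3 * V x z + E x z) * (3 * V x z + E x z)) /\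
  big_o k 0 2 (fun x z => V x z * V x z) /\ big_o k 0 2 (fun x z => V x z * (V x z * V x z)) /\
  big_o k 0 1 (fun x z => 1 - s * ((1 + (3 * V x z + E x z)) * (1 + (3 * V x z + E x z))) - (1 - s)).
Proof.
  destruct big_o_speed as (HV & HE & _).
  assert (HC : big_o k 0 1 (fun x z => 3 * V x z + E x z)) by (apply big_o_plus; [apply big_o_scal |]; auto).
  assert (H2 : big_o k 0 2 (fun x z => V x z * V x z)) by (apply (big_o_mult k 0 1 0 1); auto).
  split; [apply (big_o_mult k 0 1 0 1); auto |]. split; [exact H2 |]. split.
  - apply (big_o_weaken k 0 3); [apply (big_o_mult k 0 1 0 2); auto | lia | lia].
  - apply (big_o_eq k _ _ (fun x z => - s * ((3 * V x z + E x z) * (2 + (3 * V x z + E x z))))).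
    { intros; ring. }
    apply big_o_scal, (big_o_mult k 0 1 0 0); [exact HC |].
    apply big_o_plus; [apply big_o_const | apply (big_o_weaken k 0 1); [exact HC | lia | lia]].
Qed.

Lemma big_o_cubic : big_o k 0 2 (fun x z => 3 * (V x z * V x z) + V x z * (V x z * V x z)
     - theta1 x * ((1 + V x z) * ((1 + V x z) * (1 + V x z)))).
Proof.
  destruct speed_sq as (_ & H2 & H3 & _).
  apply big_o_minus; [apply big_o_plus; [apply big_o_scal |]; auto |].
  apply (big_o_weaken k 2 0); [| lia | lia].
  apply (big_o_mult k 2 0 0 0 (fun x _ => theta1 x)); [apply big_o_theta1 | apply big_o_V3].
Qed.

Lemma speed_e_order2 : big_o k 0 2 (fun x z => E x z - pb x * / cw * (1 - s)).
Proof.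
  destruct speed_sq as (_ & _ & _ & HD).
  apply (big_o_ext k r _ _ (fun x z => (3 * (V x z * V x z) + V x z * (V x z * V x z)
     - theta1 x * ((1 + V x z) * ((1 + V x z) * (1 + V x z)))) + / cw * (pb x *
     (1 - s * ((1 + (3 * V x z + E x z)) * (1 + (3 * V x z + E x z))) - (1 - s)))));
     [apply (r_pos k r K M C HW) | |].
  - intros x z Hx Ht. destruct (speed_equations x z Hx Ht) as [F _].
    symmetry. rewrite F at 1. ring.
  - apply big_o_plus; [apply big_o_cubic |].
    apply big_o_scal, (big_o_mult k 0 1 0 1 (fun x _ => pb x)); [apply big_o_pb | exact HD].
Qed.

(** To first order [speed_defect] is [1 - s], and again [q (1 - s) = 1/2]. *)
Lemma speed_v_order2 : big_o k 0 2 (fun x z => V x z - / 2 * (cw * pb x + pd x)).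
Proof.
  destruct speed_sq as (HC & H2 & _ & HD). pose proof s_lt1.
  apply (big_o_ext k r _ _ (fun x z => q * (s * ((3 * (V x z * V x z) + V x z * (V x z * V x z)
     - theta1 x * ((1 + V x z) * ((1 + V x z) * (1 + V x z))))
     + / 2 * ((3 * V x z + E x z) * (3 * V x z + E x z)))
   + ampl x z * (1 - s * ((1 + (3 * V x z + E x z)) * (1 + (3 * V x z + E x z))) - (1 - s))
   - (1 + / 2 * s) * (V x z * V x z)
   + (theta1 x - s * theta0 x) * ((1 + V x z) * (1 + V x z))))); [apply (r_pos k r K M C HW) | |].
  - intros x z Hx Ht. destruct (speed_equations x z Hx Ht) as [_ F]. symmetry. rewrite F at 1.
    unfold ampl, q. field. lra.
  - apply big_o_scal, big_o_plus; [apply big_o_minus; [apply big_o_plus |] |].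
    + apply big_o_scal, big_o_plus; [apply big_o_cubic | apply big_o_scal, HC].
    + apply (big_o_mult k 0 1 0 1); [apply big_o_ampl | exact HD].
    + apply big_o_scal, H2.
    + apply (big_o_weaken k 2 0); [| lia | lia].
      apply (big_o_mult k 2 0 0 0 (fun x _ => theta1 x - s * theta0 x)); [apply big_o_thetas | apply big_o_V2].
Qed.

(** The change of [c / cw] is [3 dV + dE], to leading order [theta1 / 2 - 3 q s theta0]. The first
    term gives [3/4 a^2 (h2 - 1)], the second [3/2 a^2 h0]. *)
Lemma wave_c_expansion : big_o k 1 2 (fun x z =>
  wave_c x z - (wave_c (at0 x) z + 3 / 4 * pa x ^ 2 * cw * (2 * h0 + h2 - 1))).
Proof.
  pose proof s_lt1.
  apply (big_o_eq k _ _ (fun x z => cw * (3 * (dV x z - (/ 2 * theta1 x - q * s * theta0 x))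
     + (dE x z + theta1 x) + / 2 * (theta1 x - pa x ^ 2 * (3 / 2 * (h2 - 1)))
     + - (3 * q * s) * (theta0 x - pa x ^ 2 * (3 / 4))))).
  - intros x z Hx. unfold wave_c, speed_factor. change (pk (at0 x)) with (pk x). rewrite Hx.
    fold cw. unfold dV, dE, V, V0, E, E0, q, h0. field. lra.
  - apply big_o_scal, big_o_plus; [apply big_o_plus; [apply big_o_plus |] |].
    + apply big_o_scal. apply (big_o_weaken k 2 1); [apply speed_v_difference | lia | lia].
    + apply (big_o_weaken k 2 1); [apply speed_e_difference | lia | lia].
    + apply (big_o_scal k (/ 2) 1 2 (fun x _ => theta1 x - pa x ^ 2 * (3 / 2 * (h2 - 1)))).
      apply (big_o_weaken k 3 0); [apply (theta1_order3 k r K M C HW) | lia | lia].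
    + apply (big_o_scal k _ 1 2 (fun x _ => theta0 x - pa x ^ 2 * (3 / 4))).
      apply (big_o_weaken k 3 0); [apply (theta0_order3 k r K M C HW) | lia | lia].
Qed.

(* The coefficient [h0] arises as [-2 q s * 3/4]. *)
Lemma mean_shift :
  big_o k 2 1 (fun x z => 2 * dV x z - theta1 x - pa x ^ 2 * h0).
Proof.
  pose proof s_lt1.
  apply (big_o_eq k _ _ (fun x z => 2 * (dV x z - (/ 2 * theta1 x - q * s * theta0 x))
    + - (2 * q * s) * (theta0 x - pa x ^ 2 * (3 / 4)))).
  { intros. unfold q, h0. field. lra. }
  apply big_o_plus; [apply big_o_scal, speed_v_difference |].
  apply (big_o_scal k _ 2 1 (fun x _ => theta0 x - pa x ^ 2 * (3 / 4))).
  apply (big_o_weaken k 3 0); [apply (theta0_order3 k r K M C HW) | lia | lia].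
Qed.

Lemma wave_depth_order2 : big_o k 0 2 (fun x z => wave_depth x z - 1 - (cw * pb x + pd x)).
Proof.
  destruct speed_sq as (_ & H2 & _).
  apply (big_o_eq k _ _ (fun x z => 2 * (V x z - / 2 * (cw * pb x + pd x)) + V x z * V x z
     - theta1 x * ((1 + V x z) * (1 + V x z)))).
  { intros. unfold wave_depth, V. field. }
  apply big_o_minus; [apply big_o_plus; [apply big_o_scal, speed_v_order2 | exact H2] |].
  apply (big_o_weaken k 2 0); [| lia | lia].
  apply (big_o_mult k 2 0 0 0 (fun x _ => theta1 x)); [apply big_o_theta1 | apply big_o_V2].
Qed.

Lemma wave_depth_order1 : big_o k 0 1 (fun x z => wave_depth x z - 1).
Proof.
  apply (big_o_eq k _ _ (fun x z => (wave_depth x z - 1 - (cw * pb x + pd x)) + ampl x z)).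
  { intros; unfold ampl; ring. }
  apply big_o_plus; [apply (big_o_weaken k 0 2); [apply wave_depth_order2 | lia | lia] | apply big_o_ampl].
Qed.

(** The mean comes from the change of the depth factor, while the factor multiplying [a cos z] is
    the depth itself, [1 + cw b1 + b2] to first order. *)
Lemma wave_eta_expansion : big_o k 1 2 (fun x z =>
  wave_eta x z - (wave_eta (at0 x) z + pa x * cos z + pa x * (pb x * cw + pd x) * cos z
    + pa x ^ 2 * (h0 + h2 * cos (2 * z)))).
Proof.
  destruct big_o_speed as (HV & HE & HV0 & HE0). destruct big_o_difference as (D1 & _).
  apply (big_o_eq k _ _ (fun x z => (2 * dV x z - theta1 x - pa x ^ 2 * h0)
    + (V x z + V0 x z) * dV x z - (V x z * (2 + V x z)) * theta1 x
    + pa x * ((wave_depth x z - 1 - (cw * pb x + pd x)) * cos z)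
    + pa x * ((wave_depth x z - 1) * (profile_h x z - cos z))
    + pa x * (profile_h x z - cos z - pa x * (h2 * cos (2 * z))))).
  - intros x z Hx. unfold wave_eta.
    assert (W : wave_depth (at0 x) z = (1 + V0 x z) * (1 + V0 x z)).
    { unfold wave_depth. unfold theta1, at0; cbn [pa]. unfold V0, at0. ring. }
    rewrite W. change (pa (at0 x)) with 0.
    unfold wave_depth. fold V. unfold dV. ring.
  - apply big_o_plus; [apply big_o_plus; [apply big_o_plus; [apply big_o_plus; [apply big_o_plus |] |] |] |].
    + apply (big_o_weaken k 2 1); [apply mean_shift | lia | lia].
    + apply (big_o_weaken k 2 1); [| lia | lia]. apply (big_o_mult k 0 1 2 0); [apply big_o_plus; auto | auto].
    + apply (big_o_weaken k 2 1); [| lia | lia].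
      apply big_o_opp, (big_o_times_theta (fun x z => V x z * (2 + V x z)) (fun x _ => theta1 x));
        [| apply big_o_theta1].
      apply (big_o_mult k 0 1 0 0); [auto |]. apply big_o_plus; [apply big_o_const |].
      apply (big_o_weaken k 0 1); [auto | lia | lia].
    + apply (big_o_mult k 1 0 0 2 (fun x _ => pa x)); [apply big_o_pa |].
      apply (big_o_mult k 0 2 0 0); [apply wave_depth_order2 | apply big_o_cos1].
    + apply (big_o_weaken k 2 1); [| lia | lia].
      apply (big_o_mult k 1 0 1 1 (fun x _ => pa x)); [apply big_o_pa |].
      apply (big_o_mult k 0 1 1 0); [apply wave_depth_order1 | apply (profile_h_order1 k r K M C HW)].
    + apply (big_o_weaken k 3 0); [| lia | lia].
      apply (big_o_mult k 1 0 2 0 (fun x _ => pa x)); [apply big_o_pa |].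
      apply (profile_h_order2 k r K M C HW).
Qed.

(** Both halves subtracted from [h0] and [h2] come from the term [a cos^2 z] of [profile_w], as
    [cos^2 z = (1 + cos 2z) / 2]. The mean is [2 dV + dE], in which [theta1] cancels. *)
Lemma wave_u_expansion : big_o k 1 2 (fun x z =>
  wave_u x z - (wave_u (at0 x) z + pa x * cw * cos z + / 2 * pa x * cw * (pb x * cw + pd x) * cos z
    + pa x ^ 2 * cw * (h0 - / 2 + (h2 - / 2) * cos (2 * z)))).
Proof.
  destruct big_o_speed as (HV & HE & HV0 & HE0).
  apply (big_o_eq k _ _ (fun x z => cw * ((2 * dV x z - theta1 x - pa x ^ 2 * h0)
    + (dE x z + theta1 x)
    - pa x * (profile_w x z + cos z + pa x * (h2 * cos (2 * z)) - pa x * (cos z * cos z))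
    - pa x * (V x z * (profile_w x z + cos z))
    + pa x * ((V x z - / 2 * (cw * pb x + pd x)) * cos z)))).
  - intros x z Hx. unfold wave_u, wave_c, speed_factor. change (pk (at0 x)) with (pk x).
    change (pa (at0 x)) with 0. rewrite Hx. fold cw. fold V E.
    change (V (at0 x) z) with (V0 x z). change (E (at0 x) z) with (E0 x z).
    rewrite cos_2a_cos. unfold dV, dE. field.
  - apply big_o_scal, big_o_plus; [apply big_o_plus; [apply big_o_plus; [apply big_o_plus |] |] |].
    + apply (big_o_weaken k 2 1); [apply mean_shift | lia | lia].
    + apply (big_o_weaken k 2 1); [apply speed_e_difference | lia | lia].
    + apply (big_o_weaken k 3 0); [| lia | lia].
      apply big_o_opp, (big_o_mult k 1 0 2 0 (fun x _ => pa x)); [apply big_o_pa |].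
      apply (profile_w_order2 k r K M C HW).
    + apply (big_o_weaken k 2 1); [| lia | lia].
      apply big_o_opp, (big_o_mult k 1 0 1 1 (fun x _ => pa x)); [apply big_o_pa |].
      apply (big_o_mult k 0 1 1 0); [auto | apply (profile_w_order1 k r K M C HW)].
    + apply (big_o_mult k 1 0 0 2 (fun x _ => pa x)); [apply big_o_pa |].
      apply (big_o_mult k 0 2 0 0); [apply speed_v_order2 | apply big_o_cos1].
Qed.

Lemma wave_c_order2 : big_o k 0 2 (fun x z =>
  wave_c x z - (cw + pb x * (/ 2 * s + 1) + 3 / 2 * pd x * cw)).
Proof.
  pose proof cw_pos.
  apply (big_o_eq k _ _ (fun x z => cw * (3 * (V x z - / 2 * (cw * pb x + pd x))
    + (E x z - pb x * / cw * (1 - s))))).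
  - intros x z Hx. unfold wave_c, speed_factor. rewrite Hx. fold cw V E.
    rewrite <- cw_sq. field. lra.
  - apply big_o_scal, big_o_plus; [apply big_o_scal, speed_v_order2 | apply speed_e_order2].
Qed.

Lemma wave_means_order2 x z : pa x = 0 -> pk x = k ->
  wave_eta x z - (pb x * cw + pd x) = wave_depth x z - 1 - (cw * pb x + pd x) /\
  wave_u x z - (pb x + pd x * cw) =
    cw * (2 * (V x z - / 2 * (cw * pb x + pd x)) + (E x z - pb x * / cw * (1 - s))).
Proof.
  intros Ha Hx. pose proof cw_pos. unfold wave_eta, wave_u, wave_c, speed_factor.
  rewrite Ha, Hx. fold cw V E. split; [ring |]. rewrite <- cw_sq. field. lra.
Qed.
End SpeedExpansion.

(** * Assembly of the family *)

Lemma normed_waves k r K M C p rho : wave_radius k r K M C -> pk p = k -> 0 <= rho ->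
  small_params r p rho ->
  exists B, normed p rho wave_eta B /\ normed p rho wave_u B /\ normed p rho wave_c B.
Proof.
  intros HW Hp Hr Hsm. pose proof Hsm as (Ha & _ & _). pose proof (Rabs_pos (pa p)).
  destruct (wr_speed HW p rho r Hp Hr (Rle_refl r) Hsm) as (NE & NV & _).
  destruct (wr_theta HW p rho Hp Hr Ha) as [NT _].
  destruct (wr_norms HW p rho Hp ltac:(lra)) as (_ & NC & _).
  destruct (wr_profile HW p rho Hp ltac:(lra) ltac:(lra)) as (_ & _ & Nh & Nw & _).
  pose proof (normed_one p rho Hr) as N1. pose proof (normed_pa p rho Hr) as Na.
  pose proof (normed_plus N1 NV) as N1V.
  pose proof (normed_plus N1 (normed_plus (normed_scal _ _ 3 _ _ NV) NE)) as Nsf.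
  pose proof (normed_mult NC Nsf) as Nc.
  pose proof (normed_mult (normed_mult N1V N1V) (normed_minus N1 NT)) as Nd.
  pose proof (normed_minus (normed_mult Nd
    (normed_plus N1 (normed_mult Na Nh))) N1) as Neta.
  pose proof (normed_minus Nc (normed_mult (normed_mult NC N1V)
    (normed_plus N1 (normed_mult Na Nw)))) as Nu.
  match type of Neta with normed _ _ _ ?X => match type of Nu with normed _ _ _ ?Y =>
    match type of Nc with normed _ _ _ ?Z => exists (Rmax X (Rmax Y Z)) end end end.
  split; [| split].
  - eapply normed_le; [exact Neta | apply Rmax_l].
  - eapply normed_le; [exact Nu | eapply Rle_trans; [apply Rmax_l | apply Rmax_r]].
  - eapply normed_le; [exact Nc | eapply Rle_trans; [apply Rmax_r | apply Rmax_r]].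
Qed.

Lemma wave_c_const x z z' : wave_c x z = wave_c x z'.
Proof. unfold wave_c, speed_factor. destruct (speed_const x z z') as [-> ->]. reflexivity. Qed.

Lemma wave_const_at0 x z z' : pa x = 0 -> wave_eta x z = wave_eta x z' /\ wave_u x z = wave_u x z'.
Proof.
  intros Ha. unfold wave_eta, wave_u, wave_depth. rewrite (wave_c_const x z z'), Ha.
  destruct (speed_const x z z') as [_ ->]. split; ring.
Qed.

Lemma wave_c_reflect k r K M C x : wave_radius k r K M C -> pk x = k -> Rabs (pa x) <= r ->
  wave_c (reflect x) 0 = wave_c x 0.
Proof.
  intros HW Hx Ha. pose proof (wr_pos HW).
  destruct (theta_reflect k r K x (wr_profile HW) Hx Ha ltac:(lra)) as [T1 T0].
  unfold wave_c, speed_factor. destruct (speed_reflect x 0 T1 T0) as [-> ->]. reflexivity.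
Qed.

Lemma second_harmonic k : 0 < k ->
  3 / 4 * (cww2 k / (cww2 k - cww2 (2 * k))) = 3 / 4 * resolvent_symbol 2 k.
Proof.
  intros Hk. pose proof (speed_ratio_lt1 2 k Hk (le_n _)) as H. pose proof (cww2_pos k Hk).
  unfold resolvent_symbol, speed_ratio in *. change (Nat.ltb 2 2) with false. cbv iota.
  replace (INR 2) with 2 in * by (simpl; ring).
  set (y := cww2 (2 * k)) in *. set (s := cww2 k) in *.
  assert (y < s).
  { apply Rmult_lt_reg_r with (/ s); [apply Rinv_0_lt_compat; lra |]. rewrite Rinv_r by lra. exact H. }
  field. lra.
Qed.

Theorem theorem2p1 :
  exists (r : R -> R)
         (eta u : R -> R -> R -> R -> R -> R)   (* a kappa b1 b2 z *)
         (c : R -> R -> R -> R -> R)             (* a kappa b1 b2 *)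
         (eta0 u0 c0 : R -> R -> R -> R),        (* kappa b1 b2 *)
    (forall kappa, 0 < kappa -> 0 < r kappa) /\
    (* solutions on the domain 0 < kappa, |a|,|b1|,|b2| < r kappa *)
    (forall a kappa b1 b2, 0 < kappa ->
       Rabs a < r kappa -> Rabs b1 < r kappa -> Rabs b2 < r kappa ->
       tw_system kappa b1 b2 (c a kappa b1 b2) (eta a kappa b1 b2) (u a kappa b1 b2) /\
       periodic2pi (eta a kappa b1 b2) /\ periodic2pi (u a kappa b1 b2) /\
       even_fun (eta a kappa b1 b2) /\ even_fun (u a kappa b1 b2) /\
       smooth (eta a kappa b1 b2) /\ smooth (u a kappa b1 b2) /\
       c (- a) kappa b1 b2 = c a kappa b1 b2 /\
       analytic4_at eta a kappa b1 b2 /\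
       analytic4_at u a kappa b1 b2 /\
       analytic4_at (fun a' k' b1' b2' (_ : R) => c a' k' b1' b2') a kappa b1 b2) /\
    (* asymptotics as a, b1, b2 -> 0, for each fixed kappa *)
    (forall kappa, 0 < kappa ->
       let cw := cww kappa in
       let h0 := 3 / 4 * (cww2 kappa / (cww2 kappa - 1)) in
       let h2 := 3 / 4 * (cww2 kappa / (cww2 kappa - cww2 (2 * kappa))) in
       (exists C rho, 0 < rho /\ rho <= r kappa /\
          forall a b1 b2, Rabs a < rho -> Rabs b1 < rho -> Rabs b2 < rho ->
            let err := C * Rabs a * (Rabs a + Rabs b1 + Rabs b2) ^ 2 in
            (forall z,
               Rabs (eta a kappa b1 b2 z -
                 (eta0 kappa b1 b2 + a * cos z + a * (b1 * cw + b2) * cos z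
                  + a ^ 2 * (h0 + h2 * cos (2 * z)))) <= err) /\
            (forall z,
               Rabs (u a kappa b1 b2 z -
                 (u0 kappa b1 b2 + a * cw * cos z
                  + / 2 * a * cw * (b1 * cw + b2) * cos z
                  + a ^ 2 * cw * (h0 - / 2 + (h2 - / 2) * cos (2 * z)))) <= err) /\
            Rabs (c a kappa b1 b2 -
                 (c0 kappa b1 b2 + 3 / 4 * a ^ 2 * cw * (2 * h0 + h2 - 1))) <= err) /\
       (exists C rho, 0 < rho /\
          forall b1 b2, Rabs b1 < rho -> Rabs b2 < rho ->
            let err := C * (Rabs b1 + Rabs b2) ^ 2 in
            Rabs (eta0 kappa b1 b2 - (b1 * cw + b2)) <= err /\
            Rabs (u0 kappa b1 b2 - (b1 + b2 * cw)) <= err /\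
            Rabs (c0 kappa b1 b2 -
                  (cw + b1 * (/ 2 * cww2 kappa + 1) + 3 / 2 * b2 * cw)) <= err)).
Proof.
  (* The domain uses half of the available radius, so at each of its points the expansions converge
     on a polydisc of radius [r k]. For nonpositive [k] the value 0 is a default. *)
  assert (Hr : forall k, exists r, 0 < k -> 0 < r /\ exists K M C, wave_radius k (2 * r) K M C).
  { intros k. destruct (Rlt_dec 0 k) as [Hk | Hk]; [| exists 0; lra].
    destruct (wave_radius_exists k Hk) as (r & K & M & C & HW). exists (r / 2). intros _.
    split; [pose proof (wr_pos HW); lra |].
    exists K, M, C. replace (2 * (r / 2)) with r by field. exact HW. }
  destruct (functional_choice _ Hr) as [r Hr']. clear Hr.
  exists r, (fun a k b d z => wave_eta (Pt a k b d) z), (fun a k b d z => wave_u (Pt a k b d) z),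
    (fun a k b d => wave_c (Pt a k b d) 0),
    (fun k b d => wave_eta (Pt 0 k b d) 0), (fun k b d => wave_u (Pt 0 k b d) 0),
    (fun k b d => wave_c (Pt 0 k b d) 0).
  split; [intros k Hk; apply Hr'; auto |]. split.
  - intros a k b d Hk Ha Hb Hd. destruct (Hr' k Hk) as (Hr & K & M & C & HW).
    set (x := Pt a k b d).
    assert (Hx : pk x = k) by reflexivity.
    assert (Hsm : small_params (2 * r k) x (r k)) by (repeat split; simpl; lra).
    assert (Hsm0 : small_params (2 * r k) x 0) by (repeat split; simpl; lra).
    destruct (normed_waves _ _ _ _ _ x (r k) HW Hx ltac:(lra) Hsm) as (B & Ne & Nu & Nc).
    pose proof (box_center x (r k) ltac:(lra)) as Bx.
    pose proof (normed_slice Ne Bx) as Ce. pose proof (normed_slice Nu Bx) as Cu.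
    split; [exact (wave_solves k (2 * r k) K M C Hk HW x Hx Hsm0) |].
    split; [exact (cosine_series_periodic _ _ Ce) |]. split; [exact (cosine_series_periodic _ _ Cu) |].
    split; [exact (cosine_series_even _ _ Ce) |]. split; [exact (cosine_series_even _ _ Cu) |].
    split; [exact (cosine_series_smooth _ _ Ce) |]. split; [exact (cosine_series_smooth _ _ Cu) |].
    split; [exact (wave_c_reflect k (2 * r k) K M C x HW Hx ltac:(simpl; lra)) |].
    split; [exact (normed_analytic4_at x (r k) wave_eta B Hr Ne) |].
    split; [exact (normed_analytic4_at x (r k) wave_u B Hr Nu) |].
    apply (normed_analytic4_at x (r k) (fun y _ => wave_c y 0) B Hr).
    eapply normed_ext; [| exact Nc]. intros; apply wave_c_const.
  - intros k Hk cw h0 h2. destruct (Hr' k Hk) as (Hr & K & M & C & HW). split.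
    + pose proof (wave_eta_expansion k _ K M C Hk HW) as X1.
      pose proof (wave_u_expansion k _ K M C Hk HW) as X2.
      pose proof (wave_c_expansion k _ K M C Hk HW) as X3.
      rewrite <- (second_harmonic k Hk) in X1, X2, X3.
      apply big_o_bound in X1, X2, X3.
      destruct X1 as (C1 & r1 & P1 & Q1 & X1). destruct X2 as (C2 & r2 & P2 & Q2 & X2).
      destruct X3 as (C3 & r3 & P3 & Q3 & X3).
      set (m := Rmin (r k) (Rmin r1 (Rmin r2 r3))).
      assert (Hm : 0 < m) by (repeat apply Rmin_glb_lt; auto).
      pose proof (Rmin_l (r k) (Rmin r1 (Rmin r2 r3))). pose proof (Rmin_r (r k) (Rmin r1 (Rmin r2 r3))).
      pose proof (Rmin_l r1 (Rmin r2 r3)). pose proof (Rmin_r r1 (Rmin r2 r3)).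
      pose proof (Rmin_l r2 r3). pose proof (Rmin_r r2 r3). fold m in H, H0.
      exists (C1 + C2 + C3), (m / 3). split; [lra |]. split; [lra |].
      intros a b d Ha Hb Hd err. set (x := Pt a k b d).
      assert (Ht : tau x < m) by (unfold tau, x; simpl; lra).
      assert (Hw : 0 <= Rabs a * (Rabs a + Rabs b + Rabs d) ^ 2).
      { apply Rmult_le_pos; [apply Rabs_pos | apply pow2_ge_0]. }
      assert (Herr : forall D, D <= C1 + C2 + C3 -> D * (Rabs (pa x) ^ 1 * tau x ^ 2) <= err).
      { intros D HD. unfold err, tau, x. cbn [pa pb pd]. rewrite pow_1, Rmult_assoc.
        apply Rmult_le_compat_r; auto. }
      change (Pt 0 k b d) with (at0 x).
      split; [| split].
      (* [eta0] is the value at [z = 0] of the wave of zero amplitude, which is constant in [z]. *)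
      * intros z. destruct (wave_const_at0 (at0 x) 0 z eq_refl) as [-> _].
        eapply Rle_trans; [exact (X1 x z eq_refl ltac:(lra)) | apply Herr; lra].
      * intros z. destruct (wave_const_at0 (at0 x) 0 z eq_refl) as [_ ->].
        eapply Rle_trans; [exact (X2 x z eq_refl ltac:(lra)) | apply Herr; lra].
      * eapply Rle_trans; [exact (X3 x 0 eq_refl ltac:(lra)) | apply Herr; lra].
    + pose proof (wave_depth_order2 k _ K M C Hk HW) as X1.
      pose proof (speed_v_order2 k _ K M C Hk HW) as X2v.
      pose proof (speed_e_order2 k _ K M C HW) as X2e.
      pose proof (big_o_scal k cw 0 2 _ (big_o_plus k 0 2 _ _ (big_o_scal k 2 0 2 _ X2v) X2e)) as X2.
      pose proof (wave_c_order2 k _ K M C Hk HW) as X3.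
      apply big_o_bound in X1, X2, X3.
      destruct X1 as (C1 & r1 & P1 & Q1 & X1). destruct X2 as (C2 & r2 & P2 & Q2 & X2).
      destruct X3 as (C3 & r3 & P3 & Q3 & X3).
      set (m := Rmin r1 (Rmin r2 r3)).
      assert (Hm : 0 < m) by (repeat apply Rmin_glb_lt; auto).
      pose proof (Rmin_l r1 (Rmin r2 r3)). pose proof (Rmin_r r1 (Rmin r2 r3)).
      pose proof (Rmin_l r2 r3). pose proof (Rmin_r r2 r3). fold m in H, H0.
      exists (C1 + C2 + C3), (m / 2). split; [lra |].
      intros b d Hb Hd err. set (x := Pt 0 k b d).
      assert (Et : tau x = Rabs b + Rabs d) by (unfold tau, x; simpl; rewrite Rabs_R0; ring).
      assert (Ht : tau x < m) by (rewrite Et; lra).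
      assert (Herr : forall D, D <= C1 + C2 + C3 -> D * (Rabs (pa x) ^ 0 * tau x ^ 2) <= err).
      { intros D HD. unfold err. rewrite Et, pow_O, Rmult_1_l.
        apply Rmult_le_compat_r; [apply pow2_ge_0 | auto]. }
      destruct (wave_means_order2 k Hk x 0 eq_refl eq_refl) as [E1 E2].
      cbn [pb pd x] in E1, E2.
      split; [| split].
      * unfold cw. rewrite E1.
        eapply Rle_trans; [exact (X1 x 0 eq_refl ltac:(lra)) | apply Herr; lra].
      * unfold cw. rewrite E2.
        eapply Rle_trans; [exact (X2 x 0 eq_refl ltac:(lra)) | apply Herr; lra].
      * eapply Rle_trans; [exact (X3 x 0 eq_refl ltac:(lra)) | apply Herr; lra].
Qed.
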